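(* Let $d\ge 1$, $(g,\mu)\in[0,+\infty)^2$, $T>0$, and let $h\in C^\infty([0,T]\times\mathbf{T}^d)$ be a smooth solution to $$\partial_t h+G(h)(gh+\mu\kappa)=0 .$$ Then, for all $t\in[0,T]$, $$\frac{d}{dt}\int_{\mathbf{T}^d}h(t,x)^2\,dx\le 0\qquad\text{and}\qquad \frac{d}{dt}\int_{\mathbf{T}^d}\sqrt{1+|\nabla h(t,x)|^2}\,dx\le 0 .$$
   Context: $\mathbf{T}^d$ is a $d$-dimensional (flat) torus, $\nabla=\nabla_x$ and $\operatorname{div}=\operatorname{div}_x$ act on the horizontal variable $x\in\mathbf{T}^d$ only. For a function $h=h(x)$, $\kappa=-\operatorname{div}\Big(\frac{\nabla h}{\sqrt{1+|\nabla h|^2}}\Big)$ is the mean curvature of the graph $\Sigma=\{y=h(x)\}$, and $\int_{\mathbf{T}^d}\sqrt{1+|\nabla h|^2}\,dx=\mathcal{H}^d(\Sigma)$ is its area. $G(h)$ is the Dirichlet-to-Neumann operator: let $\Omega=\{(x,y)\in\mathbf{T}^d\times\mathbf{R}: y<h(x)\}$; for smooth $\psi:\mathbf{T}^d\to\mathbf{R}$ let $\mathcal{H}(\psi)$ be the harmonic extension of $\psi$, i.e. the unique $\phi\in C^\infty(\overline\Omega)$ with $\nabla_{x,y}\phi\in L^2(\Omega)$, $\Delta_{x,y}\phi=0$ in $\Omega$, $\phi(x,h(x))=\psi(x)$. Then $$G(h)\psi(x)=\sqrt{1+|\nabla h|^2}\,\partial_n\mathcal{H}(\psi)\big|_{y=h(x)}=\big(\partial_y\mathcal{H}(\psi)-\nabla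 h\cdot\nabla\mathcal{H}(\psi)\big)\big|_{y=h(x)},$$ where $n=\frac{1}{\sqrt{1+|\nabla h|^2}}(-\nabla h,1)$ is the outward unit normal. In the evolution equation, $G(h)$ and $\kappa$ are computed at each fixed time $t$. *)

(* Defs.v *)
From HB Require Import structures.
From mathcomp Require Import all_boot all_order all_algebra.
From mathcomp Require Import all_classical all_reals all_analysis.

Set Implicit Arguments.
Unset Strict Implicit.
Unset Printing Implicit Defensive.

Import Order.TTheory GRing.Theory Num.Theory.
Import numFieldNormedType.Exports.

Local Open Scope classical_set_scope.
Local Open Scope ring_scope.

Fixpoint Ck (R : realType) (V : normedModType R) (k : nat) (f : V -> R) : Prop :=
  match k with
  | 0%N => continuous f
  | k'.+1 => (forall x, differentiable f x) /\ (forall v, Ck k' ('D_v f))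
  end.

Definition smooth (R : realType) (V : normedModType R) (f : V -> R) : Prop :=
  forall k, Ck k f.

(* The flat torus is 'rV[R]_d modulo the lattice spanned by the rows of an
   invertible matrix B; functions on it are functions on 'rV[R]_d invariant
   under that lattice. *)
Definition lattice_periodic (R : realType) (d : nat) (B : 'M[R]_d)
    (f : 'rV[R]_d -> R) : Prop :=
  forall (i : 'I_d) (x : 'rV[R]_d), f (x + row i B) = f x.

(* Integral over the unit cube [0,1]^d as an iterated Lebesgue integral. It is
   only applied to continuous functions and to nonnegative lower semicontinuous
   ones, for which it is the d-dimensional Lebesgue integral by Fubini-Tonelli. *)
Fixpoint cube_integral (R : realType) (d : nat) :
    ('rV[R]_d -> \bar R) -> \bar R :=
  match d with
  | 0%N => fun f => f 0
  | d'.+1 => fun f =>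
      (\int[lebesgue_measure]_(s in `[0%R, 1%R])
         cube_integral (fun u : 'rV[R]_d' =>
           f (row_mx (s%:M : 'rV[R]_1) u : 'rV[R]_(1 + d'))))%E
  end.

(* u |-> u *m B maps the unit cube onto a fundamental domain of the lattice and
   has Jacobian determinant \det B. *)
Definition torus_eintegral (R : realType) (d : nat) (B : 'M[R]_d)
    (f : 'rV[R]_d -> \bar R) : \bar R :=
  (`|\det B|%:E * cube_integral (fun u => f (u *m B)))%E.

Definition torus_integral (R : realType) (d : nat) (B : 'M[R]_d)
    (f : 'rV[R]_d -> R) : R :=
  fine (torus_eintegral B (fun x => (f x)%:E)).

Definition grad (R : realType) (d : nat) (f : 'rV[R]_d -> R)
    (x : 'rV[R]_d) : 'rV[R]_d :=
  \row_i 'D_(delta_mx 0 i) f x.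

Definition div (R : realType) (d : nat) (F : 'rV[R]_d -> 'rV[R]_d)
    (x : 'rV[R]_d) : R :=
  \sum_i 'D_(delta_mx 0 i) (fun z => F z 0 i) x.

(* Euclidean inner product; the library norm on 'rV[R]_d is the sup norm, so
   |v|^2 is written dot v v. *)
Definition dot (R : realType) (d : nat) (u v : 'rV[R]_d) : R :=
  \sum_i u 0 i * v 0 i.

Definition area_density (R : realType) (d : nat) (h : 'rV[R]_d -> R)
    (x : 'rV[R]_d) : R :=
  Num.sqrt (1 + dot (grad h x) (grad h x)).

Definition mean_curvature (R : realType) (d : nat) (h : 'rV[R]_d -> R)
    (x : 'rV[R]_d) : R :=
  - div (fun z => (area_density h z)^-1 *: grad h z) x.

Definition dx (R : realType) (d : nat) (i : 'I_d) (phi : 'rV[R]_d * R -> R) :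
    'rV[R]_d * R -> R :=
  'D_(delta_mx 0 i : 'rV[R]_d, 0 : R) phi.

Definition dy (R : realType) (d : nat) (phi : 'rV[R]_d * R -> R) :
    'rV[R]_d * R -> R :=
  'D_(0 : 'rV[R]_d, 1 : R) phi.

(* phi is the harmonic extension of psi to Omega = {y < h(x)}. An element of
   C^oo(closure of Omega) is represented by a smooth function on the whole
   'rV[R]_d * R, of which only the restriction to the closure of Omega matters:
   its derivatives at boundary points are determined by that restriction. *)
Definition harmonic_extension (R : realType) (d : nat) (B : 'M[R]_d)
    (h psi : 'rV[R]_d -> R) (phi : 'rV[R]_d * R -> R) : Prop :=
  [/\ smooth phi /\ (forall y, lattice_periodic B (fun x => phi (x, y))),
      (torus_eintegral B (fun x =>
         \int[lebesgue_measure]_(y in `]-oo, h x[)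
           (\sum_i (dx i phi (x, y)) ^+ 2 + (dy phi (x, y)) ^+ 2)%:E)
       < +oo)%E,
      (forall x y, y < h x ->
         \sum_i dx i (dx i phi) (x, y) + dy (dy phi) (x, y) = 0)
    & (forall x, phi (x, h x) = psi x)].

(* G is the Dirichlet-to-Neumann operator G(h), acting on smooth functions on
   the torus. *)
Definition is_dirichlet_to_neumann (R : realType) (d : nat) (B : 'M[R]_d)
    (h : 'rV[R]_d -> R) (G : ('rV[R]_d -> R) -> 'rV[R]_d -> R) : Prop :=
  forall psi, smooth psi -> lattice_periodic B psi ->
    exists2 phi, harmonic_extension B h psi phi &
      forall x, G psi x = dy phi (x, h x)
                          - dot (grad h x) (\row_i dx i phi (x, h x)).

(* Main.v *)
Require Import Defs.
From HB Require Import structures.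
From mathcomp Require Import all_boot all_order all_algebra.
From mathcomp Require Import all_classical all_reals all_analysis.
From mathcomp Require Import ring lra.

Set Implicit Arguments.
Unset Strict Implicit.
Unset Printing Implicit Defensive.

Import Order.TTheory GRing.Theory Num.Theory.
Import numFieldNormedType.Exports.

Local Open Scope classical_set_scope.
Local Open Scope ring_scope.

(* Write psi = g h + mu kappa. The two derivatives are - 2 int h G(h) psi and
   - int kappa G(h) psi. Since G(h) is self-adjoint and nonnegative, both are
   nonpositive as soon as int kappa G(h) h >= 0.

   Let phi be the harmonic extension of h and P = phi - y, which is harmonic and
   vanishes on the surface. On the surface G(h) h = 1 + sqrt(1 + |grad h|^2) d_n P,
   int kappa = 0, P >= 0 below it makes d_n P = - |grad P|, and kappa d_n P is minus
   the second normal derivative of P; hence int kappa G(h) h is the flux of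
   grad |grad P|, which is nonnegative because |grad P| is subharmonic. As
   |grad P| may vanish, it is replaced by sqrt(eta^2 + |grad P|^2), eta -> 0.

   All divergence-theorem arguments use fluxes through the translated surfaces
   y = h(x) + z, z <= 0: these are integrals over a fixed torus, and the divergence
   theorem reads: the z-derivative of the flux is the integral of the divergence.
   Finiteness of the Dirichlet energy is what makes the fluxes vanish along a
   sequence z -> - oo. *)

(** * Smooth functions and the symmetry of second derivatives *)

Section Derivatives.
Context {R : realType} {V : normedModType R}.
Implicit Types (f g : V -> R) (x v w : V).

(** Finite energy is the only information at infinite depth: [phi] is not known to be bounded, and
    no second derivative is known to decay. A layer energy with finite integral is below any
    [c / (1 - z)] at some arbitrarily large depth, while the integral of [phi^2] over a layer grows
    at most like [1 - z]; the two together control the flux of [phi1 grad phi2], whence symmetry and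
    positivity of [G(h)]. The sign of [P] is a weak maximum principle for the flux of
    [cutoff(P) grad P]; as [grad P] itself has infinite energy, one also uses that far down [P < 0]
    forces [|phi|] to exceed the depth. The flux of [grad |grad P|] contains second derivatives and
    cannot be estimated at depth; but up to a lower-order term it is the [z]-derivative of a
    weighted layer average of [|grad P|]. This flux decreases with depth, so a negative value at the
    surface would make the average grow linearly downwards, whereas it stays bounded at depths of
    small energy. *)

Lemma is_derive_line f x v (s : R) : derivable f (x + s *: v) v ->
  is_derive s 1 (fun r : R => f (x + r *: v)) ('D_v f (x + s *: v)).
Proof.
have E : (fun h : R => h^-1 *:
     (((fun r : R => f (x + r *: v)) \o shift s) (h *: (1 : R)) - f (x + s *: v)))
   = (fun h : R => h^-1 *: ((f \o shift (x + s *: v)) (h *: v) - f (x + s *: v))).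
  apply/funext => h /=; congr (_ *: (f _ - _)).
  by rewrite scalerDl [h *: 1]mulr1 addrCA addrA.
move=> fv; split.
  by rewrite /derivable E.
by rewrite /derive E.
Qed.

Lemma derive_add f g x v : differentiable f x -> differentiable g x ->
  'D_v (fun p => f p + g p) x = 'D_v f x + 'D_v g x.
Proof. by move=> df dg; apply: deriveD; exact: diff_derivable. Qed.

Lemma derive_opp f x v : differentiable f x ->
  'D_v (fun p => - f p) x = - 'D_v f x.
Proof. by move=> df; apply: deriveN; exact: diff_derivable. Qed.

Lemma derive_sub f g x v : differentiable f x -> differentiable g x ->
  'D_v (fun p => f p - g p) x = 'D_v f x - 'D_v g x.
Proof. by move=> df dg; apply: deriveB; exact: diff_derivable. Qed.

Lemma derive_mul f g x v : differentiable f x -> differentiable g x ->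
  'D_v (fun p => f p * g p) x = f x * 'D_v g x + g x * 'D_v f x.
Proof. by move=> df dg; apply: deriveM; exact: diff_derivable. Qed.

Lemma differentiable_add f g x : differentiable f x -> differentiable g x ->
  differentiable (fun p => f p + g p) x.
Proof. exact: differentiableD. Qed.

Lemma differentiable_opp f x : differentiable f x ->
  differentiable (fun p => - f p) x.
Proof. exact: differentiableN. Qed.

Lemma differentiable_mul f g x : differentiable f x -> differentiable g x ->
  differentiable (fun p => f p * g p) x.
Proof. exact: differentiableM. Qed.

Lemma differentiable_bigsum (I : finType) (F : I -> V -> R) x :
  (forall i, differentiable (F i) x) -> differentiable (fun p => \sum_i F i p) x.
Proof.
move=> dF; have -> : (fun p => \sum_i F i p) = \sum_i F i.
  by apply/funext => p; rewrite fct_sumE.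
elim/big_ind : _ => //.
by move=> f g; exact: differentiableD.
Qed.

Lemma derive_bigsum (I : finType) (F : I -> V -> R) x v :
  (forall i, differentiable (F i) x) ->
  'D_v (fun p => \sum_i F i p) x = \sum_i 'D_v (F i) x.
Proof.
move=> dF; have -> : (fun p => \sum_i F i p) = \sum_i F i.
  by apply/funext => p; rewrite fct_sumE.
suff [] : differentiable (\sum_i F i) x /\
  'D_v (\sum_i F i) x = \sum_i 'D_v (F i) x by [].
elim/big_ind2 : _ => //.
- by split; [exact: (@differentiable_cst _ V R 0 x) | exact: (@derive_cst _ V R 0)].
- move=> f a g b [df <-] [dg <-]; split; first exact: differentiableD.
  exact: derive_add.
Qed.

Lemma derive_comp1 (k : R -> R) f x v (dk : R) : differentiable f x ->
  is_derive (f x) 1 k dk ->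
  differentiable (fun p => k (f p)) x /\
  'D_v (fun p => k (f p)) x = dk * 'D_v f x.
Proof.
move=> df [kd kE].
have kdiff : differentiable k (f x) by apply/derivable1_diffP.
have cd : differentiable (k \o f) x by exact: differentiable_comp.
split=> //.
rewrite (_ : (fun p => k (f p)) = k \o f)// deriveE// diff_comp//= [in RHS]deriveE//.
by rewrite diff1E//= derive1E kE /GRing.scale/= mulrC.
Qed.

Lemma differentiable_line f x v (s : R) : differentiable f (x + s *: v) ->
  is_derive s 1 (fun r : R => f (x + r *: v)) ('D_v f (x + s *: v)).
Proof. by move=> df; apply: is_derive_line; exact: diff_derivable. Qed.

Lemma derive_sumdir (I : finType) (k : I -> R) (u : I -> V) f x :
  differentiable f x ->
  'D_(\sum_i k i *: u i) f x = \sum_i k i * 'D_(u i) f x.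
Proof.
move=> df; rewrite deriveE// linear_sum; apply: eq_bigr => i _.
by rewrite linearZ/= deriveE.
Qed.

End Derivatives.

Lemma is_derive_continuous (R : realType) (f f' : R -> R) :
  (forall r : R, is_derive r 1 f (f' r)) -> continuous f.
Proof.
move=> df r; apply: differentiable_continuous; apply/derivable1_diffP.
by have [] := df r.
Qed.

Section SmoothFunctions.
Context {R : realType} {V : normedModType R}.
Implicit Types (f g : V -> R) (x v w : V) (k : nat).

Lemma Ck_continuous k f : Ck k f -> continuous f.
Proof.
by case: k => [//|k] [df _] x; apply: differentiable_continuous; exact: df.
Qed.

Lemma CkS k f : Ck k.+1 f -> Ck k f.
Proof.
elim: k f => [|k IH] f; first exact: Ck_continuous.
by move=> [df dfk]; split=> // v; apply: IH; exact: dfk.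
Qed.

Lemma Ck_cst k (c : R) : Ck k (fun _ : V => c).
Proof.
elim: k c => [|k IH] c /=; first exact: cst_continuous.
split=> [x|v]; first exact: differentiable_cst.
rewrite (_ : 'D_v _ = fun=> 0)//; apply/funext => x; exact: derive_cst.
Qed.

Lemma Ck_add k f g : Ck k f -> Ck k g -> Ck k (fun x => f x + g x).
Proof.
elim: k f g => [|k IH] f g /=; first by move=> cf cg x; apply: cvgD; [exact: cf|exact: cg].
move=> [df dfk] [dg dgk]; split=> [x|v]; first exact: differentiable_add.
rewrite (_ : 'D_v _ = fun x => 'D_v f x + 'D_v g x); first exact: IH.
by apply/funext => x; exact: derive_add.
Qed.

Lemma Ck_mul k f g : Ck k f -> Ck k g -> Ck k (fun x => f x * g x).
Proof.
elim: k f g => [|k IH] f g; first by move=> cf cg x; apply: cvgM; [exact: cf|exact: cg].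
move=> cf cg; have [[df dfk] [dg dgk]] := (cf, cg).
split=> [x|v]; first exact: differentiable_mul.
rewrite (_ : 'D_v _ = fun x => f x * 'D_v g x + g x * 'D_v f x).
  by apply: Ck_add; apply: IH; [exact: CkS|exact: dgk|exact: CkS|exact: dfk].
by apply/funext => x; exact: derive_mul.
Qed.

Lemma Ck_opp k f : Ck k f -> Ck k (fun x => - f x).
Proof.
move=> cf; rewrite (_ : (fun x => - f x) = fun x => -1 * f x).
  by apply: Ck_mul => //; exact: Ck_cst.
by apply/funext => x; rewrite mulN1r.
Qed.

Lemma Ck_sum k (I : finType) (F : I -> V -> R) :
  (forall i, Ck k (F i)) -> Ck k (fun x => \sum_i F i x).
Proof.
move=> cF; rewrite (_ : (fun x => \sum_i F i x) = \sum_i F i); last first.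
  by apply/funext => x; rewrite fct_sumE.
elim/big_ind : _ => //; first exact: Ck_cst.
by move=> f g; exact: Ck_add.
Qed.

Lemma smooth_differentiable f x : smooth f -> differentiable f x.
Proof. by move=> /(_ 1%N)[]. Qed.

Lemma smooth_continuous f : smooth f -> continuous f.
Proof. by move=> /(_ 0%N). Qed.

Lemma smooth_derive f v : smooth f -> smooth ('D_v f).
Proof. by move=> sf k; have [_] := sf k.+1; exact. Qed.

Lemma smooth_cst (c : R) : smooth (fun _ : V => c).
Proof. by move=> k; exact: Ck_cst. Qed.

Lemma smooth_add f g : smooth f -> smooth g -> smooth (fun x => f x + g x).
Proof. by move=> sf sg k; exact: Ck_add. Qed.

Lemma smooth_mul f g : smooth f -> smooth g -> smooth (fun x => f x * g x).
Proof. by move=> sf sg k; exact: Ck_mul. Qed.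

Lemma smooth_opp f : smooth f -> smooth (fun x => - f x).
Proof. by move=> sf k; exact: Ck_opp. Qed.

Lemma smooth_sum (I : finType) (F : I -> V -> R) :
  (forall i, smooth (F i)) -> smooth (fun x => \sum_i F i x).
Proof. by move=> sF k; apply: Ck_sum => i; exact: sF. Qed.

(* [D_v s^(-1/2) = - s^(-3/2) D_v s / 2] is again polynomial in [s^(-1/2)],
   which makes the induction on the order go through. *)
Lemma derive_invsqrt f x v : 0 < f x -> differentiable f x ->
  differentiable (fun p => (Num.sqrt (f p))^-1) x /\
  'D_v (fun p => (Num.sqrt (f p))^-1) x =
    - 2^-1 * ((Num.sqrt (f x))^-1 * ((Num.sqrt (f x))^-1 * (Num.sqrt (f x))^-1))
      * 'D_v f x.
Proof.
move=> fx0 df; apply: (@derive_comp1 _ _ (fun r => (Num.sqrt r)^-1)) => //.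
have sq0 : Num.sqrt (f x) != 0 by rewrite gt_eqF// sqrtr_gt0.
have ds := is_derive1_sqrt fx0.
have := @is_deriveV R (@Num.sqrt R : R -> R) (f x) _ 1 sq0 ds.
move=> H; apply: (is_derive_eq H).
by rewrite /GRing.scale/=; field.
Qed.

Lemma smooth_invsqrt f : (forall x, 0 < f x) -> smooth f ->
  smooth (fun p => (Num.sqrt (f p))^-1).
Proof.
move=> f0 sf; have d1 x v := @derive_invsqrt f x v (f0 x) (smooth_differentiable x sf).
elim=> [|k IH]; first by move=> x; apply: differentiable_continuous; have [] := d1 x 0.
split=> [x|v]; first by have [] := d1 x 0.
rewrite (_ : 'D_v _ = fun x => - 2^-1 * ((Num.sqrt (f x))^-1 *
    ((Num.sqrt (f x))^-1 * (Num.sqrt (f x))^-1)) * 'D_v f x); last first.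
  by apply/funext => x; have [] := d1 x v.
apply: Ck_mul; last exact: smooth_derive.
by apply: Ck_mul; [exact: Ck_cst|do 2!apply: Ck_mul => //].
Qed.

Lemma sqrtE f x : 0 < f x -> Num.sqrt (f x) = f x * (Num.sqrt (f x))^-1.
Proof.
move=> fx0; rewrite -{2}(sqr_sqrtr (ltW fx0)) expr2 mulfK//.
by rewrite gt_eqF// sqrtr_gt0.
Qed.

Lemma smooth_sqrt f : (forall x, 0 < f x) -> smooth f ->
  smooth (fun p => Num.sqrt (f p)).
Proof.
move=> f0 sf; rewrite (_ : (fun p => _) = fun p => f p * (Num.sqrt (f p))^-1).
  by apply: smooth_mul => //; exact: smooth_invsqrt.
by apply/funext => x; exact: sqrtE.
Qed.

Lemma derive_sqrt f x v : 0 < f x -> differentiable f x ->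
  'D_v (fun p => Num.sqrt (f p)) x = 2^-1 * (Num.sqrt (f x))^-1 * 'D_v f x.
Proof.
move=> f0 df; have [|_ ->//] := @derive_comp1 _ _ (@Num.sqrt R) f x v
  (2 * Num.sqrt (f x))^-1 df.
  exact: is_derive1_sqrt.
by rewrite invfM.
Qed.

Let second_difference_aux (a b c e t D x : R) :
  a - b - (c - e) = x * (t - 0) -> x = D * (t - 0) -> a - b - (c - e) = t * t * D.
Proof. by move=> E1 E2; rewrite {}E2 in E1; lra. Qed.

(** The mean value theorem is applied twice, first along [v] to the increment in direction [w], then
    along [w]. The left side is symmetric in [v] and [w] up to reordering; the right side remembers
    the order of differentiation. *)
Let second_difference f x v w (t : R) : Ck 2 f -> 0 < t ->
  exists c c' : R, [/\ 0 < c < t, 0 < c' < t &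
    f (x + t *: v + t *: w) - f (x + t *: v) - (f (x + t *: w) - f x) =
    t * t * 'D_w ('D_v f) (x + c *: v + c' *: w)].
Proof.
move=> [df df1] t0.
pose A (s : R) := f (x + t *: w + s *: v) - f (x + s *: v).
pose A' (s : R) := 'D_v f (x + t *: w + s *: v) - 'D_v f (x + s *: v).
have dA (s : R) : is_derive s 1 A (A' s).
  by apply: is_deriveB; apply: differentiable_line.
have [|c c0t EA] := @MVT _ A A' 0 t t0 (fun s _ => dA s).
  by apply: continuous_subspaceT; exact: is_derive_continuous dA.
pose D (r : R) := 'D_v f (x + c *: v + r *: w).
pose D' (r : R) := 'D_w ('D_v f) (x + c *: v + r *: w).
have dD (s : R) : is_derive s 1 D (D' s).
  by apply: differentiable_line; have [] := df1 v.
have [|c' c'0t ED] := @MVT _ D D' 0 t t0 (fun s _ => dD s).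
  by apply: continuous_subspaceT; exact: is_derive_continuous dD.
exists c, c'; split; [by rewrite in_itv/= in c0t|by rewrite in_itv/= in c'0t|].
apply: second_difference_aux ED.
by move: EA; rewrite /D /A /A' !scale0r !addr0 (addrAC x (t *: w)) (addrAC x (t *: w)).
Qed.

Let derive_comm_aux1 (a b p q e : R) : p = q ->
  `|b - p| < e -> `|a - q| < e -> e = `|a - b| / 3 ->
  0 < `|a - b| -> False.
Proof.
move=> <- bp ap eE.
have : `|a - b| < e + e.
  rewrite -[a - b](subrKA p).
  by rewrite (le_lt_trans (ler_normD _ _))// ltrD// distrC.
by rewrite eE; lra.
Qed.

Let derive_comm_aux2 (s1 s2 s3 s4 s5 t p q : R) : 0 < t -> s1 = s5 ->
  s1 - s2 - (s3 - s4) = t * t * p -> s5 - s3 - (s2 - s4) = t * t * q -> p = q.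
Proof.
move=> t0 <- E1 E2; have t00 : t * t != 0 by rewrite mulf_neq0// gt_eqF.
by apply: (mulfI t00); rewrite -E1 -E2; lra.
Qed.

Let derive_comm_aux3 (c c' t d : R) : 0 < c < t -> 0 < c' < t -> t < d ->
    ball (0 : R, 0 : R) d (c, c').
Proof.
move=> /andP[c0 ct] /andP[c'0 c't] td.
by split; rewrite /ball/= sub0r normrN gtr0_norm//; exact: lt_trans td.
Qed.

(** Exchanging [v] and [w] in the second difference makes the two mixed derivatives agree at two
    points close to [x]. With a continuity tolerance of one third of the supposed gap at [x], that
    gap would be less than two thirds of itself. *)
Lemma derive_comm f x v w : Ck 2 f -> 'D_v ('D_w f) x = 'D_w ('D_v f) x.
Proof.
move=> Cf.
apply/eqP; rewrite -subr_eq0 -normr_le0 leNgt; apply/negP => d0.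
have e0 := divr_gt0 d0 (ltr0n R 3).
have cc (v' w' : V) (e : R) : 0 < e -> \forall p \near (0 : R, 0 : R),
    `|'D_w' ('D_v' f) x - 'D_w' ('D_v' f) (x + p.1 *: v' + p.2 *: w')| < e.
  move=> {}e0.
  have : continuous ('D_w' ('D_v' f)) by have [_ /(_ v') [_ /(_ w')]] := Cf.
  move=> cD; have : (fun p : R * R => 'D_w' ('D_v' f) (x + p.1 *: v' + p.2 *: w')) p
      @[p --> (0 : R, 0 : R)] --> 'D_w' ('D_v' f) (x + 0 *: v' + 0 *: w').
    apply: (@cvg_comp _ _ _ (fun p : R * R => x + p.1 *: v' + p.2 *: w')
      ('D_w' ('D_v' f))); last exact: cD.
    apply: cvgD; first apply: cvgD; first exact: cvg_cst.
      by apply: cvgZr_tmp; exact: cvg_fst.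
    by apply: cvgZr_tmp; exact: cvg_snd.
  rewrite !scale0r !addr0.
  by move=> /cvgrPdist_lt /(_ _ e0).
have /nbhs_ballP[d1 /= d1_0 b1] := cc v w _ e0.
have /nbhs_ballP[d2 /= d2_0 b2] := cc w v _ e0.
pose t := Num.min d1 d2 / 2.
have t0 : 0 < t by rewrite divr_gt0// lt_min d1_0.
have td1 : t < d1.
  rewrite /t ltr_pdivrMr// (@le_lt_trans _ _ d1)//; last lra.
  by rewrite ge_min lexx.
have td2 : t < d2.
  rewrite /t ltr_pdivrMr// (@le_lt_trans _ _ d2)//; last lra.
  by rewrite ge_min lexx orbT.
have [c1 [c1' [c1t c1't E1]]] := @second_difference f x v w t Cf t0.
have [c2 [c2' [c2t c2't E2]]] := @second_difference f x w v t Cf t0.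
have E3 := derive_comm_aux2 t0 (congr1 f (addrAC x (t *: v) (t *: w))) E1 E2.
have /= h1 := b1 (c1, c1') (derive_comm_aux3 c1t c1't td1).
have /= h2 := b2 (c2, c2') (derive_comm_aux3 c2t c2't td2).
exact: derive_comm_aux1 E3 h1 h2 erefl d0.
Qed.

Lemma smooth_derive_comm f v w : smooth f -> 'D_v ('D_w f) = 'D_w ('D_v f).
Proof. by move=> sf; apply/funext => x; apply: derive_comm; exact: sf. Qed.

End SmoothFunctions.

(** * Integration over the torus *)

Lemma continuous_pairing (T U W : topologicalType) (f : T -> U) (g : T -> W) :
  continuous f -> continuous g -> continuous (fun x => (f x, g x)).
Proof. by move=> cf cg x; apply: cvg_pair; [exact: cf|exact: cg]. Qed.

Lemma continuous_of_comp (T U W : topologicalType) (f : T -> U) (g : U -> W) :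
  continuous f -> continuous g -> continuous (fun x => g (f x)).
Proof. by move=> cf cg x; apply: continuous_comp; [exact: cf|exact: cg]. Qed.

Lemma continuous_cst (T U : topologicalType) (c : U) : continuous (fun _ : T => c).
Proof. by move=> x; exact: cvg_cst. Qed.

Lemma continuous_idfun (T : topologicalType) : continuous (fun x : T => x).
Proof. by move=> x; exact: cvg_id. Qed.

Lemma continuous_fst (T U : topologicalType) : continuous (fun p : T * U => p.1).
Proof. by move=> x; exact: cvg_fst. Qed.

Lemma continuous_snd (T U : topologicalType) : continuous (fun p : T * U => p.2).
Proof. by move=> x; exact: cvg_snd. Qed.

Section RealValued.
Context {R : realType} {T : topologicalType}.
Implicit Types f g : T -> R.

Lemma continuous_add f g : continuous f -> continuous g ->
  continuous (fun x => f x + g x).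
Proof. by move=> cf cg x; apply: cvgD; [exact: cf|exact: cg]. Qed.

Lemma continuous_mul f g : continuous f -> continuous g ->
  continuous (fun x => f x * g x).
Proof. by move=> cf cg x; apply: cvgM; [exact: cf|exact: cg]. Qed.

Lemma continuous_opp f : continuous f -> continuous (fun x => - f x).
Proof. by move=> cf x; apply: cvgN; exact: cf. Qed.

Lemma continuous_sub f g : continuous f -> continuous g ->
  continuous (fun x => f x - g x).
Proof. by move=> cf cg; apply: continuous_add => //; exact: continuous_opp. Qed.

Lemma continuous_norm f : continuous f -> continuous (fun x => `|f x|).
Proof. by move=> cf x; apply: cvg_norm; exact: cf. Qed.

Lemma continuous_sum (I : finType) (F : I -> T -> R) :
  (forall i, continuous (F i)) -> continuous (fun x => \sum_i F i x).
Proof.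
move=> cF; rewrite (_ : (fun x => _) = \sum_i F i); last first.
  by apply/funext => x; rewrite fct_sumE.
elim/big_ind : _ => //; first exact: (@continuous_cst T R 0).
by move=> f g; exact: continuous_add.
Qed.

End RealValued.

Lemma continuous_mx (T : topologicalType) (R : realType) (m n : nat)
    (F : T -> 'M[R]_(m, n)) :
  (forall i j, continuous (fun x => F x i j)) -> continuous F.
Proof.
move=> cF x; apply/cvg_mx_entourageP => A eA.
have H : forall ij : 'I_m * 'I_n, \forall y \near x, A (F x ij.1 ij.2, F y ij.1 ij.2).
  move=> [i j] /=; have /cvg_entourageP := cF i j x; exact.
have := @filter_forall T _ (fun ij y => A (F x ij.1 ij.2, F y ij.1 ij.2)) _ _ H.
move=> /(_ (nbhs_filter x)); apply: filterS => y Hy i j; rewrite inE.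
exact: (Hy (i, j)).
Qed.

(** Tube-lemma argument: joint continuity gives the estimate on a product neighbourhood of each
    point of [K], and compactness makes the neighbourhood of [s0] uniform. Limits pass through the
    integrals below by this uniformity. *)
Lemma compact_near_uniform (S X : topologicalType) (R : realType)
    (f : S -> X -> R) (K : set X) (s0 : S) (e : R) :
  compact K -> continuous (fun p : S * X => f p.1 p.2) -> 0 < e ->
  \forall s \near s0, forall x, K x -> `|f s0 x - f s x| < e.
Proof.
move=> cK cf e0; have e20 : 0 < e / 2 by rewrite divr_gt0.
have cov := (compact_near_coveringP K).1 cK S (nbhs s0)
  (fun s x => `|f s0 x - f s x| < e) _.
apply: cov => x Kx.
have c1 := cf (s0, x); move/cvgrPdist_lt : c1 => /(_ _ e20) /= [[U W] /= [Us Wx] UW].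
exists (W, U) => // -[x' s] /= [Wx' Us'].
have h1 := UW (s0, x') (conj (nbhs_singleton Us) Wx').
have h2 := UW (s, x') (conj Us' Wx').
rewrite /= in h1 h2.
rewrite -(subrKA (f s0 x)) (le_lt_trans (ler_normD _ _))// (splitr e) ltrD//.
by rewrite distrC.
Qed.

(** * Integrals over the unit interval *)

Section UnitInterval.
Context {R : realType}.
Implicit Types (f g : R -> R).
Local Notation mu := (@lebesgue_measure R).
Local Notation int01 f := (\int[mu]_(r in `[0, 1]) f r)%R.

Lemma continuous_integrable f (a b : R) : continuous f ->
  mu.-integrable `[a, b] (EFin \o f).
Proof.
move=> cf; apply: continuous_compact_integrable; first exact: segment_compact.
exact: continuous_subspaceT.
Qed.

Lemma int01_EFin f : continuous f ->
  (\int[mu]_(r in `[0%R, 1%R]) (f r)%:E)%E = (int01 f)%:E.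
Proof.
move=> cf; rewrite /Rintegral fineK//.
by apply: integrable_fin_num => //; exact: continuous_integrable.
Qed.

Lemma int01D f g : continuous f -> continuous g ->
  int01 (fun r => f r + g r) = int01 f + int01 g.
Proof. by move=> cf cg; apply: RintegralD => //; exact: continuous_integrable. Qed.

Lemma int01Z f (c : R) : continuous f -> int01 (fun r => c * f r) = c * int01 f.
Proof. by move=> cf; apply: RintegralZl => //; exact: continuous_integrable. Qed.

Lemma le_int01 f g : continuous f -> continuous g ->
  (forall r, 0 <= r <= 1 -> f r <= g r) -> int01 f <= int01 g.
Proof.
by move=> cf cg fg; apply: le_Rintegral => //; exact: continuous_integrable.
Qed.

Lemma int01_cst (c : R) : int01 (fun=> c) = c.
Proof.
have /= := @Rintegral_cst _ (measurableTypeR R) R mu `[0, 1] (measurable_itv _) c.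
by rewrite lebesgue_measure_itv/= lte_fin ltr01 oppr0 adde0 mulr1.
Qed.

Lemma eq_int01 f g : (forall r, 0 <= r <= 1 -> f r = g r) -> int01 f = int01 g.
Proof.
by move=> fg; apply: eq_Rintegral => r; rewrite inE/= in_itv/=; exact: fg.
Qed.

Lemma int01_FTC (F F' : R -> R) : (forall r : R, is_derive r 1 F (F' r)) ->
  continuous F' -> int01 F' = F 1 - F 0.
Proof.
move=> dF cF'; have cF := is_derive_continuous dF.
rewrite /Rintegral (@continuous_FTC2 _ F' F)//=.
- exact: continuous_subspaceT.
- split.
  + by move=> r _; have [] := dF r.
  + by apply: cvg_at_right_filter; exact: cF.
  + by apply: cvg_at_left_filter; exact: cF.
- by move=> r _; rewrite derive1E; have [] := dF r.
Qed.

Lemma continuous_int01 (S : topologicalType) (f : S -> R -> R) :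
  continuous (fun p : S * R => f p.1 p.2) -> continuous (fun s => int01 (f s)).
Proof.
move=> cf s0; apply/cvgrPdist_le => e e0.
have cfs s : continuous (f s).
  apply: (continuous_of_comp _ cf (f := fun r => (s, r))).
  by apply: continuous_pairing; [exact: continuous_cst|exact: continuous_idfun].
have := compact_near_uniform s0 (@segment_compact R 0 1) cf e0.
apply: filterS => s Hs /=; rewrite -RintegralB//=; try exact: continuous_integrable.
have cd : continuous (fun r => f s0 r - f s r).
  exact: continuous_sub.
have H r : 0 <= r <= 1 -> `|f s0 r - f s r| <= e.
  by move=> r01; apply/ltW/Hs; rewrite /= in_itv.
rewrite ler_norml; apply/andP; split.
  rewrite -{1}(int01_cst (- e)); apply: le_int01 => //; first exact: continuous_cst.
  by move=> r /H; rewrite ler_norml => /andP[].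
rewrite -(int01_cst e); apply: le_int01 => //; first exact: continuous_cst.
by move=> r /H; rewrite ler_norml => /andP[].
Qed.

Lemma int01_eq0 f : continuous f -> (forall r, 0 <= r <= 1 -> 0 <= f r) ->
  int01 f = 0 -> forall r, 0 <= r <= 1 -> f r = 0.
Proof.
move=> cf f0 If r0 r01; apply/eqP; rewrite eq_le f0// andbT leNgt; apply/negP => fr0.
have c0 : 0 < f r0 / 2 by rewrite divr_gt0.
have /cvgrPdist_lt /(_ _ c0) /nbhs_ballP[d /= d0 dP] := cf r0.
(* Clipping to [[0, 1]] covers the case of [r0] at an endpoint; the half radius keeps the closed
   interval inside the ball where [f] exceeds [f r0 / 2]. *)
pose a := Num.max 0 (r0 - d / 2); pose b := Num.min 1 (r0 + d / 2).
have d20 : 0 < d / 2 by rewrite divr_gt0.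
have [r0_ge0 r0_le1] := andP r01.
have ab : a < b.
  rewrite /a /b gt_max !lt_min ltr01 ltr_pwDr//=.
  by rewrite (@lt_le_trans _ _ r0) ?gtrBl// ltrBlDr -addrA ltrDl addr_gt0.
have sub : `[a, b] `<=` `[0, 1].
  move=> r /=; rewrite !in_itv/= /a /b ge_max le_min => /andP[/andP[-> _] /andP[->]] //.
have fab r : r \in `[a, b] -> f r0 / 2 <= f r.
  rewrite in_itv/= /a /b ge_max le_min => /andP[/andP[_ h1] /andP[_ h2]].
  have : ball r0 d r.
    rewrite /ball/= ltr_distlC; apply/andP; split.
      by rewrite (lt_le_trans _ h1)// ltrD2l ltrN2 ltr_pdivrMr// ltr_pMr// ltr1n.
    by rewrite (le_lt_trans h2)// ltrD2l ltr_pdivrMr// ltr_pMr// ltr1n.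
  move=> /dP /ltW; rewrite ler_norml => /andP[_]; rewrite lerBlDr => h.
  by rewrite -(lerD2l (f r0 / 2)) -splitr.
have : ((f r0 / 2 * (b - a))%:E <= (int01 f)%:E)%E.
  rewrite -int01_EFin//.
  apply: (@le_trans _ _ (\int[mu]_(r in `[a, b]) (f r)%:E)%E); last first.
    apply: ge0_subset_integral => //.
    - exact: measurable_int (continuous_integrable _ _ cf).
  apply: (@le_trans _ _ (\int[mu]_(r in `[a, b]) (f r0 / 2)%:E)%E).
    by rewrite integral_cst//= lebesgue_measure_itv/= lte_fin ab EFinM EFinB.
  apply: ge0_le_integral => //.
  - by move=> r _; rewrite lee_fin ltW.
  - exact: measurable_int (continuous_integrable _ _ cf).
rewrite If lee_fin leNgt => /negP; apply.
by rewrite mulr_gt0// subr_gt0.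
Qed.

End UnitInterval.

Lemma continuous_row_mx (R : realType) (T : topologicalType) (n2 : nat)
    (f : T -> R) (g : T -> 'rV[R]_n2) : continuous f -> continuous g ->
  continuous (fun x => row_mx ((f x)%:M : 'rV[R]_1) (g x) : 'rV[R]_(1 + n2)).
Proof.
move=> cf cg; apply: continuous_mx => i j.
rewrite (_ : (fun x => _) = fun x => match fintype.split j with
    inl k => (f x) *+ (i == k) | inr k => g x i k end); last first.
  by apply/funext => x; rewrite mxE; case: (fintype.split j) => k; rewrite ?mxE.
case: (fintype.split j) => k.
  by case: (i == k) => //=; exact: continuous_cst.
exact: (continuous_of_comp cg (@coord_continuous _ _ _ i k)).
Qed.

(** * Iterated integrals over the unit cube *)

Section CubeIntegral.
Context {R : realType}.
Local Notation mu := (@lebesgue_measure R).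

(** Real-valued twin of [cube_integral]: on continuous integrands every iterated integral is finite,
    so the calculus is done in [R] and transferred by [cube_integral_EFin]. *)
Fixpoint cube_Rintegral (d : nat) : ('rV[R]_d -> R) -> R :=
  match d with
  | 0%N => fun f => f 0
  | d'.+1 => fun f => (\int[mu]_(s in `[0, 1])
      cube_Rintegral (fun u : 'rV[R]_d' =>
        f (row_mx (s%:M : 'rV[R]_1) u : 'rV[R]_(1 + d'))))%R
  end.

Definition unit_cube (d : nat) : set 'rV[R]_d :=
  [set u | forall i, 0 <= u 0 i <= 1].

Lemma unit_cube_compact d : compact (@unit_cube d).
Proof.
have -> : @unit_cube d = [set u : 'rV[R]_d | forall i, `[0, 1]%classic (u ord0 i)].
  by apply/seteqP; split => u /= + i => /(_ i); rewrite in_itv.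
exact: (@rV_compact R d (fun=> `[0, 1]%classic) (fun=> @segment_compact R 0 1)).
Qed.

Lemma unit_cube_row_mx d (s : R) (u : 'rV[R]_d) : 0 <= s <= 1 ->
  unit_cube u -> unit_cube (row_mx (s%:M : 'rV[R]_1) u : 'rV[R]_(1 + d)).
Proof.
move=> s01 u01 i; rewrite mxE; case: (fintype.split i) => k; last exact: u01.
by rewrite !mxE ord1 eqxx.
Qed.

Lemma unit_cubeS d (u : 'rV[R]_(1 + d)) : unit_cube u ->
  exists s (v : 'rV[R]_d), [/\ 0 <= s <= 1, unit_cube v & u = row_mx (s%:M) v].
Proof.
move=> u01; exists (u 0 (lshift d 0)), (rsubmx u); split.
- exact: u01.
- by move=> i; rewrite mxE; exact: u01.
- rewrite -[LHS](@hsubmxK _ 1 1 d); congr row_mx.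
  by apply/rowP => i; rewrite !mxE !ord1.
Qed.

Lemma continuous_slice d (T : topologicalType) (f : T -> 'rV[R]_(1 + d) -> R) :
  continuous (fun p : T * 'rV[R]_(1 + d) => f p.1 p.2) ->
  continuous (fun p : (T * R) * 'rV[R]_d =>
    f p.1.1 (row_mx (p.1.2%:M : 'rV[R]_1) p.2)).
Proof.
move=> cf; apply: (continuous_of_comp _ cf
  (f := fun p : (T * R) * 'rV[R]_d => (p.1.1, row_mx (p.1.2%:M : 'rV[R]_1) p.2))).
apply: continuous_pairing.
  by apply: (continuous_of_comp (@continuous_fst _ _)); exact: continuous_fst.
apply: continuous_row_mx; last exact: continuous_snd.
by apply: (continuous_of_comp (@continuous_fst _ _)); exact: continuous_snd.
Qed.

(** The parameter space is generalized in the induction: each step moves the first coordinate of the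
    cube into the parameter, replacing [T] by [T * R]. *)
Lemma continuous_cube_Rintegral d (T : topologicalType) (f : T -> 'rV[R]_d -> R) :
  continuous (fun p : T * 'rV[R]_d => f p.1 p.2) ->
  continuous (fun s => cube_Rintegral (f s)).
Proof.
elim: d T f => [|d IH] T f cf /=.
  apply: (continuous_of_comp _ cf (f := fun s : T => (s, 0 : 'rV[R]_0))).
  by apply: continuous_pairing; [exact: continuous_idfun|exact: continuous_cst].
apply: (@continuous_int01 _ _ (fun s r => cube_Rintegral (fun u : 'rV[R]_d =>
        f s (row_mx (r%:M : 'rV[R]_1) u : 'rV[R]_(1 + d))))).
exact: (IH _ (fun (p : T * R) u => f p.1 (row_mx (p.2%:M : 'rV[R]_1) u))
  (continuous_slice cf)).
Qed.

Section Slices.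
Variables (d : nat) (f : 'rV[R]_(1 + d) -> R).
Hypothesis cf : continuous f.

Let cf2 : continuous (fun p : R * 'rV[R]_d => f (row_mx (p.1%:M : 'rV[R]_1) p.2)).
Proof.
apply: (continuous_of_comp _ cf).
by apply: continuous_row_mx; [exact: continuous_fst|exact: continuous_snd].
Qed.

Lemma continuous_tail (s : R) :
  continuous (fun u : 'rV[R]_d => f (row_mx (s%:M : 'rV[R]_1) u)).
Proof.
apply: (continuous_of_comp _ cf).
by apply: continuous_row_mx; [exact: continuous_cst|exact: continuous_idfun].
Qed.

Lemma continuous_inner : continuous (fun s : R => cube_Rintegral
  (fun u : 'rV[R]_d => f (row_mx (s%:M : 'rV[R]_1) u))).
Proof. exact: (continuous_cube_Rintegral cf2). Qed.

End Slices.

Lemma cube_integral_EFin d (f : 'rV[R]_d -> R) : continuous f ->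
  cube_integral (fun u => (f u)%:E) = (cube_Rintegral f)%:E.
Proof.
elim: d f => [|d IH] f cf //=.
rewrite -int01_EFin; last exact: continuous_inner.
by apply: eq_integral => s _; rewrite IH//; exact: continuous_tail.
Qed.

Lemma cube_RintegralD d (f g : 'rV[R]_d -> R) : continuous f -> continuous g ->
  cube_Rintegral (fun u => f u + g u) = cube_Rintegral f + cube_Rintegral g.
Proof.
elim: d f g => [|d IH] f g cf cg //=.
rewrite -int01D; [|exact: continuous_inner..].
by apply: eq_int01 => s _; rewrite IH//; exact: continuous_tail.
Qed.

Lemma cube_RintegralZ d (f : 'rV[R]_d -> R) (c : R) : continuous f ->
  cube_Rintegral (fun u => c * f u) = c * cube_Rintegral f.
Proof.
elim: d f => [|d IH] f cf //=.
rewrite -int01Z; last exact: continuous_inner.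
by apply: eq_int01 => s _; rewrite IH//; exact: continuous_tail.
Qed.

Lemma le_cube_Rintegral d (f g : 'rV[R]_d -> R) : continuous f -> continuous g ->
  (forall u, unit_cube u -> f u <= g u) -> cube_Rintegral f <= cube_Rintegral g.
Proof.
elim: d f g => [|d IH] f g cf cg fg /=; first by apply: fg => -[].
apply: le_int01; [exact: continuous_inner..|] => s s01.
apply: IH; [exact: continuous_tail..|] => u u01; apply: fg.
exact: unit_cube_row_mx.
Qed.

Lemma cube_Rintegral_eq0 d (f : 'rV[R]_d -> R) : continuous f ->
  (forall u, unit_cube u -> 0 <= f u) -> cube_Rintegral f = 0 ->
  forall u, unit_cube u -> f u = 0.
Proof.
elim: d f => [|d IH] f cf f0 /= If u u01.
  by rewrite -If; congr f; apply/rowP => -[].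
have [s [v [s01 v01 ->]]] := unit_cubeS u01.
apply: (IH (fun v => f (row_mx (s%:M : 'rV[R]_1) v))) => //.
- exact: continuous_tail.
- by move=> w w01; apply: f0; exact: unit_cube_row_mx.
- apply: (int01_eq0 (continuous_inner cf) _ If s01) => r r01.
  have := @le_cube_Rintegral d (fun=> 0) (fun u => f (row_mx (r%:M : 'rV[R]_1) u)).
  rewrite (_ : cube_Rintegral (fun=> 0) = 0); last first.
    by elim: (d) => [//|k IHk] /=; rewrite IHk int01_cst.
  apply; [exact: continuous_cst|exact: continuous_tail|] => w w01.
  by apply: f0; exact: unit_cube_row_mx.
Qed.

Lemma cube_Rintegral_cst d (c : R) : cube_Rintegral (fun _ : 'rV[R]_d => c) = c.
Proof. by elim: d => [//|d IH] /=; rewrite IH int01_cst. Qed.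

End CubeIntegral.

(** Increments of both signs are covered at once, as two-sided difference quotients require. *)
Lemma MVT_abs (R : realType) (f df : R -> R) (s e : R) :
  (forall r : R, is_derive r 1 f (df r)) ->
  exists2 c, `|c - s| <= `|e| & f (s + e) - f s = e * df c.
Proof.
move=> df1; have cf := is_derive_continuous df1.
have [e0|e0] := leP 0 e.
  have se : s <= s + e by rewrite lerDl.
  have [|c cI E] := @MVT_segment _ f df s (s + e) se (fun r _ => df1 r).
    exact: continuous_subspaceT.
  exists c; last by rewrite E [s + e]addrC addrK mulrC.
  move: cI; rewrite in_itv/= => /andP[sc cs].
  by rewrite !ger0_norm// ?subr_ge0// lerBlDl.
have se : s + e <= s by rewrite gerDl ltW.
have [|c cI E] := @MVT_segment _ f df (s + e) s se (fun r _ => df1 r).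
  exact: continuous_subspaceT.
exists c; last by rewrite -opprB E opprD addNKr mulrC mulNr opprK.
move: cI; rewrite in_itv/= => /andP[sc cs].
rewrite !ler0_norm ?subr_le0 ?(ltW e0)// opprB lerBlDl -lerBlDr.
by rewrite opprK.
Qed.

Section CubeIntegralCalculus.
Context {R : realType}.

Lemma cube_RintegralB d (f g : 'rV[R]_d -> R) : continuous f -> continuous g ->
  cube_Rintegral (fun u => f u - g u) = cube_Rintegral f - cube_Rintegral g.
Proof.
move=> cf cg; rewrite cube_RintegralD//; last exact: continuous_opp.
congr (_ + _); rewrite -mulN1r -cube_RintegralZ//.
by congr cube_Rintegral; apply/funext => u; rewrite mulN1r.
Qed.

Lemma cube_Rintegral_norm_le d (f : 'rV[R]_d -> R) (e : R) : continuous f ->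
  (forall u, unit_cube u -> `|f u| <= e) -> `|cube_Rintegral f| <= e.
Proof.
move=> cf fe; rewrite ler_norml; apply/andP; split.
  rewrite -(cube_Rintegral_cst d (- e)); apply: le_cube_Rintegral => //.
    exact: continuous_cst.
  by move=> u /fe; rewrite ler_norml => /andP[].
rewrite -(cube_Rintegral_cst d e); apply: le_cube_Rintegral => //.
  exact: continuous_cst.
by move=> u /fe; rewrite ler_norml => /andP[].
Qed.

(** By the mean value theorem the difference quotient is [F'] at an intermediate time, which is
    uniformly close to [F' s] on the compact cube. *)
Lemma is_derive_cube_Rintegral d (F F' : R -> 'rV[R]_d -> R) (s : R) :
  (forall r, continuous (F r)) ->
  (forall u (r : R), is_derive r 1 (F ^~ u) (F' r u)) ->
  continuous (fun p : R * 'rV[R]_d => F' p.1 p.2) ->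
  is_derive s 1 (fun r => cube_Rintegral (F r)) (cube_Rintegral (F' s)).
Proof.
move=> cF dF cF'.
have cF's r : continuous (F' r).
  apply: (continuous_of_comp _ cF' (f := fun u => (r, u))).
  by apply: continuous_pairing; [exact: continuous_cst|exact: continuous_idfun].
have L : (fun h : R => h^-1 *: (((fun r => cube_Rintegral (F r)) \o shift s) (h *: (1 : R))
    - cube_Rintegral (F s))) @ 0^' --> cube_Rintegral (F' s).
  apply/cvgrPdist_le => e e0.
  have := compact_near_uniform s (@unit_cube_compact R d) cF' e0.
  move=> /nbhs_ballP[dl /= dl0 H].
  near=> h.
  have h0 : h != 0 by near: h; exact: nbhs_dnbhs_neq.
  have hd : `|h| < dl.
    near: h; apply: dnbhs0_lt; exact: dl0.
  rewrite /= [h *: 1]mulr1 /GRing.scale/= -cube_RintegralB// -cube_RintegralZ; last first.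
    by apply: continuous_sub; exact: cF.
  rewrite -cube_RintegralB//; last first.
    by apply: continuous_mul; [exact: continuous_cst|apply: continuous_sub; exact: cF].
  apply: cube_Rintegral_norm_le.
    apply: continuous_sub => //.
    by apply: continuous_mul; [exact: continuous_cst|apply: continuous_sub; exact: cF].
  move=> u u01; have [c cs] := @MVT_abs _ _ _ s h (dF u); rewrite (addrC h s) => ->.
  rewrite mulKf//; apply/ltW/H => //.
  by rewrite /ball/= distrC (le_lt_trans cs).
by split; [apply/cvg_ex; eexists; exact: L | exact: cvg_lim L].
Unshelve. all: end_near. Qed.

(** The outermost integration variable is the first coordinate. If [j] is that coordinate, the
    fundamental theorem of calculus applies to the inner integral and periodicity equates its two
    end values; otherwise the inner integral vanishes for each [s] by induction. *)
Lemma cube_Rintegral_partial d (f f' : 'rV[R]_d -> R) (j : 'I_d) :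
  continuous f -> continuous f' ->
  (forall u (r : R), is_derive r 1 (fun r : R => f (u + r *: delta_mx 0 j))
    (f' (u + r *: delta_mx 0 j))) ->
  (forall u, f (u + delta_mx 0 j) = f u) ->
  cube_Rintegral f' = 0.
Proof.
elim: d f f' j => [|d IH] f f' j cf cf' df pf; first by case: (j).
rewrite /=.
case: (@split_ordP 1 d j) => k jE.
- have rE (u : 'rV[R]_d) (r : R) : row_mx (r%:M : 'rV[R]_1) u =
      row_mx (0%:M : 'rV[R]_1) u + r *: delta_mx 0 j.
    apply/rowP => i; rewrite !mxE jE; case: (split_ordP i) => l -> /=.
      by rewrite !mxE !ord1 !eqxx/= mulr1 add0r.
    case: eqP => [/(congr1 val)|_]; last by rewrite mulr0 addr0.
    by rewrite (ord1 k).
  apply: (etrans (@int01_FTC _ (fun s => cube_Rintegral (fun u : 'rV[R]_d =>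
    f (row_mx (s%:M : 'rV[R]_1) u))) (fun s => cube_Rintegral (fun u : 'rV[R]_d =>
    f' (row_mx (s%:M : 'rV[R]_1) u))) _ _)).
  + move=> s; apply: (@is_derive_cube_Rintegral d (fun s u => f (row_mx (s%:M : 'rV[R]_1) u))
      (fun s u => f' (row_mx (s%:M : 'rV[R]_1) u))).
    * by move=> r; exact: (@continuous_tail R d f).
    * move=> u r; have := df (row_mx (0%:M : 'rV[R]_1) u) r; rewrite -rE.
      by under eq_fun do rewrite -rE.
    * apply: (continuous_of_comp _ cf').
      by apply: continuous_row_mx; [exact: continuous_fst|exact: continuous_snd].
  + exact: (@continuous_inner R d f').
  + apply/eqP; rewrite subr_eq0; apply/eqP; congr cube_Rintegral.
    by apply/funext => u; rewrite rE scale1r pf.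
- rewrite -[RHS](@int01_cst R 0); apply: eq_int01 => s _.
  have rE (u : 'rV[R]_d) (r : R) : row_mx (s%:M : 'rV[R]_1) (u + r *: delta_mx 0 k) =
      row_mx (s%:M : 'rV[R]_1) u + r *: delta_mx 0 j.
    apply/rowP => i; rewrite !mxE jE; case: (split_ordP i) => l -> /=.
      case: eqP => [/(congr1 val)|_]; last by rewrite mulr0 addr0.
      by rewrite (ord1 l).
    by rewrite !mxE; congr (_ + _ * _).
  apply: (IH (fun u => f (row_mx (s%:M : 'rV[R]_1) u)) _ k).
  + exact: (@continuous_tail R d f).
  + exact: (@continuous_tail R d f').
  + move=> u r; have := df (row_mx (s%:M : 'rV[R]_1) u) r; rewrite -rE.
    by under eq_fun do rewrite -rE.
  + by move=> u; rewrite -[delta_mx 0 k]scale1r rE scale1r pf.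
Qed.

End CubeIntegralCalculus.

Section NonnegativeIntegral.
Context {R : realType}.
Local Open Scope ereal_scope.

(* Unlike [ge0_le_integral], no measurability is needed: both sides are suprema
   of integrals of simple functions. *)
Lemma ge0_le_integral_nomeas d (T : measurableType d)
    (nu : {measure set T -> \bar R}) (D : set T) (f g : T -> \bar R) :
  (forall x, D x -> 0 <= f x) -> (forall x, D x -> f x <= g x) ->
  \int[nu]_(x in D) f x <= \int[nu]_(x in D) g x.
Proof.
move=> f0 fg; have g0 x : D x -> 0 <= g x by move=> Dx; apply: le_trans (fg _ Dx); exact: f0.
have neg0 (k : T -> \bar R) : (forall x, D x -> 0 <= k x) -> (k \_ D)^\- = cst 0.
  move=> k0; apply/funext => x; rewrite funenegE; apply/max_idPr.
  by rewrite leeNl oppe0; exact: erestrict_ge0.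
rewrite /integral (neg0 f)// (neg0 g)//; apply: leeB => //.
apply: le_ereal_sup => _ [s /= sf <-]; exists s => //= x.
apply: (le_trans (sf x)); rewrite !funeposE !patchE.
case: ifPn => [/set_mem Dx|//].
by rewrite !max_l ?fg ?f0 ?g0.
Qed.

Lemma cube_integral_ge0 d (f : 'rV[R]_d -> \bar R) :
  (forall u, 0 <= f u) -> 0 <= cube_integral f.
Proof.
elim: d f => [|d IH] f f0 //=; apply: integral_ge0 => s _.
by apply: IH => u; exact: f0.
Qed.

Lemma ge0_le_cube_integral d (f g : 'rV[R]_d -> \bar R) :
  (forall u, 0 <= f u) -> (forall u, f u <= g u) ->
  cube_integral f <= cube_integral g.
Proof.
elim: d f g => [|d IH] f g f0 fg //=; apply: ge0_le_integral_nomeas => s _.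
  by apply: cube_integral_ge0.
exact: IH.
Qed.

End NonnegativeIntegral.

Section TorusIntegral.
Context {R : realType} {d : nat} (B : 'M[R]_d).
Implicit Types f g : 'rV[R]_d -> R.
Local Notation L := (torus_integral B).

(** The part of space seen by [torus_integral]. Pointwise comparisons are asked only there because
    compactness makes continuous coefficients bounded on it. *)
Definition torus_cell : set 'rV[R]_d :=
  [set u *m B | u in [set u | @unit_cube R d u]].

Lemma continuous_mulmx : continuous (fun u : 'rV[R]_d => u *m B).
Proof.
apply: continuous_mx => i j.
rewrite (_ : (fun x => _) = fun u : 'rV[R]_d => \sum_k u i k * B k j); last first.
  by apply/funext => x; rewrite mxE.
apply: continuous_sum => k; apply: continuous_mul; last exact: continuous_cst.
exact: coord_continuous.
Qed.

Lemma torus_cell_compact : compact torus_cell.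
Proof.
apply: continuous_compact; last exact: unit_cube_compact.
by apply: continuous_subspaceT; exact: continuous_mulmx.
Qed.

Let cmul f : continuous f -> continuous (fun u : 'rV[R]_d => f (u *m B)).
Proof. by move=> cf; exact: continuous_of_comp continuous_mulmx cf. Qed.

Lemma torus_integralE f : continuous f ->
  L f = `|\det B| * cube_Rintegral (fun u => f (u *m B)).
Proof.
move=> cf; rewrite /torus_integral /torus_eintegral cube_integral_EFin//.
exact: (cmul cf).
Qed.

Lemma torus_integralD f g : continuous f -> continuous g ->
  L (fun x => f x + g x) = L f + L g.
Proof.
move=> cf cg; rewrite !torus_integralE//; last exact: continuous_add.
by rewrite -mulrDr cube_RintegralD//; exact: cmul.
Qed.

Lemma torus_integralZ f (c : R) : continuous f -> L (fun x => c * f x) = c * L f.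
Proof.
move=> cf; rewrite !torus_integralE//; last first.
  by apply: continuous_mul => //; exact: continuous_cst.
by rewrite mulrCA cube_RintegralZ//; exact: cmul.
Qed.

Lemma torus_integralN f : continuous f -> L (fun x => - f x) = - L f.
Proof.
move=> cf; rewrite -mulN1r -torus_integralZ//.
by congr L; apply/funext => x; rewrite mulN1r.
Qed.

Lemma torus_integralB f g : continuous f -> continuous g ->
  L (fun x => f x - g x) = L f - L g.
Proof.
move=> cf cg; rewrite torus_integralD//; last exact: continuous_opp.
by rewrite torus_integralN.
Qed.

Lemma torus_integral_sum (I : finType) (F : I -> 'rV[R]_d -> R) :
  (forall i, continuous (F i)) -> L (fun x => \sum_i F i x) = \sum_i L (F i).
Proof.
move=> cF; rewrite (_ : (fun x => _) = \sum_i F i); last first.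
  by apply/funext => x; rewrite fct_sumE.
suff [] : continuous (\sum_i F i) /\ L (\sum_i F i) = \sum_i L (F i) by [].
elim/big_ind2 : _ => //.
- split; first exact: (@continuous_cst _ R 0).
  rewrite torus_integralE; last exact: (@continuous_cst _ R 0).
  by rewrite (cube_Rintegral_cst d 0) mulr0.
- move=> f a g b [cf <-] [cg <-]; split; first exact: continuous_add.
  exact: torus_integralD.
Qed.

Lemma le_torus_integral f g : continuous f -> continuous g ->
  (forall x, torus_cell x -> f x <= g x) -> L f <= L g.
Proof.
move=> cf cg fg; rewrite !torus_integralE// ler_wpM2l//.
apply: le_cube_Rintegral; [exact: cmul..|] => u u01.
by apply: fg; exists u.
Qed.

Lemma torus_integral_cst (c : R) : L (fun=> c) = `|\det B| * c.
Proof.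
by rewrite torus_integralE ?cube_Rintegral_cst//; exact: continuous_cst.
Qed.

Lemma torus_integral_ge0 f : continuous f ->
  (forall x, torus_cell x -> 0 <= f x) -> 0 <= L f.
Proof.
move=> cf f0; have := @le_torus_integral (fun=> 0) f (@continuous_cst _ _ _) cf f0.
by rewrite torus_integral_cst mulr0.
Qed.

Lemma torus_integral_eq0 f : B \in unitmx -> continuous f ->
  (forall x, torus_cell x -> 0 <= f x) -> L f = 0 ->
  forall x, torus_cell x -> f x = 0.
Proof.
move=> uB cf f0; rewrite torus_integralE// => /eqP; rewrite mulf_eq0 normr_eq0.
rewrite unitmxE unitfE in uB; rewrite (negbTE uB)/= => /eqP If _ [u u01 <-].
apply: (cube_Rintegral_eq0 (cmul cf) _ If u01) => v v01.
by apply: f0; exists v.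
Qed.

Lemma is_derive_torus_integral (F F' : R -> 'rV[R]_d -> R) (s : R) :
  (forall r, continuous (F r)) ->
  (forall x (r : R), is_derive r 1 (F ^~ x) (F' r x)) ->
  continuous (fun p : R * 'rV[R]_d => F' p.1 p.2) ->
  is_derive s 1 (fun r => L (F r)) (L (F' s)).
Proof.
move=> cF dF cF'.
have cF's r : continuous (F' r).
  apply: (continuous_of_comp _ cF' (f := fun u => (r, u))).
  by apply: continuous_pairing; [exact: continuous_cst|exact: continuous_idfun].
rewrite torus_integralE// (_ : (fun r => L (F r)) =
    `|\det B| \*: (fun r => cube_Rintegral (fun u => F r (u *m B)))); last first.
  by apply/funext => r; rewrite torus_integralE.
apply: is_deriveZ.
apply: (@is_derive_cube_Rintegral R d (fun r u => F r (u *m B)) (fun r u => F' r (u *m B))).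
- by move=> r; exact: cmul.
- apply: (continuous_of_comp _ cF' (f := fun p : R * 'rV[R]_d => (p.1, p.2 *m B))).
  apply: continuous_pairing; first exact: continuous_fst.
  exact: (continuous_of_comp (@continuous_snd R 'rV[R]_d) continuous_mulmx).
Qed.

(** Expanding [v] in the lattice basis, with coefficients [v *m invmx B], reduces to derivatives
    along the rows of [B]; these become partial derivatives in the cube coordinates. *)
Lemma torus_integral_derive f (v : 'rV[R]_d) : B \in unitmx -> Ck 1 f ->
  lattice_periodic B f -> L ('D_v f) = 0.
Proof.
move=> uB [df cf] pf.
pose c := v *m invmx B.
have vE : v = \sum_j c 0 j *: row j B.
  by rewrite -mulmx_sum_row mulmxKV.
have cf0 : continuous f by move=> x; exact: differentiable_continuous.
have -> : 'D_v f = fun x => \sum_j c 0 j * 'D_(row j B) f x.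
  by apply/funext => x; rewrite {1}vE derive_sumdir.
rewrite torus_integral_sum; last first.
  by move=> j; apply: continuous_mul; [exact: continuous_cst|exact: cf].
rewrite big1// => j _; rewrite torus_integralZ; last exact: cf.
rewrite torus_integralE; last exact: cf.
suff -> : cube_Rintegral (fun u : 'rV[R]_d => 'D_(row j B) f (u *m B)) = 0.
  by rewrite !mulr0.
apply: (@cube_Rintegral_partial _ _ (fun u => f (u *m B))
  (fun u => 'D_(row j B) f (u *m B)) j).
- exact: cmul.
- exact: cmul (cf _).
- move=> u r.
  have E (r' : R) : (u + r' *: delta_mx 0 j) *m B = u *m B + r' *: row j B.
    by rewrite mulmxDl -scalemxAl -rowE.
  rewrite E; under eq_fun do rewrite E.
  exact: differentiable_line.
- by move=> u; rewrite mulmxDl -rowE pf.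
Qed.

(** Here [g] will be the vertical energy integral as a function of [x]; the comparison spares any
    discussion of its measurability. *)
Lemma le_torus_eintegral f (g : 'rV[R]_d -> \bar R) : continuous f ->
  (forall x, 0 <= f x) -> (forall x, (f x)%:E <= g x)%E ->
  ((L f)%:E <= torus_eintegral B g)%E.
Proof.
move=> cf f0 fg; rewrite torus_integralE// EFinM; apply: lee_wpmul2l => //.
rewrite -cube_integral_EFin; last exact: cmul.
by apply: ge0_le_cube_integral => u; rewrite ?lee_fin.
Qed.

End TorusIntegral.

Lemma sum_option (R : nmodType) (I : finType) (F : option I -> R) :
  \sum_j F j = F None + \sum_i F (Some i).
Proof.
rewrite (bigD1 None)//=; congr (_ + _).
rewrite (reindex_omap Some id) => [|[i|]//].
by apply: eq_bigl => i; rewrite /= eqxx.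
Qed.

Lemma derive_ge0_le (R : realType) (f f' : R -> R) (b x y : R) :
  (forall r : R, r <= b -> is_derive r 1 f (f' r)) ->
  (forall r, r <= b -> 0 <= f' r) -> x <= y -> y <= b -> f x <= f y.
Proof.
move=> df f0 xy yb.
have [| |c cI E] := @MVT_segment _ f f' x y xy.
- by move=> r; rewrite in_itv/= => /andP[_ ry]; apply: df; rewrite (le_trans (ltW ry)).
- apply: derivable_within_continuous => r; rewrite in_itv/= => /andP[_ ry].
  by have [] := df r (le_trans ry yb).
rewrite -subr_ge0 E mulr_ge0 ?subr_ge0//.
by apply: f0; move: cI; rewrite in_itv/= => /andP[_ cy]; exact: le_trans yb.
Qed.

Lemma derive_eq0_cst (R : realType) (f : R -> R) (b x : R) :
  (forall r : R, r <= b -> is_derive r 1 f 0) -> x <= b -> f x = f b.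
Proof.
move=> df xb; apply/eqP; rewrite eq_le; apply/andP; split.
  exact: (@derive_ge0_le _ f (fun=> 0) b).
rewrite -lerN2; apply: (@derive_ge0_le _ (fun x => - f x) (fun=> 0) b) => // r rb.
by rewrite -oppr0; apply: is_deriveN; exact: df.
Qed.

(** * Fluxes through translated graphs *)

Section Graph.
Context {R : realType} {d : nat} (B : 'M[R]_d).
Implicit Types (h : 'rV[R]_d -> R) (G : 'rV[R]_d * R -> R).

(* [None] is the vertical direction. *)
Definition ev (j : option 'I_d) : 'rV[R]_d * R :=
  if j is Some i then (delta_mx 0 i, 0) else (0, 1).

Definition xperiodic G := forall y, lattice_periodic B (fun x => G (x, y)).

Lemma lattice_periodic_derive (k : 'rV[R]_d -> R) v :
  lattice_periodic B k -> lattice_periodic B ('D_v k).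
Proof.
move=> pk i x.
have E : (fun r : R => r^-1 *: ((k \o shift (x + row i B)) (r *: v) - k (x + row i B)))
    = (fun r : R => r^-1 *: ((k \o shift x) (r *: v) - k x)).
  by apply/funext => r /=; rewrite pk addrA pk.
by rewrite /derive E.
Qed.

Lemma xperiodic_derive G v : xperiodic G -> xperiodic ('D_v G).
Proof.
move=> pG y i x.
have E : (fun r : R => r^-1 *: ((G \o shift (x + row i B, y)) (r *: v) - G (x + row i B, y)))
    = (fun r : R => r^-1 *: ((G \o shift (x, y)) (r *: v) - G (x, y))).
  apply/funext => r /=; rewrite pG; congr (_ *: (_ - _)).
  case: v => v1 v2; have /= := pG (r * v2 + y) i (r *: v1 + x).
  by rewrite -addrA.
by rewrite /derive E.
Qed.

Lemma pair_addZ (x v : 'rV[R]_d) (a b r : R) :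
  (x, a) + r *: (v, b) = (x + r *: v, a + r * b).
Proof. by []. Qed.

Lemma is_derive_vertical G h x (z : R) : (forall p, differentiable G p) ->
  is_derive z 1 (fun z => G (x, h x + z)) ('D_(ev None) G (x, h x + z)).
Proof.
move=> dG.
have E (r : R) : (x, h x + r) = (x, h x) + r *: ev None.
  by rewrite pair_addZ scaler0 addr0 mulr1.
by rewrite E; under eq_fun do rewrite E; exact: differentiable_line.
Qed.

Lemma derive_graph G h x v (z : R) : differentiable G (x, h x + z) ->
  differentiable h x ->
  differentiable (fun x => G (x, h x + z)) x /\
  'D_v (fun x => G (x, h x + z)) x =
    'D_(v, 0) G (x, h x + z) + 'D_v h x * 'D_(ev None) G (x, h x + z).
Proof.
move=> dG dh.
have dhz : differentiable (fun x => h x + z) x.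
  by apply: differentiable_add => //; exact: differentiable_cst.
have dk : differentiable (fun x => (x, h x + z)) x.
  by apply: differentiable_pair.
have dc : differentiable (G \o (fun x => (x, h x + z))) x.
  exact: differentiable_comp.
split=> //.
have E : 'd (fun x => (x, h x + z)) x v = (v, 0) + 'D_v h x *: ev None.
  rewrite diff_pair//= pair_addZ scaler0 addr0 add0r mulr1; congr pair.
    by rewrite diff_val.
  rewrite -(deriveE _ dhz) (derive_add _ dh (differentiable_cst z x)).
  by rewrite derive_cst addr0.
rewrite (_ : (fun x => _) = G \o (fun x => (x, h x + z)))// deriveE// diff_comp//=.
by rewrite E linearD linearZ/= -!deriveE.
Qed.

Lemma continuous_trace G h : continuous G -> continuous h ->
  continuous (fun p : R * 'rV[R]_d => G (p.2, h p.2 + p.1)).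
Proof.
move=> cG ch; apply: (continuous_of_comp _ cG
  (f := fun p : R * 'rV[R]_d => (p.2, h p.2 + p.1))).
apply: continuous_pairing; first exact: continuous_snd.
apply: continuous_add; last exact: continuous_fst.
exact: (continuous_of_comp (@continuous_snd R 'rV[R]_d) ch).
Qed.

Lemma continuous_trace_at G h z : continuous G -> continuous h ->
  continuous (fun x : 'rV[R]_d => G (x, h x + z)).
Proof.
move=> cG ch; apply: (continuous_of_comp _ cG (f := fun x : 'rV[R]_d => (x, h x + z))).
apply: continuous_pairing; first exact: continuous_idfun.
by apply: continuous_add => //; exact: continuous_cst.
Qed.

(* [(- grad h, 1)], that is, [sqrt (1 + |grad h|^2)] times the outward normal. *)
Definition conormal h (j : option 'I_d) (x : 'rV[R]_d) : R :=
  if j is Some i then - 'D_(delta_mx 0 i) h x else 1.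

Definition flux h (F : option 'I_d -> 'rV[R]_d * R -> R) (z : R) : R :=
  torus_integral B (fun x => \sum_j conormal h j x * F j (x, h x + z)).

Lemma continuous_conormal h j : Ck 1 h -> continuous (conormal h j).
Proof.
case: j => [i|] [_ ch]; last exact: continuous_cst.
by apply: continuous_opp; exact: ch.
Qed.

(* The flux through the surface translated vertically by [z] is an integral over
   the fixed torus, so that the divergence theorem becomes a derivative in [z]. *)
Lemma is_derive_flux h F (z : R) : B \in unitmx -> Ck 1 h -> lattice_periodic B h ->
  (forall j, Ck 1 (F j)) -> (forall j, xperiodic (F j)) ->
  is_derive z 1 (flux h F)
    (torus_integral B (fun x => \sum_j 'D_(ev j) (F j) (x, h x + z))).
Proof.
move=> uB Ch ph CF pF; have [dh cDh] := Ch; have ch := Ck_continuous Ch.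
have dF j p : differentiable (F j) p by have [] := CF j.
have cF j : continuous (F j) := Ck_continuous (CF j).
have cDF j v : continuous ('D_v (F j)) by have [] := CF j.
have ct j v (r : R) : continuous (fun x => 'D_v (F j) (x, h x + r)).
  exact: (continuous_trace_at (cDF j v) ch).
pose F' (z : R) x := \sum_j conormal h j x * 'D_(ev None) (F j) (x, h x + z).
have -> : torus_integral B (fun x => \sum_j 'D_(ev j) (F j) (x, h x + z)) =
    torus_integral B (F' z).
  apply/eqP; rewrite -subr_eq0; apply/eqP; rewrite -torus_integralB; last 2 first.
  - by apply: continuous_sum => j; exact: ct.
  - apply: continuous_sum => j; apply: continuous_mul; first exact: continuous_conormal.
    exact: ct.
  (* The full divergence minus the vertical derivative of the flux density is the horizontal
     divergence of the traces [F (Some i) (x, h x + z)], which integrates to zero by periodicity. *)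
  rewrite (_ : (fun x => _) = fun x => \sum_i
      'D_(delta_mx 0 i) (fun x => F (Some i) (x, h x + z)) x); last first.
    apply/funext => x; rewrite /F' !sum_option /conormal mul1r opprD addrACA subrr add0r.
    rewrite -sumrB; apply: eq_bigr => i _.
    by have [_ ->] := @derive_graph (F (Some i)) h x (delta_mx 0 i) z (dF _ _) (dh _);
      rewrite mulNr opprK.
  rewrite torus_integral_sum; last first.
    move=> i; rewrite (_ : 'D_(_) _ = fun x => 'D_(delta_mx 0 i, 0) (F (Some i)) (x, h x + z)
        + 'D_(delta_mx 0 i) h x * 'D_(ev None) (F (Some i)) (x, h x + z)).
      apply: continuous_add; first exact: ct.
      by apply: continuous_mul; [exact: cDh|exact: ct].
    apply/funext => x.
    by have [_ ->] := @derive_graph (F (Some i)) h x (delta_mx 0 i) z (dF _ _) (dh _).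
  rewrite big1// => i _; apply: torus_integral_derive => //.
    split=> [x|v].
      by have [] := @derive_graph (F (Some i)) h x 0 z (dF _ _) (dh _).
    rewrite (_ : 'D_v _ = fun x => 'D_(v, 0) (F (Some i)) (x, h x + z)
        + 'D_v h x * 'D_(ev None) (F (Some i)) (x, h x + z)).
      apply: continuous_add; first exact: ct.
      by apply: continuous_mul; [exact: cDh|exact: ct].
    apply/funext => x.
    by have [_ ->] := @derive_graph (F (Some i)) h x v z (dF _ _) (dh _).
  by move=> k x; rewrite ph pF.
apply: (@is_derive_torus_integral R d B
  (fun z x => \sum_j conormal h j x * F j (x, h x + z)) F' z).
- move=> r; apply: continuous_sum => j; apply: continuous_mul.
    exact: continuous_conormal.
  exact: (continuous_trace_at (cF j) ch).
- move=> x r.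
  rewrite (_ : (fun z => \sum_j conormal h j x * F j (x, h x + z)) =
     \sum_j (fun z : R => conormal h j x * F j (x, h x + z))); last first.
    by apply/funext => y; rewrite fct_sumE.
  have H j : is_derive r 1 (fun z : R => conormal h j x * F j (x, h x + z))
      (conormal h j x * 'D_(ev None) (F j) (x, h x + r)).
    by apply: is_deriveZ; exact: is_derive_vertical.
  rewrite /F'; elim/big_rec2 : _ => [|j a b _ dab]; first exact: is_derive_cst.
  exact: is_deriveD.
- apply: continuous_sum => j; apply: continuous_mul.
    exact: (continuous_of_comp (@continuous_snd R 'rV[R]_d) (@continuous_conormal h j Ch)).
  exact: (continuous_trace (cDF j _) ch).
Qed.

End Graph.

(** * Growth and decay along the half-line of depths *)

Section RealLine.
Context {R : realType}.

(* A lower bound [c / (1 - z)] on the derivative would make the primitive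
   diverge logarithmically. *)
Lemma derivative_small (I E : R -> R) (b c z0 : R) :
  (forall z : R, z <= 0 -> is_derive z 1 I (E z)) ->
  (forall z, z <= 0 -> b <= I z) -> 0 < c -> z0 <= 0 ->
  exists2 z, z <= z0 & E z * (1 - z) < c.
Proof.
move=> dI Ib c0 z00; apply/not_exists2P => H.
have {}H z : z <= z0 -> c <= E z * (1 - z).
  by move=> zz0; case: (H z) => // /negP; rewrite -leNgt.
have pos z : z <= z0 -> 0 < 1 - z.
  by move=> zz0; rewrite subr_gt0 (le_lt_trans zz0)// (le_lt_trans z00).
pose f z := I z + c * ln (1 - z).
have df (z : R) : z <= z0 -> is_derive z 1 f (E z - c / (1 - z)).
  move=> zz0; apply: is_deriveD; first by apply: dI; exact: le_trans z00.
  rewrite -mulrN; apply: is_deriveZ.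
  have d1 : is_derive z 1 (fun z : R => 1 - z) (-1).
    by rewrite -[X in is_derive _ _ _ X]add0r; apply: is_deriveB.
  have := @is_derive1_comp _ (@ln R) (fun z => 1 - z) z _ _ (is_derive1_ln (pos z zz0)) d1.
  by rewrite mulrN1.
have fle z : z <= z0 -> f z <= f z0.
  move=> zz0; apply: (derive_ge0_le df) => // r rz0.
  by rewrite subr_ge0 ler_pdivrMr ?pos// H.
(* This [y] gives [b + c * y = f z0 + c], just above the monotonicity bound [f z0]; [z] is then
   taken so deep that [ln (1 - z) >= y]. *)
pose y := (f z0 - b) / c + 1.
pose z := Num.min z0 (1 - expR y).
have zz0 : z <= z0 by rewrite /z ge_min lexx.
have yz : y <= ln (1 - z).
  rewrite -ler_expR lnK ?posrE ?pos// lerBrDr -lerBrDl.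
  by rewrite /z ge_min lexx orbT.
have := fle z zz0; rewrite /f -/(f z0) leNgt => /negP; apply.
apply: (@lt_le_trans _ _ (b + c * y)).
  by rewrite /y mulrDr mulr1 mulrCA divff ?gt_eqF// mulr1 addrA [b + _]addrC subrK ltrDl.
apply: lerD; first by apply: Ib; exact: le_trans z00.
by rewrite ler_pM2l.
Qed.

(** The choice [l = 1 - z] turns the family of inequalities into the monotonicity of
    [m z / (1 - z) + I z], whose value at [0] then bounds [m z / (1 - z)] since [I >= b]. *)
Lemma linear_growth (m m' I E : R -> R) (b : R) :
  (forall z : R, z <= 0 -> is_derive z 1 m (m' z)) ->
  (forall z : R, z <= 0 -> is_derive z 1 I (E z)) ->
  (forall z, z <= 0 -> b <= I z) ->
  (forall z l, z <= 0 -> 0 < l -> - m' z <= l^-1 * m z + l * E z) ->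
  exists C, forall z, z <= 0 -> m z <= C * (1 - z).
Proof.
move=> dm dI Ib H; pose f z := m z * (1 - z)^-1 + I z.
have pos (z : R) : z <= 0 -> 0 < 1 - z.
  by move=> zz0; rewrite subr_gt0 (le_lt_trans zz0).
have df (z : R) : z <= 0 -> is_derive z 1 f
    (m z * (- (1 - z) ^- 2 * -1) + (1 - z)^-1 * m' z + E z).
  move=> zz0; apply: is_deriveD; last exact: dI.
  have d1 : is_derive z 1 (fun z : R => 1 - z) (-1).
    by rewrite -[X in is_derive _ _ _ X]add0r; apply: is_deriveB.
  apply: is_deriveM; first exact: dm.
  by apply: is_deriveV => //; rewrite gt_eqF// pos.
exists (m 0 + (I 0 - b)) => z z0.
have : f z <= f 0.
  apply: (derive_ge0_le df) => // r r0; have pr := pos r r0.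
  have := H r (1 - r) r0 pr; rewrite -(ler_pM2l (x := (1 - r)^-1)) ?invr_gt0//.
  rewrite mulrDr mulKf ?gt_eqF// mulrA -invfM -expr2 mulrN.
  by rewrite mulrN1 opprK [m r * _]mulrC -subr_ge0 opprK addrAC.
rewrite /f subr0 invr1 mulr1 => fz.
rewrite -ler_pdivrMr ?pos//; have := Ib z z0; lra.
Qed.

Lemma continuous_eq0_left (f : R -> R) : continuous f ->
  (forall z, z < 0 -> f z = 0) -> f 0 = 0.
Proof.
move=> cf f0; apply/eqP/negPn/negP => fn0.
have n0 : 0 < `|f 0| by rewrite normr_gt0.
have /cvgrPdist_lt /(_ _ n0) /nbhs_ballP[e /= e0 H] := cf 0.
have : ball 0 e (- (e / 2)).
  by rewrite /ball/= sub0r opprK gtr0_norm ?divr_gt0// ltr_pdivrMr// ltr_pMr// ltr1n.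
by move=> /H; rewrite (f0 (- (e / 2))) ?oppr_lt0 ?divr_gt0// subr0 ltxx.
Qed.

End RealLine.

Lemma torus_cell_bounded (R : realType) (d : nat) (B : 'M[R]_d) (f : 'rV[R]_d -> R) :
  continuous f -> exists2 M : R, 0 < M & forall x, torus_cell B x -> `|f x| <= M.
Proof.
move=> cf.
have cK : compact (f @` torus_cell B).
  by apply: continuous_compact; [exact: continuous_subspaceT|exact: torus_cell_compact].
have [M [Mr HM]] := compact_bounded cK.
exists (`|M| + 1); first by rewrite ltr_wpDl.
move=> x cx; apply: HM; last by exists x.
by rewrite (le_lt_trans (ler_norm _))// ltrDl.
Qed.

(** * Layer energies and the total energy below the graph *)

Section VerticalEnergy.
Context {R : realType} {d : nat} (B : 'M[R]_d) (h : 'rV[R]_d -> R).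
Hypotheses (uB : B \in unitmx) (ch : continuous h).
Variable (e : 'rV[R]_d * R -> R).
Hypotheses (se : smooth e) (e0 : forall p, 0 <= e p).
Local Notation mu := (@lebesgue_measure R).
Local Notation L := (torus_integral B).

(** The integral of [e] over the vertical segment of length [l] under the surface, rescaled by
    [y = h x - l * r] so that the domain of integration is fixed. *)
Let slab (l : R) (x : 'rV[R]_d) : R :=
  (\int[mu]_(r in `[0, 1]) (l * e (x, h x - l * r)))%R.

Let cslab2 : continuous (fun p : (R * 'rV[R]_d) * R => e (p.1.2, h p.1.2 - p.1.1 * p.2)).
Proof.
apply: (continuous_of_comp _ (smooth_continuous se) (f := fun p : (R * 'rV[R]_d) * R =>
  (p.1.2, h p.1.2 - p.1.1 * p.2))).
have c12 : continuous (fun p : (R * 'rV[R]_d) * R => p.1.2).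
  by apply: (continuous_of_comp (@continuous_fst _ _)); exact: continuous_snd.
apply: continuous_pairing => //; apply: continuous_sub.
  exact: (continuous_of_comp c12 ch).
apply: continuous_mul; last exact: continuous_snd.
by apply: (continuous_of_comp (@continuous_fst _ _)); exact: continuous_fst.
Qed.

Let cslab l : continuous (slab l).
Proof.
apply: (@continuous_int01 R _ (fun x r => l * e (x, h x - l * r))).
apply: continuous_mul; first exact: continuous_cst.
apply: (continuous_of_comp _ cslab2 (f := fun p : 'rV[R]_d * R => ((l, p.1), p.2))).
apply: continuous_pairing; last exact: continuous_snd.
by apply: continuous_pairing; [exact: continuous_cst|exact: continuous_fst].
Qed.

Let ce x : continuous (fun y : R => e (x, y)).
Proof.
apply: (continuous_of_comp _ (smooth_continuous se) (f := fun y : R => (x, y))).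
by apply: continuous_pairing; [exact: continuous_cst|exact: continuous_idfun].
Qed.

Let cey x : continuous (fun y : R => 'D_(ev None) e (x, y)).
Proof.
apply: (continuous_of_comp _ (smooth_continuous (smooth_derive (ev None) se))
  (f := fun y : R => (x, y))).
by apply: continuous_pairing; [exact: continuous_cst|exact: continuous_idfun].
Qed.

Let dey x (y : R) : is_derive y 1 (fun y : R => e (x, y)) ('D_(ev None) e (x, y)).
Proof.
have := @is_derive_vertical R d e (fun=> 0) x y (fun p => smooth_differentiable p se).
by rewrite add0r; under eq_fun do rewrite add0r.
Qed.

Let dcomp x (a b : R) (r : R) : is_derive r 1 (fun r : R => e (x, a - b * r))
  ('D_(ev None) e (x, a - b * r) * - b).
Proof.
have d1 : is_derive r 1 (fun r : R => a - b * r) (- b).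
  rewrite -[X in is_derive _ _ _ X]add0r -[X in 0 - X]mulr1.
  by apply: is_deriveB; apply: is_deriveZ.
exact: (@is_derive1_comp _ (fun y => e (x, y)) (fun r => a - b * r) r _ _ (dey x _) d1).
Qed.

Let dslab x (l : R) : is_derive l 1 (slab ^~ x) (e (x, h x - l)).
Proof.
(* The [l]-derivative of [l * e (x, h x - l * r)] equals the [r]-derivative of
   [r * e (x, h x - l * r)], so its integral over [[0, 1]] is the end value [e (x, h x - l)]. Using
   the one-dimensional cube makes [is_derive_cube_Rintegral] applicable. *)
pose k' (l r : R) := e (x, h x - l * r) + l * ('D_(ev None) e (x, h x - l * r) * - r).
pose F (l : R) (u : 'rV[R]_1) := l * e (x, h x - l * u 0 0).
have E1 (f : R -> R) : cube_Rintegral (fun u : 'rV[R]_1 => f (u 0 0)) =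
    (\int[mu]_(r in `[0, 1]) f r)%R.
  rewrite /=; apply: eq_int01 => r _; congr f.
  by rewrite mxE; case: split_ordP => k // _; rewrite mxE !ord1.
have -> : slab ^~ x = fun l => cube_Rintegral (F l).
  by apply/funext => l'; rewrite (E1 (fun r => l' * e (x, h x - l' * r))).
have -> : e (x, h x - l) = cube_Rintegral (fun u : 'rV[R]_1 => k' l (u 0 0)).
  apply: esym; rewrite E1.
  apply: (etrans (@int01_FTC R (fun r => r * e (x, h x - l * r)) (k' l) _ _)).
  - move=> r; have d1 : is_derive r 1 (fun r : R => r) 1 by exact: is_derive_id.
    apply: (is_derive_eq (is_deriveM d1 (dcomp x (h x) l r))).
    rewrite /k' /GRing.scale/=; move: ('D_(ev None) e _) (e _) => a b; ring.
  - have cr : continuous (fun r : R => h x - l * r).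
      by apply: continuous_sub; [exact: continuous_cst|apply: continuous_mul;
        [exact: continuous_cst|exact: continuous_idfun]].
    rewrite /k'; apply: continuous_add; first exact: (continuous_of_comp cr (@ce x)).
    apply: continuous_mul; first exact: continuous_cst.
    apply: continuous_mul; first exact: (continuous_of_comp cr (@cey x)).
    by apply: continuous_opp; exact: continuous_idfun.
  - by rewrite !mul1r mul0r subr0 mulr1.
apply: (@is_derive_cube_Rintegral R 1 F (fun l u => k' l (u 0 0))).
- move=> r; rewrite /F; apply: continuous_mul; first exact: continuous_cst.
  apply: (continuous_of_comp _ (@ce x)
    (f := fun u : 'rV[R]_1 => h x - r * u 0 0)).
  apply: continuous_sub; first exact: continuous_cst.
  by apply: continuous_mul; [exact: continuous_cst|exact: coord_continuous].
- move=> u r; have d1 : is_derive r 1 (fun r : R => r) 1 by exact: is_derive_id.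
  have d2 := dcomp x (h x) (u 0 0) r.
  have d3 : is_derive r 1 (fun r : R => e (x, h x - r * u 0 0))
      ('D_(ev None) e (x, h x - r * u 0 0) * - u 0 0).
    by rewrite [r * _]mulrC; under eq_fun do rewrite [_ * u 0 0]mulrC.
  apply: (is_derive_eq (is_deriveM d1 d3)).
  by rewrite /k' /GRing.scale/= mulr1 addrC.
- have c1 : continuous (fun p : R * 'rV[R]_1 => p.2 0 0).
    exact: (continuous_of_comp (@continuous_snd R 'rV[R]_1) (@coord_continuous _ 1 1 0 0)).
  have cl : continuous (fun p : R * 'rV[R]_1 => h x - p.1 * p.2 0 0).
    by apply: continuous_sub; [exact: continuous_cst|apply: continuous_mul => //;
      exact: continuous_fst].
  rewrite /k'; apply: continuous_add; first exact: (continuous_of_comp cl (@ce x)).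
  apply: continuous_mul; first exact: continuous_fst.
  apply: continuous_mul; first exact: (continuous_of_comp cl (@cey x)).
  exact: continuous_opp.
Qed.

Let slab_le x (l : R) : 0 <= l ->
  ((slab l x)%:E <= \int[mu]_(y in `]-oo, h x[) (e (x, y))%:E)%E.
Proof.
(* The case [l = 0] is separate because the substitution [y = h x - l * r] must be strictly
   decreasing. *)
rewrite le_eqVlt => /predU1P[<-|l0].
  rewrite /slab (@eq_int01 _ _ (fun=> 0)) => [|r _]; last by rewrite mul0r.
  by rewrite int01_cst; apply: integral_ge0 => y _; rewrite lee_fin.
have -> : (slab l x)%:E = (\int[mu]_(y in `[(h x - l)%R, h x]) (e (x, y))%:E)%E.
  rewrite /slab -int01_EFin; last first.
    apply: continuous_mul; first exact: continuous_cst.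
    apply: (continuous_of_comp _ (@ce x)).
    by apply: continuous_sub; [exact: continuous_cst|apply: continuous_mul;
      [exact: continuous_cst|exact: continuous_idfun]].
  pose F (r : R) := h x - l * r.
  have dF (r : R) : is_derive r 1 F (- l).
    rewrite -[X in is_derive _ _ _ X]add0r -[X in 0 - X]mulr1.
    by apply: is_deriveB; apply: is_deriveZ.
  have F'E : derive1 F = cst (- l).
    by apply/funext => r; rewrite derive1E; have [] := dF r.
  have cF : continuous F := is_derive_continuous dF.
  have := @integration_by_substitution_decreasing R F (fun y => e (x, y)) 0 1 ler01.
  have F1 : F 1 = h x - l by rewrite /F mulr1.
  have F0 : F 0 = h x by rewrite /F mulr0 subr0.
  rewrite F1 F0 => -> //.
  - apply: eq_integral => r _; rewrite /= F'E /= opprK mulrC //.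
  - by move=> r s _ _ rs; rewrite /F ltrD2l ltrN2 ltr_pM2l.
  - by rewrite F'E => r _; exact: cvg_cst.
  - by rewrite F'E; exact: is_cvg_cst.
  - by rewrite F'E; exact: is_cvg_cst.
  - split.
    + by move=> r _; have [] := dF r.
    + by apply: cvg_at_right_filter; exact: cF.
    + by apply: cvg_at_left_filter; exact: cF.
  - by apply: continuous_subspaceT; exact: ce.
have me : measurable_fun setT (fun y : R => e (x, y)).
  by apply: measurable_realfun.continuous_measurable_fun; exact: ce.
rewrite -integral_itv_bndo_bndc; last first.
  by apply/measurable_realfun.measurable_EFinP; exact: measurable_funTS me.
apply: ge0_subset_integral => //.
- by apply/measurable_realfun.measurable_EFinP; exact: measurable_funTS me.
- by move=> y _; rewrite lee_fin.
- by move=> y /=; rewrite !in_itv/= => /andP[].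
Qed.

(* The energy [W l] of the slab between the surface and its translate by [- l]
   satisfies [W' l = L (fun x => e (x, h x - l))], so that [I z + W (- z)] is
   constant. *)
Lemma vertical_energy_bound (I : R -> R) :
  (torus_eintegral B (fun x => \int[mu]_(y in `]-oo, h x[) (e (x, y))%:E) < +oo)%E ->
  (forall z : R, z <= 0 -> is_derive z 1 I (L (fun x => e (x, h x + z)))) ->
  exists b, forall z, z <= 0 -> b <= I z.
Proof.
move=> fin dI.
set K := torus_eintegral B _ in fin.
exists (I 0 - fine K) => z z0.
have dW (l : R) : is_derive l 1 (fun l => L (slab l)) (L (fun x => e (x, h x - l))).
  apply: (@is_derive_torus_integral R d B slab (fun l x => e (x, h x - l))).
  - exact: cslab.
  - by move=> x r; exact: dslab.
  - apply: (continuous_of_comp _ (continuous_trace (smooth_continuous se) ch)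
      (f := fun p : R * 'rV[R]_d => (- p.1, p.2))).
    apply: continuous_pairing; last exact: continuous_snd.
    by apply: continuous_opp; exact: continuous_fst.
have dJ (r : R) : r <= 0 -> is_derive r 1 (fun r => I r + L (slab (- r))) 0.
  move=> r0.
  have d1 : is_derive r 1 (fun r : R => - r) (-1) by apply: is_deriveN.
  have := @is_derive1_comp _ (fun l => L (slab l)) (fun r => - r) r _ _ (dW (- r)) d1.
  rewrite opprK mulrN1 => d2.
  apply: (is_derive_eq (is_deriveD (dI _ r0) d2)); exact: subrr.
have := derive_eq0_cst dJ z0; rewrite oppr0.
have -> : L (slab 0) = 0.
  rewrite -[RHS](mulr0 `|\det B|) -torus_integral_cst; congr (L _).
  apply/funext => x; rewrite /slab (@eq_int01 _ _ (fun=> 0)) => [|r _].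
    exact: int01_cst.
  by rewrite mul0r.
rewrite addr0 => <-; rewrite lerBlDr lerD2l.
have WK : ((L (slab (- z)))%:E <= K)%E.
  apply: le_torus_eintegral => [|x|x]; first exact: cslab.
    apply: Rintegral_ge0 => r _; rewrite mulr_ge0// oppr_ge0//.
  by apply: slab_le; rewrite oppr_ge0.
have K0 : (0 <= K)%E.
  apply: mule_ge0 => //; apply: cube_integral_ge0 => u; apply: integral_ge0 => y _.
  by rewrite lee_fin.
have Kfin : K \is a fin_num by rewrite ge0_fin_numE.
by rewrite -lee_fin (fineK Kfin).
Qed.

End VerticalEnergy.

Lemma young_ineq (R : realType) (a b l : R) : 0 < l ->
  2 * `|a * b| <= l * a ^+ 2 + l^-1 * b ^+ 2.
Proof.
move=> l0; have l0' : 0 < l^-1 by rewrite invr_gt0.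
have := mulr_ge0 (ltW l0') (sqr_ge0 (l * `|a| - `|b|)).
rewrite normrM -(real_normK (num_real a)) -(real_normK (num_real b)).
have E (x y : R) : l^-1 * (l * x - y) ^+ 2 = l * x ^+ 2 + l^-1 * y ^+ 2 - 2 * (x * y).
  by field; rewrite gt_eqF.
by rewrite E subr_ge0.
Qed.

(** * Harmonic extensions *)

Section HarmonicExtensions.
Context {R : realType} {d : nat} (B : 'M[R]_d) (h : 'rV[R]_d -> R).
Hypotheses (uB : B \in unitmx) (sh : smooth h) (ph : lattice_periodic B h).
Implicit Types (f g phi G : 'rV[R]_d * R -> R).
Local Notation L := (torus_integral B).
Local Notation mu := (@lebesgue_measure R).

Definition grad_sq phi p : R := \sum_j ('D_(ev j) phi p) ^+ 2.

(** No trace is prescribed, so that extensions of different data are treated alike. The equation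
    includes the surface [z = 0], where it is inherited by continuity. *)
Definition decaying_harmonic phi : Prop :=
  [/\ smooth phi, xperiodic B phi,
      (torus_eintegral B (fun x =>
         \int[mu]_(y in `]-oo, h x[) (grad_sq phi (x, y))%:E) < +oo)%E
    & forall x z, z <= 0 -> \sum_j 'D_(ev j) ('D_(ev j) phi) (x, h x + z) = 0].

(** At [z = 0], for extensions of [psi1] and [psi2], this is the bilinear form
    [int psi1 G(h) psi2]. *)
Definition flux_grad phi1 phi2 : R -> R :=
  flux B h (fun j p => phi1 p * 'D_(ev j) phi2 p).

Definition mass phi z : R := L (fun x => phi (x, h x + z) ^+ 2).

Definition dirichlet phi z : R := L (fun x => grad_sq phi (x, h x + z)).

Let ch : continuous h := smooth_continuous sh.

Lemma continuous_layer G z : continuous G -> continuous (fun x => G (x, h x + z)).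
Proof. by move=> cG; exact: continuous_trace_at. Qed.

Lemma continuous_layer_derive G v z : smooth G ->
  continuous (fun x => 'D_v G (x, h x + z)).
Proof.
move=> sG; apply: (@continuous_layer ('D_v G)).
by apply: smooth_continuous; exact: smooth_derive.
Qed.

Lemma is_derive_layer (w : 'rV[R]_d -> R) G (z : R) : continuous w -> Ck 1 G ->
  is_derive z 1 (fun z => L (fun x => w x * G (x, h x + z)))
    (L (fun x => w x * 'D_(ev None) G (x, h x + z))).
Proof.
move=> cw CG; have [dG cDG] := CG.
apply: (@is_derive_torus_integral R d B (fun z x => w x * G (x, h x + z))
  (fun z x => w x * 'D_(ev None) G (x, h x + z))).
- move=> r; apply: continuous_mul => //.
  by apply: continuous_layer; exact: Ck_continuous CG.
- by move=> x r; apply: is_deriveZ; exact: is_derive_vertical.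
- apply: continuous_mul; last exact: (continuous_trace (cDG _) ch).
  exact: (continuous_of_comp (@continuous_snd R 'rV[R]_d) cw).
Qed.

Lemma smooth_grad_sq phi : smooth phi -> smooth (grad_sq phi).
Proof.
move=> sphi; apply: smooth_sum => j.
by apply: smooth_mul; exact: smooth_derive.
Qed.

Lemma grad_sq_ge0 phi p : 0 <= grad_sq phi p.
Proof. by apply: sumr_ge0 => j _; rewrite sqr_ge0. Qed.

Lemma derive_sq_le_grad_sq phi p j : ('D_(ev j) phi p) ^+ 2 <= grad_sq phi p.
Proof.
rewrite /grad_sq (bigD1 j)//= lerDl; apply: sumr_ge0 => k _; exact: sqr_ge0.
Qed.

Lemma dirichlet_ge0 phi z : smooth phi -> 0 <= dirichlet phi z.
Proof.
move=> sphi; apply: torus_integral_ge0 => [|x _]; last exact: grad_sq_ge0.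
by apply: continuous_layer; apply: smooth_continuous; exact: smooth_grad_sq.
Qed.

Lemma harmonic_extension_decaying psi phi :
  harmonic_extension B h psi phi -> decaying_harmonic phi.
Proof.
move=> [[sphi pphi] fin harm _]; split=> //.
  rewrite (_ : (fun x => _) = (fun x => \int[mu]_(y in `]-oo, h x[)
    (\sum_i (dx i phi (x, y)) ^+ 2 + (dy phi (x, y)) ^+ 2)%:E)%E)//.
  apply/funext => x; apply: eq_integral => y _.
  by rewrite /grad_sq sum_option addrC.
move=> x z; rewrite le_eqVlt => /predU1P[->|z0]; last first.
  by rewrite sum_option addrC; apply: harm; rewrite gtrDl.
pose lap p := \sum_j 'D_(ev j) ('D_(ev j) phi) p.
have slap : smooth lap by apply: smooth_sum => j; do 2!apply: smooth_derive.
apply: (@continuous_eq0_left R (fun z => lap (x, h x + z))) => [|r r0].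
  apply: (continuous_of_comp _ (continuous_trace (smooth_continuous slap) ch)
    (f := fun z : R => (z, x))).
  by apply: continuous_pairing; [exact: continuous_idfun|exact: continuous_cst].
by rewrite /lap sum_option addrC; apply: harm; rewrite gtrDl.
Qed.

Lemma is_derive_flux_grad phi1 phi2 (z : R) : smooth phi1 -> xperiodic B phi1 ->
  smooth phi2 -> xperiodic B phi2 ->
  (forall x, \sum_j 'D_(ev j) ('D_(ev j) phi2) (x, h x + z) = 0) ->
  is_derive z 1 (flux_grad phi1 phi2)
    (L (fun x => \sum_j 'D_(ev j) phi1 (x, h x + z) * 'D_(ev j) phi2 (x, h x + z))).
Proof.
move=> s1 p1 s2 p2 harm.
apply: (is_derive_eq (is_derive_flux z uB (sh 1%N) ph _ _)).
- by move=> j; apply: Ck_mul; [exact: s1|exact: smooth_derive].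
- by move=> j y i x; rewrite p1 (xperiodic_derive _ p2).
- congr (L _); apply/funext => x.
  transitivity (phi1 (x, h x + z) * \sum_j 'D_(ev j) ('D_(ev j) phi2) (x, h x + z) +
    \sum_j 'D_(ev j) phi1 (x, h x + z) * 'D_(ev j) phi2 (x, h x + z)); last first.
    by rewrite harm mulr0 add0r.
  rewrite mulr_sumr -big_split/=; apply: eq_bigr => j _.
  rewrite derive_mul; last 2 first.
  + exact: smooth_differentiable.
  + by apply: smooth_differentiable; exact: smooth_derive.
  by congr (_ + _); rewrite mulrC.
Qed.

Lemma is_derive_flux_grad_self phi (z : R) : decaying_harmonic phi -> z <= 0 ->
  is_derive z 1 (flux_grad phi phi) (dirichlet phi z).
Proof.
move=> [sphi pphi _ harm] z0.
exact: is_derive_flux_grad (fun x => harm x z z0).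
Qed.

(** The [z]-derivative of this flux is the layer energy, whose integral over all depths is the
    finite Dirichlet energy. *)
Lemma flux_grad_bounded_below phi : decaying_harmonic phi ->
  exists b, forall z, z <= 0 -> b <= flux_grad phi phi z.
Proof.
move=> dphi; have [sphi pphi fin harm] := dphi.
apply: (@vertical_energy_bound R d B h ch (grad_sq phi)) => //.
- exact: smooth_grad_sq.
- exact: grad_sq_ge0.
- by move=> z z0; exact: is_derive_flux_grad_self.
Qed.

(** Energy does not bound the size of [phi] directly. The derivative of the mass is
    [int 2 phi d_y phi], and Young's inequality with weight [l^-1] puts it in the form required by
    [linear_growth]. *)
Lemma mass_linear_growth phi : decaying_harmonic phi ->
  exists C, forall z, z <= 0 -> mass phi z <= C * (1 - z).
Proof.
move=> dphi; have [sphi pphi fin harm] := dphi.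
have [b Hb] := flux_grad_bounded_below dphi.
have sq : smooth (fun p => phi p ^+ 2) by exact: smooth_mul.
have cw : continuous (fun _ : 'rV[R]_d => 1 : R) by exact: continuous_cst.
pose m' z := L (fun x => 1 * 'D_(ev None) (fun p => phi p ^+ 2) (x, h x + z)).
have dm (z : R) : is_derive z 1 (mass phi) (m' z).
  rewrite (_ : mass phi = fun z => L (fun x => 1 * phi (x, h x + z) ^+ 2)).
    exact: (@is_derive_layer _ (fun p => phi p ^+ 2) z cw (sq 1%N)).
  by apply/funext => r; congr (L _); apply/funext => x; rewrite mul1r.
apply: (@linear_growth R (mass phi) m' (flux_grad phi phi) (dirichlet phi) b) => //.
  by move=> z z0; exact: is_derive_flux_grad_self.
move=> z l z0 l0.
have cphi : continuous (fun x => phi (x, h x + z) ^+ 2).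
  by apply: (@continuous_layer (fun p => phi p ^+ 2)); exact: smooth_continuous.
have cg : continuous (fun x => grad_sq phi (x, h x + z)).
  by apply: continuous_layer; apply: smooth_continuous; exact: smooth_grad_sq.
have cD : continuous (fun x => 1 * 'D_(ev None) (fun p => phi p ^+ 2) (x, h x + z)).
  by apply: continuous_mul => //; exact: continuous_layer_derive.
rewrite /m' -torus_integralN// /mass /dirichlet -!torus_integralZ//.
rewrite -torus_integralD; [|by apply: continuous_mul => //; exact: continuous_cst..].
apply: le_torus_integral.
- exact: continuous_opp.
- by apply: continuous_add; apply: continuous_mul => //; exact: continuous_cst.
move=> x _; rewrite mul1r.
have dphi1 := smooth_differentiable (x, h x + z) sphi.
rewrite (@derive_mul _ _ phi phi)// -mulr2n -mulr_natl.
have := young_ineq (phi (x, h x + z)) ('D_(ev None) phi (x, h x + z)) (l := l^-1).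
rewrite invr_gt0 invrK => /(_ l0) yo.
apply: le_trans (le_trans yo _).
  by rewrite -mulrN ler_pM2l// -normrN ler_norm.
by rewrite lerD2l ler_pM2l// derive_sq_le_grad_sq.
Qed.

Lemma conormal_bounded : exists2 M : R, 0 < M &
  forall j x, torus_cell B x -> `|conormal h j x| <= M.
Proof.
have cn j : continuous (conormal h j) by apply: continuous_conormal; exact: sh.
have [|M M0 HM] := @torus_cell_bounded R d B (fun x => \sum_j `|conormal h j x|).
  by apply: continuous_sum => j; exact: continuous_norm.
exists M => // j x /HM; apply: le_trans; apply: le_trans (ler_norm _).
by rewrite (bigD1 j)//= lerDl sumr_ge0.
Qed.

Lemma flux_grad_bound : exists2 M : R, 0 < M & forall phi1 phi2 z l,
  smooth phi1 -> smooth phi2 -> 0 < l ->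
  `|flux_grad phi1 phi2 z| <= M * (l * mass phi1 z + l^-1 * dirichlet phi2 z).
Proof.
have [M M0 HM] := conormal_bounded.
(* One factor [M] for each of the [d + 1] directions in the sum. *)
exists (M * #|{: option 'I_d}|%:R); first by rewrite mulr_gt0// ltr0n card_option.
move=> phi1 phi2 z l s1 s2 l0.
have c1 : continuous (fun x => phi1 (x, h x + z) ^+ 2).
  apply: (@continuous_layer (fun p => phi1 p ^+ 2)); apply: smooth_continuous.
  exact: smooth_mul.
have cg : continuous (fun x => grad_sq phi2 (x, h x + z)).
  by apply: continuous_layer; apply: smooth_continuous; exact: smooth_grad_sq.
have cF : continuous (fun x => \sum_j conormal h j x *
    (phi1 (x, h x + z) * 'D_(ev j) phi2 (x, h x + z))).
  apply: continuous_sum => j; apply: continuous_mul.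
    by apply: continuous_conormal; exact: sh.
  apply: (@continuous_layer (fun p => phi1 p * 'D_(ev j) phi2 p)).
  by apply: smooth_continuous; apply: smooth_mul => //; exact: smooth_derive.
have cE : continuous (fun x => l * phi1 (x, h x + z) ^+ 2 + l^-1 * grad_sq phi2 (x, h x + z)).
  by apply: continuous_add; apply: continuous_mul => //; exact: continuous_cst.
have E : M * #|{: option 'I_d}|%:R * (l * mass phi1 z + l^-1 * dirichlet phi2 z) =
  L (fun x => M * #|{: option 'I_d}|%:R *
    (l * phi1 (x, h x + z) ^+ 2 + l^-1 * grad_sq phi2 (x, h x + z))).
  rewrite torus_integralZ// torus_integralD;
    [|by apply: continuous_mul => //; exact: continuous_cst..].
  by rewrite !torus_integralZ.
have cE2 : continuous (fun x => M * #|{: option 'I_d}|%:R *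
    (l * phi1 (x, h x + z) ^+ 2 + l^-1 * grad_sq phi2 (x, h x + z))).
  by apply: continuous_mul => //; exact: continuous_cst.
have pt x : torus_cell B x -> `|\sum_j conormal h j x *
    (phi1 (x, h x + z) * 'D_(ev j) phi2 (x, h x + z))| <=
    M * #|{: option 'I_d}|%:R *
    (l * phi1 (x, h x + z) ^+ 2 + l^-1 * grad_sq phi2 (x, h x + z)).
  move=> cx; apply: (le_trans (ler_norm_sum _ _ _)).
  rewrite -mulrA mulr_natl mulrnAr -[leRHS]sumr_const; apply: ler_sum => j _.
  rewrite normrM ler_pM ?HM//.
  have yo := young_ineq (phi1 (x, h x + z)) ('D_(ev j) phi2 (x, h x + z)) l0.
  have le2 (r : R) : 0 <= r -> r <= 2 * r by move=> r0; rewrite ler_peMl// ler1n.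
  apply: (le_trans (le2 _ (normr_ge0 _))); apply: (le_trans yo).
  by rewrite lerD2l ler_pM2l ?invr_gt0// derive_sq_le_grad_sq.
rewrite ler_norml E -torus_integralN//; apply/andP; split; apply: le_torus_integral => //.
- exact: continuous_opp.
- by move=> x /pt; rewrite ler_norml => /andP[].
- by move=> x /pt; rewrite ler_norml => /andP[].
Qed.

(** Balances the bound of [flux_grad_bound] at [w = 1 - z]: the weight [dl / (2 * M * C * w)] makes
    the mass term at most [dl / 2], and the threshold on [E * w] is what then makes the energy term
    at most [dl / 2]. *)
Let decay_arith (M C dl w E m : R) : 0 < M -> 0 < C -> 0 < dl -> 0 < w ->
  m <= C * w -> E * w < dl ^+ 2 / (4 * M ^+ 2 * C) ->
  M * (dl / (2 * M * C * w) * m + (dl / (2 * M * C * w))^-1 * E) <= dl.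
Proof.
move=> M0 C0 dl0 w0 mC Ew.
have k0 : 0 < M * (dl / (2 * M * C * w)) by rewrite !(mulr_gt0, invr_gt0).
have h1 : M * (dl / (2 * M * C * w)) * m <= dl / 2.
  have := mC; rewrite -(ler_pM2l k0) => /le_trans; apply.
  by rewrite le_eqVlt; apply/orP; left; apply/eqP; field; rewrite !gt_eqF.
have k1 : 0 < 2 * M ^+ 2 * C / dl by rewrite !(mulr_gt0, invr_gt0, exprn_gt0).
have h2 : M * ((dl / (2 * M * C * w))^-1 * E) <= dl / 2.
  have := ltW Ew; rewrite -(ler_pM2l k1) => H.
  rewrite (_ : M * _ = 2 * M ^+ 2 * C / dl * (E * w)); last by field; rewrite !gt_eqF.
  apply: (le_trans H).
  by rewrite le_eqVlt; apply/orP; left; apply/eqP; field; rewrite !gt_eqF.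
by rewrite mulrDr mulrA (splitr dl) lerD// -splitr.
Qed.

(** Symmetry needs both fluxes small at one common depth, so [derivative_small] is applied to the
    sum of the two layer energies rather than to each. *)
Lemma flux_grad_decay phi1 phi2 (dl z0 : R) :
  decaying_harmonic phi1 -> decaying_harmonic phi2 -> 0 < dl -> z0 <= 0 ->
  exists z, [/\ z <= z0, `|flux_grad phi1 phi2 z| <= dl &
    `|flux_grad phi2 phi1 z| <= dl].
Proof.
move=> d1 d2 dl0 z00.
have [b1 H1] := flux_grad_bounded_below d1; have [b2 H2] := flux_grad_bounded_below d2.
have [C1 HC1] := mass_linear_growth d1; have [C2 HC2] := mass_linear_growth d2.
have [M M0 HM] := flux_grad_bound.
pose C := `|C1| + `|C2| + 1.
have C0 : 0 < C by rewrite ltr_wpDl// addr_ge0.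
have [s1 _ _ _] := d1; have [s2 _ _ _] := d2.
have [z zz0 Ez] := @derivative_small R (fun z => flux_grad phi1 phi1 z + flux_grad phi2 phi2 z)
  (fun z => dirichlet phi1 z + dirichlet phi2 z) (b1 + b2)
  (dl ^+ 2 / (4 * M ^+ 2 * C)) z0
  (fun z z0 => is_deriveD (is_derive_flux_grad_self d1 z0) (is_derive_flux_grad_self d2 z0))
  (fun z z0 => lerD (H1 z z0) (H2 z z0))
  (divr_gt0 (exprn_gt0 2 dl0) (mulr_gt0 (mulr_gt0 (ltr0n R 4) (exprn_gt0 2 M0)) C0)) z00.
have z_le0 : z <= 0 := le_trans zz0 z00.
have w0 : 0 < 1 - z by rewrite subr_gt0 (le_lt_trans z_le0).
have E1 := dirichlet_ge0 z s1; have E2 := dirichlet_ge0 z s2.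
have l0 : 0 < dl / (2 * M * C * (1 - z)) by rewrite !(mulr_gt0, invr_gt0).
exists z; split=> //.
- apply: le_trans (HM phi1 phi2 z _ s1 s2 l0) _; apply: decay_arith => //.
    apply: (le_trans (HC1 z z_le0)); rewrite ler_pM2r// /C -addrA.
    by rewrite (le_trans (ler_norm _))// lerDl addr_ge0.
  by apply: le_lt_trans Ez; rewrite ler_pM2r// lerDr.
- apply: le_trans (HM phi2 phi1 z _ s2 s1 l0) _; apply: decay_arith => //.
    apply: (le_trans (HC2 z z_le0)); rewrite ler_pM2r// /C addrAC.
    by rewrite (le_trans (ler_norm _))// lerDr addr_ge0.
  by apply: le_lt_trans Ez; rewrite ler_pM2r// lerDl.
Qed.

(** Positivity of [G(h)]: the flux increases with [z] and is arbitrarily close to zero at some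
    depth. *)
Lemma flux_grad_self_ge0 phi : decaying_harmonic phi -> 0 <= flux_grad phi phi 0.
Proof.
move=> dphi; have [sphi _ _ _] := dphi.
apply/ler_addgt0Pr => e e0.
have [z [z0 fz _]] := flux_grad_decay dphi dphi e0 (lexx 0).
have : flux_grad phi phi z <= flux_grad phi phi 0.
  apply: (derive_ge0_le (b := 0) (f' := dirichlet phi)) => // r r0.
    exact: is_derive_flux_grad_self.
  exact: dirichlet_ge0.
move: fz; rewrite ler_norml => /andP[fz _] h1.
by rewrite -lerBlDr sub0r; exact: le_trans fz h1.
Qed.

(** Self-adjointness of [G(h)]: both fluxes have [z]-derivative [int grad phi1 . grad phi2], so
    their difference is constant, and it is arbitrarily small at some depth. *)
Lemma flux_grad_sym phi1 phi2 : decaying_harmonic phi1 -> decaying_harmonic phi2 ->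
  flux_grad phi1 phi2 0 = flux_grad phi2 phi1 0.
Proof.
move=> d1 d2; have [s1 p1 _ h1] := d1; have [s2 p2 _ h2] := d2.
pose J z := flux_grad phi1 phi2 z - flux_grad phi2 phi1 z.
have dJ (z : R) : z <= 0 -> is_derive z 1 J 0.
  move=> z0; have D1 := is_derive_flux_grad s1 p1 s2 p2 (fun x => h2 x z z0).
  have D2 := is_derive_flux_grad s2 p2 s1 p1 (fun x => h1 x z z0).
  apply: (is_derive_eq (is_deriveB D1 D2)); apply/eqP; rewrite subr_eq0; apply/eqP.
  by congr (L _); apply/funext => x; apply: eq_bigr => j _; rewrite mulrC.
apply/eqP; rewrite -subr_eq0 -normr_le0; apply/ler_addgt0Pr => e e0; rewrite add0r.
have e20 : 0 < e / 2 by rewrite divr_gt0.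
have [z [z0 f1 f2]] := flux_grad_decay d1 d2 e20 (lexx 0).
rewrite -/(J 0) -(derive_eq0_cst dJ z0) /J (splitr e).
by rewrite (le_trans (ler_normB _ _))// lerD.
Qed.

End HarmonicExtensions.

(** * A C^1 truncation of the negative part *)

Lemma is_derive_quadratic (R : realType) (f : R -> R) (p a : R) :
  (forall e, `|f (p + e) - f p - a * e| <= e ^+ 2) -> is_derive p 1 f a.
Proof.
move=> H.
have C : (fun e : R => e^-1 *: ((f \o shift p) (e *: (1 : R)) - f p)) @ 0^' --> a.
  apply/cvgrPdist_le => dl dl0; near=> e.
  have e0 : e != 0 by near: e; exact: nbhs_dnbhs_neq.
  have ed : `|e| < dl by near: e; apply: dnbhs0_lt; exact: dl0.
  rewrite /= [e *: 1]mulr1 /GRing.scale/= (addrC e p).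
  rewrite -(ler_pM2l (x := `|e|)) ?normr_gt0// -normrM mulrBr mulVKf//.
  rewrite distrC mulrC; apply: le_trans (H e) _.
  by rewrite -(real_normK (num_real e)) expr2 ler_wpM2l// ltW.
by split; [apply/cvg_ex; eexists; exact: C | exact: cvg_lim C].
Unshelve. all: end_near. Qed.

Section Cutoff.
Context {R : realType}.

(* A bounded nondecreasing C^1 function vanishing exactly on [p >= 0]. *)
Definition cutoff (p : R) : R := (1 + (Num.min p 0) ^+ 2)^-1 - 1.
Definition cutoff' (p : R) : R :=
  - ((1 + (Num.min p 0) ^+ 2)^-1) ^+ 2 * (2 * Num.min p 0).

Let den_gt0 (p : R) : 0 < 1 + (Num.min p 0) ^+ 2.
Proof. by rewrite ltr_pwDl// sqr_ge0. Qed.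

Let is_derive_min_sq (p : R) :
  is_derive p 1 (fun p : R => (Num.min p 0) ^+ 2) (2 * Num.min p 0).
Proof.
(* The remainder is at most [e ^+ 2] in all four sign cases, which settles the change of formula at
   [0] without one-sided derivatives. *)
apply: is_derive_quadratic => e.
have [p0|p0] := leP p 0; have [pe0|pe0] := leP (p + e) 0.
- rewrite (_ : _ - _ = e ^+ 2); last by ring.
  by rewrite ger0_norm// sqr_ge0.
- rewrite ler_norml; apply/andP; split; nra.
- rewrite ler_norml; apply/andP; split; nra.
- by rewrite expr0n/= mulr0 mul0r !subr0 normr0 sqr_ge0.
Qed.

Lemma is_derive_cutoff (p : R) : is_derive p 1 cutoff (cutoff' p).
Proof.
have d0 : 1 + (Num.min p 0) ^+ 2 != 0 by rewrite gt_eqF.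
have d1 : is_derive p 1 (fun p : R => 1 + (Num.min p 0) ^+ 2) (0 + 2 * Num.min p 0).
  exact: is_deriveD (is_derive_cst _ _ _) (is_derive_min_sq p).
have := @is_deriveV R (fun p : R => 1 + (Num.min p 0) ^+ 2) p _ 1 d0 d1 => d2.
apply: (is_derive_eq (is_deriveB d2 (is_derive_cst (1 : R) p 1))).
by rewrite add0r subr0 /cutoff' exprVn.
Qed.

Lemma cutoff'_ge0 p : 0 <= cutoff' p.
Proof.
rewrite /cutoff' mulNr -mulrN mulr_ge0 ?sqr_ge0// oppr_ge0 pmulr_rle0//.
by rewrite ge_min lexx orbT.
Qed.

Lemma cutoff_ge p : 0 <= p -> cutoff p = 0.
Proof. by move=> p0; rewrite /cutoff min_r// expr0n addr0 invr1 subrr. Qed.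

Lemma cutoff'0 : cutoff' 0 = 0.
Proof. by rewrite /cutoff' minxx !mulr0. Qed.

Lemma cutoff_norm_le1 p : `|cutoff p| <= 1.
Proof.
have d0 := den_gt0 p; rewrite /cutoff ler_norml; apply/andP; split.
  by rewrite lerBrDl subrr invr_ge0 ltW.
rewrite lerBlDr (le_trans (y := 1))//; last by rewrite lerDl.
by rewrite invf_le1// lerDl sqr_ge0.
Qed.

Lemma cutoff_eq0 p : cutoff p = 0 -> 0 <= p.
Proof.
move/eqP; rewrite /cutoff subr_eq0 -[X in _ == X]invr1 => /eqP/invr_inj/eqP.
rewrite -subr_eq0 addrAC subrr add0r sqrf_eq0 => /eqP m0.
by rewrite leNgt; apply/negP => p0; rewrite min_l ?ltW// in m0; rewrite m0 ltxx in p0.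
Qed.

Let continuous_min : continuous (fun p : R => Num.min p 0).
Proof.
move=> p; apply: (@continuous_min _ _ (fun p : R => p) (fun=> 0)).
  exact: cvg_id.
exact: cvg_cst.
Qed.

Lemma continuous_cutoff : continuous cutoff.
Proof. exact: is_derive_continuous is_derive_cutoff. Qed.

Lemma continuous_cutoff' : continuous cutoff'.
Proof.
have cm := continuous_min.
have ci : continuous (fun p : R => (1 + (Num.min p 0) ^+ 2)^-1).
  move=> p; apply: cvgV; first by rewrite gt_eqF.
  apply: cvgD; first exact: cvg_cst.
  by apply: cvgM; exact: cm.
apply: continuous_mul; last by apply: continuous_mul => //; exact: continuous_cst.
by apply: continuous_opp; exact: continuous_mul.
Qed.

End Cutoff.

Lemma is_derive_left_le0 (R : realType) (g g' : R -> R) :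
  (forall z : R, is_derive z 1 g (g' z)) -> continuous g' ->
  (forall z, z <= 0 -> 0 <= g z) -> g 0 = 0 -> g' 0 <= 0.
Proof.
move=> dg cg' g0 g00; rewrite leNgt; apply/negP => gp.
have /cvgrPdist_lt /(_ _ gp) /nbhs_ballP[e /= e0 H] := cg' 0.
have [c ce E] := MVT_abs 0 (- (e / 2)) dg.
have e20 : 0 < e / 2 by rewrite divr_gt0.
have bc : ball 0 e c.
  rewrite /ball/= distrC (le_lt_trans ce)// normrN gtr0_norm//.
  by rewrite ltr_pdivrMr// ltr_pMr// ltr1n.
have gc : 0 < g' c.
  by have := H c bc; rewrite ltr_norml => /andP[_]; rewrite ltrBlDl ltrDr.
have := g0 (- (e / 2)); rewrite oppr_le0 ltW// => /(_ isT).
move: E; rewrite add0r g00 subr0 => ->.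
by rewrite mulNr oppr_ge0 pmulr_rle0// leNgt gc.
Qed.

(** * Sign of the pressure *)

Section PressureSign.
Context {R : realType} {d : nat} (B : 'M[R]_d) (h : 'rV[R]_d -> R).
Hypotheses (uB : B \in unitmx) (sh : smooth h) (ph : lattice_periodic B h).
Variable phi : 'rV[R]_d * R -> R.
Hypotheses (dphi : decaying_harmonic B h phi) (phi_h : forall x, phi (x, h x) = h x).
Local Notation L := (torus_integral B).

Lemma Ck_snd k : Ck k (fun p : 'rV[R]_d * R => p.2).
Proof.
have dsnd p : differentiable (fun p : 'rV[R]_d * R => p.2) p.
  apply: linear_differentiable; exact: continuous_snd.
case: k => [|k]; first exact: continuous_snd.
split=> // v; rewrite (_ : 'D_v _ = fun=> v.2); first exact: Ck_cst.
apply/funext => p; rewrite deriveE// diff_lin//; exact: continuous_snd.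
Qed.

Lemma derive_snd v p : 'D_v (fun p : 'rV[R]_d * R => p.2) p = v.2.
Proof. by rewrite deriveE ?diff_lin//; [exact: continuous_snd|have [] := Ck_snd 1]. Qed.

(** Subtracting the height makes the energy infinite; every decay estimate for [P] is therefore
    expressed through [phi]. *)
Definition pressure (p : 'rV[R]_d * R) : R := phi p - p.2.

Let sphi : smooth phi. Proof. by have [] := dphi. Qed.

Lemma smooth_pressure : smooth pressure.
Proof. by apply: smooth_add => //; apply: smooth_opp => k; exact: Ck_snd. Qed.

Lemma derive_pressure v : 'D_v pressure = fun p => 'D_v phi p - v.2.
Proof.
apply/funext => p; rewrite derive_sub ?derive_snd//; first exact: smooth_differentiable.
by have [] := Ck_snd 1.
Qed.

Lemma derive_pressure_at v p : 'D_v pressure p = 'D_v phi p - v.2.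
Proof. by rewrite -[LHS]/(('D_v pressure) p) derive_pressure. Qed.

Lemma derive2_pressure v w p : 'D_w ('D_v pressure) p = 'D_w ('D_v phi) p.
Proof.
rewrite derive_pressure.
rewrite (derive_sub _ (smooth_differentiable p (smooth_derive v sphi))
  (differentiable_cst v.2 p)).
by rewrite derive_cst subr0.
Qed.

Lemma pressure_graph x : pressure (x, h x) = 0.
Proof. by rewrite /pressure phi_h subrr. Qed.

Lemma xperiodic_pressure : xperiodic B pressure.
Proof. by move=> y i x; rewrite /pressure/=; have [_ -> _ _] := dphi. Qed.

Local Notation P := pressure.
Let sP : smooth P := smooth_pressure.
Let cP : continuous P := smooth_continuous sP.

(** The field of the weak maximum principle: its divergence below the surface is
    [cutoff' (P) * |grad P|^2], which is nonnegative, and it vanishes wherever [P >= 0], in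
    particular on the surface. *)
Let F (j : option 'I_d) p := cutoff (P p) * 'D_(ev j) P p.

Let dcut v p : differentiable (fun p => cutoff (P p)) p /\
  'D_v (fun p => cutoff (P p)) p = cutoff' (P p) * 'D_v P p.
Proof.
by apply: derive_comp1; [exact: smooth_differentiable|exact: is_derive_cutoff].
Qed.

Let ccut' : continuous (fun p => cutoff' (P p)).
Proof. exact: continuous_of_comp cP continuous_cutoff'. Qed.

Let CF j : Ck 1 (F j).
Proof.
have C1 : Ck 1 (fun p => cutoff (P p)).
  split=> [p|v]; first by have [] := dcut 0 p.
  rewrite (_ : 'D_v _ = fun p => cutoff' (P p) * 'D_v P p).
    by apply: continuous_mul => //; apply: smooth_continuous; exact: smooth_derive.
  by apply/funext => p; have [] := dcut v p.
by apply: Ck_mul => //; exact: smooth_derive.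
Qed.

Let harmP x z : z <= 0 -> \sum_j 'D_(ev j) ('D_(ev j) P) (x, h x + z) = 0.
Proof.
move=> z0; have [_ _ _ H] := dphi; rewrite -[RHS](H x z z0).
by apply: eq_bigr => j _; rewrite derive2_pressure.
Qed.

Let J := flux B h F.
Let J' (z : R) := L (fun x => cutoff' (P (x, h x + z)) * grad_sq P (x, h x + z)).

Let dJ (z : R) : z <= 0 -> is_derive z 1 J (J' z).
Proof.
move=> z0; apply: (is_derive_eq (is_derive_flux z uB (sh 1%N) ph CF _)).
  move=> j y i x; rewrite /F (xperiodic_pressure _ i x).
  by rewrite (xperiodic_derive _ xperiodic_pressure).
congr (L _); apply/funext => x.
transitivity (cutoff (P (x, h x + z)) * \sum_j 'D_(ev j) ('D_(ev j) P) (x, h x + z) +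
   cutoff' (P (x, h x + z)) * grad_sq P (x, h x + z)); last first.
  by rewrite harmP// mulr0 add0r.
rewrite /grad_sq !mulr_sumr -big_split/=; apply: eq_bigr => j _.
have [dc Dc] := dcut (ev j) (x, h x + z).
rewrite derive_mul//; last by apply: smooth_differentiable; exact: smooth_derive.
by rewrite Dc expr2; congr (_ + _); rewrite mulrCA mulrA.
Qed.

Let cJ' z : continuous (fun x => cutoff' (P (x, h x + z)) * grad_sq P (x, h x + z)).
Proof.
apply: continuous_mul; first exact: (continuous_layer sh ccut').
by apply: (continuous_layer sh); apply: smooth_continuous; exact: smooth_grad_sq.
Qed.

Let J'_ge0 z : 0 <= J' z.
Proof.
apply: torus_integral_ge0 => // x _; apply: mulr_ge0; first exact: cutoff'_ge0.
exact: grad_sq_ge0.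
Qed.

Let J0 : J 0 = 0.
Proof.
rewrite /J /flux (_ : (fun x => _) = fun=> 0); first by rewrite torus_integral_cst mulr0.
apply/funext => x; rewrite big1// => j _.
by rewrite /F addr0 pressure_graph cutoff_ge// mul0r mulr0.
Qed.

(* Where [P < 0] one has [phi < y], so that far below the surface the
   set [P < 0] carries little of the mass of [phi]. *)
Let cutoff_far x z (w : R) : 0 < w -> h x + z <= - w ->
  `|cutoff (P (x, h x + z))| <= w ^- 2 * phi (x, h x + z) ^+ 2.
Proof.
move=> w0 hz; have [P0|P0] := leP 0 (P (x, h x + z)).
  by rewrite cutoff_ge// normr0 mulr_ge0 ?sqr_ge0// invr_ge0 sqr_ge0.
apply: (le_trans (cutoff_norm_le1 _)).
rewrite mulrC ler_pdivlMr ?exprn_gt0// mul1r.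
move: P0; rewrite /pressure subr_lt0/= => P0.
rewrite -[leRHS]sqrrN; apply: lerXn2r; rewrite ?nnegrE ?ltW//.
  by rewrite (lt_trans w0)// ltrNr (lt_le_trans P0).
by rewrite ltrNr (lt_le_trans P0).
Qed.

Let flux_arith (th c D gq s e2 y nD : R) : 0 <= c -> c <= 1 -> c <= s -> 0 <= D ->
  2 * D <= th + y -> y <= gq -> nD <= D + e2 -> e2 <= 1 -> 0 <= nD ->
  c * nD <= th + gq + s.
Proof.
move=> c0 c1 cs D0 yo yg nb e1 n0.
have h1 : c * nD <= c * D + c * e2 by rewrite -mulrDr ler_wpM2l.
have h2 : c * D <= D by rewrite ler_piMl.
have h3 : c * e2 <= c by rewrite ler_piMr.
by lra.
Qed.

(** The two parts of [grad P = grad phi - grad y] use different bounds on the truncation: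
    [|cutoff| <= 1] and Young's inequality for [grad phi], and the mass bound [cutoff_far] for the
    constant part. *)
Let flux_pt (M th : R) x z (w : R) : 0 < M -> 0 < th -> 0 < w -> h x + z <= - w ->
  (forall j, `|conormal h j x| <= M) ->
  `|\sum_j conormal h j x * F j (x, h x + z)| <=
  M * #|{: option 'I_d}|%:R * (th + th^-1 * grad_sq phi (x, h x + z) +
    w ^- 2 * phi (x, h x + z) ^+ 2).
Proof.
move=> M0 th0 w0 hz HM; apply: (le_trans (ler_norm_sum _ _ _)).
rewrite -mulrA mulr_natl mulrnAr -[leRHS]sumr_const; apply: ler_sum => j _.
rewrite normrM ler_pM ?HM// /F derive_pressure_at.
have cf := cutoff_far w0 hz; have c1 := cutoff_norm_le1 (P (x, h x + z)).
have yo := young_ineq 1 ('D_(ev j) phi (x, h x + z)) th0.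
have gs := derive_sq_le_grad_sq phi (x, h x + z) j.
rewrite -(ler_pM2l (x := th^-1)) ?invr_gt0// in gs.
have n1 : `|(ev j).2 : R| <= 1 by case: (j) => [i|]/=; rewrite ?normr0// normr1.
have nb := ler_normB ('D_(ev j) phi (x, h x + z)) (ev j).2.
rewrite mul1r expr1n mulr1 in yo.
rewrite normrM.
exact: flux_arith (normr_ge0 _) c1 cf (normr_ge0 _) yo gs nb n1 (normr_ge0 _).
Qed.

(** Each of the three terms gets [dl / 3]: [th] is fixed by the volume term, [c] by the energy term,
    and [12 * K * C / dl <= 1 - z] by the mass term, which is at most [4 * K * C / (1 - z)]. *)
Let decay_arith (K V C dl th c z w m E : R) : 0 < K -> 0 < V -> 0 < C -> 0 < dl ->
  th = dl / (3 * K * V) -> c = th * dl / (3 * K) ->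
  0 <= E -> z <= 0 -> E * (1 - z) < c -> m <= C * (1 - z) ->
  w = (1 - z) / 2 -> 12 * K * C / dl <= 1 - z ->
  K * (V * th + th^-1 * E + w ^- 2 * m) <= dl.
Proof.
move=> K0 V0 C0 dl0 thE cE E0 z0 Ez mC wE z12.
have q0 : 0 < 1 - z by rewrite subr_gt0 (le_lt_trans z0).
have th0 : 0 < th by rewrite thE !(mulr_gt0, invr_gt0).
have h1 : K * (V * th) = dl / 3 by rewrite thE; field; rewrite !gt_eqF.
have h2 : K * (th^-1 * E) <= dl / 3.
  have k0 : 0 < K * th^-1 by rewrite mulr_gt0 ?invr_gt0.
  have EE : E <= c.
    apply: le_trans (ltW Ez); rewrite ler_peMr// lerDl oppr_ge0 //.
  rewrite mulrA; apply: (@le_trans _ _ (K * th^-1 * c)); first by rewrite ler_pM2l.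
  by rewrite cE le_eqVlt; apply/orP; left; apply/eqP; field; rewrite !gt_eqF.
have h3 : K * (w ^- 2 * m) <= dl / 3.
  have w0 : 0 < w by rewrite wE divr_gt0.
  have k0 : 0 < K * w ^- 2 by rewrite mulr_gt0 ?invr_gt0 ?exprn_gt0.
  rewrite mulrA; apply: (@le_trans _ _ (K * w ^- 2 * (C * (1 - z)))).
    by rewrite ler_pM2l.
  rewrite (_ : _ * _ = 4 * K * C / (1 - z)); last by rewrite wE; field; rewrite !gt_eqF.
  rewrite ler_pdivrMr//; move: z12; rewrite ler_pdivrMr//; lra.
rewrite !mulrDr h1; lra.
Qed.

Let J_decay (dl z0 : R) : 0 < dl -> z0 <= 0 -> exists2 z, z <= z0 & `|J z| <= dl.
Proof.
move=> dl0 z00.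
have [M M0 HM] := conormal_bounded B sh.
have [H H0 HH] := torus_cell_bounded B (smooth_continuous sh).
have [b Hb] := flux_grad_bounded_below uB sh ph dphi.
have [C' HC'] := mass_linear_growth uB sh ph dphi.
pose C := `|C'| + 1; have C0 : 0 < C by rewrite ltr_wpDl.
pose K := M * #|{: option 'I_d}|%:R.
have K0 : 0 < K by rewrite mulr_gt0// ltr0n card_option.
pose V : R := `|\det B|.
have V0 : 0 < V by rewrite normr_gt0 -unitfE -unitmxE.
pose th := dl / (3 * K * V); pose c := th * dl / (3 * K).
have th0 : 0 < th := divr_gt0 dl0 (mulr_gt0 (mulr_gt0 (ltr0n R 3) K0) V0).
have c0 : 0 < c := divr_gt0 (mulr_gt0 th0 dl0) (mulr_gt0 (ltr0n R 3) K0).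
(* The bound [- (2 * H + 1)] is exactly what gives [H + z <= - (1 - z) / 2 = - w]; the last one
   makes the mass term small. *)
pose z1 := Num.min z0 (Num.min (- (2 * H + 1)) (1 - 12 * K * C / dl)).
have z1z0 : z1 <= z0 by rewrite ge_min lexx.
have z10 : z1 <= 0 := le_trans z1z0 z00.
have [z zz1 Ez] := derivative_small
  (fun z z0 => is_derive_flux_grad_self uB sh ph dphi z0) Hb c0 z10.
have zz0 : z <= 0 := le_trans zz1 z10.
exists z; first exact: le_trans z1z0.
move: (zz1); rewrite /z1 !le_min => /and3P[_ zH zK].
pose w := (1 - z) / 2.
have q0 : 0 < 1 - z by rewrite subr_gt0 (le_lt_trans zz0).
have w0 : 0 < w by rewrite divr_gt0.
have hw x : torus_cell B x -> h x + z <= - w.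
  move=> /HH /(le_trans (ler_norm _)) hx.
  by move: hx zH; rewrite /w; move: (h x) => hx; lra.
have pt x : torus_cell B x -> `|\sum_j conormal h j x * F j (x, h x + z)| <=
  K * (th + th^-1 * grad_sq phi (x, h x + z) + w ^- 2 * phi (x, h x + z) ^+ 2).
  by move=> cx; apply: flux_pt => //; [exact: hw|move=> j; exact: HM].
have cF : continuous (fun x => \sum_j conormal h j x * F j (x, h x + z)).
  apply: continuous_sum => j; apply: continuous_mul; last first.
    by apply: (continuous_layer sh); exact: Ck_continuous (CF j).
  by apply: continuous_conormal; exact: sh.
have cm : continuous (fun x => phi (x, h x + z) ^+ 2).
  apply: (@continuous_layer R d h sh (fun p => phi p ^+ 2)); apply: smooth_continuous.
  exact: smooth_mul.
have cg : continuous (fun x => grad_sq phi (x, h x + z)).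
  by apply: (continuous_layer sh); apply: smooth_continuous; exact: smooth_grad_sq.
have cc (k : R) : continuous (fun _ : 'rV[R]_d => k) by exact: continuous_cst.
have ck (k : R) f : continuous f -> continuous (fun x : 'rV[R]_d => k * f x).
  by move=> cf; exact: continuous_mul.
have cA : continuous (fun x => th + th^-1 * grad_sq phi (x, h x + z)).
  by apply: continuous_add => //; exact: ck.
have cB : continuous (fun x => th + th^-1 * grad_sq phi (x, h x + z) +
    w ^- 2 * phi (x, h x + z) ^+ 2).
  by apply: continuous_add => //; exact: ck.
have E : L (fun x => K * (th + th^-1 * grad_sq phi (x, h x + z) +
    w ^- 2 * phi (x, h x + z) ^+ 2)) =
    K * (V * th + th^-1 * dirichlet B h phi z + w ^- 2 * mass B h phi z).
  rewrite torus_integralZ// torus_integralD//; last exact: ck.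
  rewrite torus_integralD//; last exact: ck.
  by rewrite torus_integral_cst !torus_integralZ.
have le1 : K * (V * th + th^-1 * dirichlet B h phi z + w ^- 2 * mass B h phi z) <= dl.
  apply: (@decay_arith K V C dl th c z w) => //.
  - exact: dirichlet_ge0.
  - apply: (le_trans (HC' z zz0)); rewrite ler_pM2r//.
    by rewrite (le_trans (ler_norm _))// lerDl.
  - by rewrite lerBrDl addrC -lerBrDl.
rewrite ler_norml; apply/andP; split.
  apply: (@le_trans _ _ (- L (fun x => K * (th + th^-1 * grad_sq phi (x, h x + z) +
    w ^- 2 * phi (x, h x + z) ^+ 2)))); first by rewrite lerN2 E.
  rewrite -torus_integralN; last exact: ck.
  apply: le_torus_integral => //; first by apply: continuous_opp; exact: ck.
  by move=> x /pt; rewrite ler_norml => /andP[].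
apply: le_trans le1; rewrite -E; apply: le_torus_integral => //; first exact: ck.
by move=> x /pt; rewrite ler_norml => /andP[].
Qed.

(** [J] is nondecreasing, zero at the surface and arbitrarily close to zero far below, which leaves
    it no room. *)
Let J_eq0 z : z <= 0 -> J z = 0.
Proof.
have mono x y : x <= y -> y <= 0 -> J x <= J y.
  by apply: derive_ge0_le => r r0; [exact: dJ|exact: J'_ge0].
move=> z0; apply/eqP; rewrite eq_le -{1}J0 mono//=.
apply/ler_addgt0Pr => e e0; have [y yz Jy] := J_decay e0 z0.
move: Jy; rewrite ler_norml => /andP[Jy _].
by rewrite -lerBlDr sub0r (le_trans Jy)// mono.
Qed.

Let J'_eq0 z : z < 0 -> J' z = 0.
Proof.
move=> z0.
have H : is_derive z 1 J 0.
  have zin : z \in `](z - 1), 0[ by rewrite in_itv/= z0 gtrBl ltr01.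
  (* [J] vanishes identically on []z - 1, 0[], so [z] is an interior maximum. *)
  apply: (@derive1_at_max R J (z - 1) 0 z _ _ zin).
  - by rewrite lerBlDr add0r (le_trans (ltW z0)).
  - by move=> t; rewrite in_itv/= => /andP[_ t0]; have [] := dJ (ltW t0).
  - by move=> t; rewrite in_itv/= => /andP[_ t0]; rewrite !J_eq0// ltW.
by have [_ <-] := dJ (ltW z0); have [_ ->] := H.
Qed.

(** Since [J'] vanishes below the surface, [cutoff' (P) * |grad P|^2] is zero on each layer. Hence
    [cutoff (P)] is constant along vertical lines, equal to its surface value [0]. *)
Lemma pressure_ge0 x z : torus_cell B x -> z <= 0 -> 0 <= pressure (x, h x + z).
Proof.
move=> cx z0; apply: cutoff_eq0.
have D (r : R) : r <= 0 -> is_derive r 1 (fun r => cutoff (P (x, h x + r))) 0.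
  move=> r0.
  have dPr := is_derive_vertical h x r (fun p => smooth_differentiable p sP).
  have := @is_derive1_comp R cutoff (fun r => P (x, h x + r)) r _ _ (is_derive_cutoff _) dPr.
  move=> H; apply: (is_derive_eq H).
  (* [J'_eq0] covers only [r < 0]; on the surface the factor [cutoff' 0] is zero. *)
  move: r0; rewrite le_eqVlt => /predU1P[->|r0].
    by rewrite addr0 pressure_graph cutoff'0 mul0r.
  have := torus_integral_eq0 uB (@cJ' r)
    (fun x _ => mulr_ge0 (cutoff'_ge0 _) (grad_sq_ge0 _ _))
    (J'_eq0 r0) cx.
  move=> /eqP; rewrite mulf_eq0 => /orP[/eqP->|/eqP g0]; first by rewrite mul0r.
  have := derive_sq_le_grad_sq P (x, h x + r) None; rewrite g0 => H1.
  have /eqP : ('D_(ev None) P (x, h x + r)) ^+ 2 = 0.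
    by apply/eqP; rewrite eq_le H1 sqr_ge0.
  by rewrite sqrf_eq0 => /eqP ->; rewrite mulr0.
have := derive_eq0_cst D z0; rewrite addr0 pressure_graph => ->.
exact: cutoff_ge.
Qed.

Lemma pressure_dy_le0 x : torus_cell B x -> 'D_(ev None) pressure (x, h x) <= 0.
Proof.
move=> cx.
have := @is_derive_left_le0 R (fun z => P (x, h x + z)) (fun z => 'D_(ev None) P (x, h x + z)).
rewrite !addr0; apply.
- by move=> z; apply: is_derive_vertical => p; exact: smooth_differentiable.
- have cD := smooth_continuous (smooth_derive (ev None) sP).
  apply: (continuous_of_comp _ cD (f := fun z : R => (x, h x + z))).
  apply: continuous_pairing; first exact: continuous_cst.
  by apply: continuous_add; [exact: continuous_cst|exact: continuous_idfun].
- by move=> z z0; exact: pressure_ge0.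
- exact: pressure_graph.
Qed.

End PressureSign.

(** [S] is allowed to exceed the sum of squares: it will be [eta ^+ 2 + |grad P|^2], positive even
    at critical points of [P]. *)
Lemma cauchy_schwarz_sum (R : realType) (I : finType) (a b : I -> R) (S : R) :
  0 < S -> \sum_k (a k) ^+ 2 <= S ->
  (\sum_k a k * b k) ^+ 2 <= S * \sum_k (b k) ^+ 2.
Proof.
move=> S0 aS; set C := \sum_k a k * b k; set A := \sum_k (a k) ^+ 2 in aS *.
set D := \sum_k (b k) ^+ 2.
have : 0 <= \sum_k (S * b k - C * a k) ^+ 2 by apply: sumr_ge0 => k _; exact: sqr_ge0.
have E c : \sum_k (S * b k - c * a k) ^+ 2 = S ^+ 2 * D - 2 * S * c * C + c ^+ 2 * A.
  rewrite /A /D /C !mulr_sumr -sumrB -big_split/=.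
  by apply: eq_bigr => k _; ring.
rewrite E => H; have : C ^+ 2 * A <= C ^+ 2 * S by rewrite ler_wpM2l ?sqr_ge0.
move=> H2.
have : 0 <= S * (S * D - C ^+ 2) by lra.
by rewrite pmulr_rge0// subr_ge0.
Qed.

(** * Mean curvature and subharmonicity *)

Section Subharmonic.
Context {R : realType} {d : nat} (B : 'M[R]_d) (h : 'rV[R]_d -> R).
Hypotheses (uB : B \in unitmx) (sh : smooth h) (ph : lattice_periodic B h).
Variable phi : 'rV[R]_d * R -> R.
Hypothesis dphi : decaying_harmonic B h phi.
Variable eta : R.
Hypothesis eta0 : 0 < eta.
Local Notation L := (torus_integral B).
Local Notation P := (pressure phi).

Let ch : continuous h := smooth_continuous sh.
Let sphi : smooth phi. Proof. by have [] := dphi. Qed.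
Let sP : smooth P := smooth_pressure dphi.

(** The Laplacian of [phi] is only known to vanish on the closed region under the graph. Below the
    surface it vanishes on a neighbourhood and can be differentiated in all directions; the surface
    is reached by continuity. *)
Lemma derive_harmonic k x z : z <= 0 ->
  \sum_j 'D_(ev j) ('D_(ev j) ('D_(ev k) P)) (x, h x + z) = 0.
Proof.
pose lap p := \sum_j 'D_(ev j) ('D_(ev j) phi) p.
have slap : smooth lap by apply: smooth_sum => j; do 2!apply: smooth_derive.
have Dlap p : \sum_j 'D_(ev j) ('D_(ev j) ('D_(ev k) P)) p = 'D_(ev k) lap p.
  rewrite derive_bigsum; last first.
    by move=> j; apply: smooth_differentiable; do 2!apply: smooth_derive.
  apply: eq_bigr => j _.
  have E : 'D_(ev j) ('D_(ev k) P) = 'D_(ev k) ('D_(ev j) phi).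
    apply: (etrans _ (smooth_derive_comm (ev j) (ev k) sphi)).
    by apply/funext => q; exact: derive2_pressure dphi _ _ _.
  apply: (etrans (congr1 (fun F => 'D_(ev j) F p) E)).
  by apply: derive_comm; exact: smooth_derive.
have lt0 r : r < 0 -> 'D_(ev k) lap (x, h x + r) = 0.
  move=> r0; rewrite (@near_eq_derive _ _ _ lap (cst 0)) ?derive_cst//.
  have cg : continuous (fun p : 'rV[R]_d * R => h p.1 - p.2).
    apply: continuous_sub; last exact: continuous_snd.
    exact: (continuous_of_comp (@continuous_fst 'rV[R]_d R) ch).
  have pos : 0 < h (x, h x + r).1 - (x, h x + r).2.
    by rewrite /= opprD addrA subrr add0r oppr_gt0.
  have near_pos : \forall p \near (x, h x + r), 0 < h p.1 - p.2.
    by have := cvgr_gt _ (cg (x, h x + r)); apply.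
  apply: (filterS _ near_pos) => -[a b] /=; rewrite subr_gt0 => ba.
  have [_ _ _ /(_ a (b - h a))] := dphi.
  by rewrite subr_le0 addrC subrK; apply; exact: ltW.
move=> z0; rewrite Dlap; move: z0; rewrite le_eqVlt => /predU1P[->|]; last exact: lt0.
apply: (@continuous_eq0_left R (fun z => 'D_(ev k) lap (x, h x + z))) => //.
have cD := smooth_continuous (smooth_derive (ev k) slap).
apply: (continuous_of_comp _ cD (f := fun z : R => (x, h x + z))).
apply: continuous_pairing; first exact: continuous_cst.
by apply: continuous_add; [exact: continuous_cst|exact: continuous_idfun].
Qed.

Definition reg_sq p : R := eta ^+ 2 + grad_sq P p.
Definition reg_norm p : R := Num.sqrt (reg_sq p).
Local Notation f := reg_norm.

Lemma reg_sq_gt0 p : 0 < reg_sq p.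
Proof. by rewrite ltr_wpDr ?grad_sq_ge0// exprn_gt0. Qed.

Let sreg : smooth reg_sq.
Proof. by apply: smooth_add; [exact: smooth_cst|exact: smooth_grad_sq]. Qed.

Lemma smooth_reg_norm : smooth f.
Proof. by apply: smooth_sqrt => //; exact: reg_sq_gt0. Qed.

Lemma reg_norm_gt0 p : 0 < f p.
Proof. by rewrite sqrtr_gt0 reg_sq_gt0. Qed.

Lemma sqr_reg_norm p : f p ^+ 2 = reg_sq p.
Proof. by rewrite sqr_sqrtr// ltW// reg_sq_gt0. Qed.

Lemma derive_grad_sq v p : 'D_v (grad_sq P) p =
  2 * \sum_k 'D_(ev k) P p * 'D_v ('D_(ev k) P) p.
Proof.
have dD k q : differentiable ('D_(ev k) P) q.
  by apply: smooth_differentiable; exact: smooth_derive.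
rewrite /grad_sq derive_bigsum; last by move=> k; exact: differentiable_mul.
rewrite mulr_sumr; apply: eq_bigr => k _.
by rewrite (@derive_mul _ _ ('D_(ev k) P) ('D_(ev k) P))// -mulr2n mulr_natl.
Qed.

Lemma derive_reg_norm v p : 'D_v f p =
  (f p)^-1 * \sum_k 'D_(ev k) P p * 'D_v ('D_(ev k) P) p.
Proof.
have dg : differentiable (grad_sq P) p.
  by apply: smooth_differentiable; exact: smooth_grad_sq.
rewrite derive_sqrt; [|exact: reg_sq_gt0|exact: smooth_differentiable].
rewrite (derive_add v (differentiable_cst (eta ^+ 2) p) dg) derive_cst add0r.
by rewrite derive_grad_sq -/(f p) [2^-1 / _]mulrC -mulrA mulKf// pnatr_eq0.
Qed.

(** Bochner's argument. Differentiating [f * d_j f = Q j] and summing, the third-order terms cancel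
    because each [d_k P] is harmonic; this leaves [f] times the Laplacian of [f] equal to
    [|Hess P|^2 - |grad f|^2], nonnegative by Cauchy-Schwarz. *)
Lemma reg_norm_subharmonic x z : z <= 0 ->
  0 <= \sum_j 'D_(ev j) ('D_(ev j) f) (x, h x + z).
Proof.
move=> z0; set p := (x, h x + z).
have fp := reg_norm_gt0 p.
pose Q j q := \sum_k 'D_(ev k) P q * 'D_(ev j) ('D_(ev k) P) q.
have dk k q : differentiable ('D_(ev k) P) q.
  by apply: smooth_differentiable; exact: smooth_derive.
have djk j k q : differentiable ('D_(ev j) ('D_(ev k) P)) q.
  by apply: smooth_differentiable; do 2!apply: smooth_derive.
have df q : differentiable f q by apply: smooth_differentiable; exact: smooth_reg_norm.
have djf j q : differentiable ('D_(ev j) f) q.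
  by apply: smooth_differentiable; apply: smooth_derive; exact: smooth_reg_norm.
have DQ j : 'D_(ev j) (Q j) p = f p * 'D_(ev j) ('D_(ev j) f) p + ('D_(ev j) f p) ^+ 2.
  have -> : Q j = fun q => f q * 'D_(ev j) f q.
    by apply/funext => q; rewrite derive_reg_norm mulVKf// gt_eqF// reg_norm_gt0.
  exact: (derive_mul _ (df p) (djf j p)).
have DQ2 j : 'D_(ev j) (Q j) p = \sum_k ('D_(ev j) ('D_(ev k) P) p) ^+ 2 +
    \sum_k 'D_(ev k) P p * 'D_(ev j) ('D_(ev j) ('D_(ev k) P)) p.
  rewrite /Q derive_bigsum; last by move=> k; exact: differentiable_mul.
  rewrite -big_split/=; apply: eq_bigr => k _.
  apply: (etrans (derive_mul _ (dk k p) (djk j k p))); exact: addrC.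
have cs j : ('D_(ev j) f p) ^+ 2 <= \sum_k ('D_(ev j) ('D_(ev k) P) p) ^+ 2.
  rewrite derive_reg_norm exprMn exprVn ler_pdivrMl ?exprn_gt0// sqr_reg_norm.
  apply: cauchy_schwarz_sum; first exact: reg_sq_gt0.
  by rewrite lerDr sqr_ge0.
rewrite -(pmulr_rge0 _ fp) mulr_sumr.
have -> : \sum_j f p * 'D_(ev j) ('D_(ev j) f) p =
    \sum_j (\sum_k ('D_(ev j) ('D_(ev k) P) p) ^+ 2 - ('D_(ev j) f p) ^+ 2).
  transitivity (\sum_j ('D_(ev j) (Q j) p - ('D_(ev j) f p) ^+ 2)).
    by apply: eq_bigr => j _; rewrite DQ addrK.
  under eq_bigr do rewrite DQ2.
  rewrite !sumrB big_split/= [X in _ + X - _]exchange_big/= [X in _ + X - _]big1 ?addr0//.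
  by move=> k _; rewrite -mulr_sumr derive_harmonic// mulr0.
by apply: sumr_ge0 => j _; rewrite subr_ge0.
Qed.

Definition reg_flux : R -> R := flux B h (fun j => 'D_(ev j) f).

Lemma xperiodic_reg_norm : xperiodic B f.
Proof.
move=> y i x; rewrite /reg_norm /reg_sq /grad_sq; congr (Num.sqrt (_ + _)).
apply: eq_bigr => j _.
by rewrite (xperiodic_derive _ (xperiodic_pressure dphi)).
Qed.

Let dJ (z : R) : is_derive z 1 reg_flux
  (L (fun x => \sum_j 'D_(ev j) ('D_(ev j) f) (x, h x + z))).
Proof.
have C1 j : Ck 1 ('D_(ev j) f) := smooth_derive (ev j) smooth_reg_norm 1%N.
have p1 j : xperiodic B ('D_(ev j) f) := xperiodic_derive (ev j) xperiodic_reg_norm.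
exact: (@is_derive_flux R d B h (fun j => 'D_(ev j) f) z uB (sh 1%N) ph C1 p1).
Qed.

Let J_mono x y : x <= y -> y <= 0 -> reg_flux x <= reg_flux y.
Proof.
apply: derive_ge0_le => r r0; first exact: dJ.
apply: torus_integral_ge0; last by move=> a _; exact: reg_norm_subharmonic.
apply: continuous_sum => j; apply: (continuous_layer_derive sh).
by apply: smooth_derive; exact: smooth_reg_norm.
Qed.

(** The value of [f] where [grad phi = 0], that is [grad P = (0, -1)]: the value to be expected at
    depth. So [u] is small in mean on layers of small energy. *)
Let c0 : R := Num.sqrt (eta ^+ 2 + 1).
Let u p := f p - c0.

Let c0_ge1 : 1 <= c0.
Proof. by rewrite -(sqrtr1 R) /c0 ler_wsqrtr// lerDr sqr_ge0. Qed.

Lemma grad_sq_pressure p :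
  grad_sq P p = grad_sq phi p - 2 * 'D_(ev None) phi p + 1.
Proof.
rewrite /grad_sq !sum_option (derive_pressure_at dphi)/=.
under eq_bigr do rewrite (derive_pressure_at dphi)/= subr0.
by move: ('D_(ev None) phi p) (\sum_i _) => a b; ring.
Qed.

Let diff_arith (a c g y th : R) : 0 < a -> 1 <= c -> a ^+ 2 - c ^+ 2 = g - 2 * y ->
  0 <= g -> 2 * `|y| <= th + th^-1 * g -> `|a - c| <= th + (1 + th^-1) * g.
Proof.
move=> a0 c1 E g0 yo.
have h1 : `|a - c| <= `|a - c| * (a + c) by rewrite ler_peMr// ler_wpDl// ltW.
have h2 : `|a - c| * (a + c) = `|g - 2 * y|.
  rewrite -E subr_sqr normrM; congr (_ * _); rewrite ger0_norm// addr_ge0 ?(ltW a0)//.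
  exact: le_trans ler01 c1.
have h3 : `|g - 2 * y| <= g + 2 * `|y|.
  by rewrite (le_trans (ler_normB _ _))// normrM (ger0_norm g0) ger0_norm.
by rewrite h2 in h1; have := le_trans h1 h3; lra.
Qed.

(** One has [f^2 - c0^2 = |grad phi|^2 - 2 d_y phi] and [f + c0 >= 1]. The energy controls only
    squares, so the linear term is absorbed by Young's inequality with [th] left free. *)
Let diff_bound p (th : R) : 0 < th ->
  `|u p| <= th + (1 + th^-1) * grad_sq phi p.
Proof.
move=> th0; apply: (@diff_arith _ _ _ ('D_(ev None) phi p)) => //.
- exact: reg_norm_gt0.
- rewrite sqr_reg_norm sqr_sqrtr ?addr_ge0 ?sqr_ge0// /reg_sq grad_sq_pressure.
  by move: (grad_sq phi p) ('D_(ev None) phi p) (eta ^+ 2) => a b e; ring.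
- exact: grad_sq_ge0.
- have := young_ineq 1 ('D_(ev None) phi p) th0; rewrite mul1r expr1n mulr1 => yo.
  apply: (le_trans yo); rewrite lerD2l ler_pM2l ?invr_gt0//.
  exact: derive_sq_le_grad_sq.
Qed.

Let su : smooth u.
Proof.
by apply: smooth_add; [exact: smooth_reg_norm|apply: smooth_opp; exact: smooth_cst].
Qed.

Let Du v p : 'D_v u p = 'D_v f p.
Proof.
have df : differentiable f p by apply: smooth_differentiable; exact: smooth_reg_norm.
apply: (etrans (derive_sub _ df (differentiable_cst c0 p))).
by rewrite derive_cst subr0.
Qed.

Let V : R := `|\det B|.

Let layer_bound (w : 'rV[R]_d -> R) (W th z : R) : continuous w -> 0 < W -> 0 < th ->
  (forall x, torus_cell B x -> `|w x| <= W) ->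
  `|L (fun x => w x * u (x, h x + z))| <=
    W * (V * th + (1 + th^-1) * dirichlet B h phi z).
Proof.
move=> cw W0 th0 HW.
have cu : continuous (fun x => u (x, h x + z)).
  by apply: (continuous_layer sh); exact: smooth_continuous.
have cg : continuous (fun x => grad_sq phi (x, h x + z)).
  by apply: (continuous_layer sh); apply: smooth_continuous; exact: smooth_grad_sq.
have cc (k : R) : continuous (fun _ : 'rV[R]_d => k) by exact: continuous_cst.
have ck (k : R) g : continuous g -> continuous (fun x : 'rV[R]_d => k * g x).
  by move=> cf; exact: continuous_mul.
have cA : continuous (fun x => th + (1 + th^-1) * grad_sq phi (x, h x + z)).
  by apply: continuous_add => //; exact: ck.
have -> : W * (V * th + (1 + th^-1) * dirichlet B h phi z) =
    L (fun x => W * (th + (1 + th^-1) * grad_sq phi (x, h x + z))).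
  rewrite torus_integralZ// torus_integralD//; last exact: ck.
  by rewrite torus_integral_cst torus_integralZ.
have pt x : torus_cell B x -> `|w x * u (x, h x + z)| <=
    W * (th + (1 + th^-1) * grad_sq phi (x, h x + z)).
  by move=> cx; rewrite normrM ler_pM ?HW//; exact: diff_bound.
rewrite ler_norml; apply/andP; split.
  rewrite -torus_integralN; last exact: ck.
  apply: le_torus_integral; [by apply: continuous_opp; exact: ck|exact: continuous_mul|].
  by move=> x /pt; rewrite ler_norml => /andP[].
apply: le_torus_integral; [exact: continuous_mul|exact: ck|].
by move=> x /pt; rewrite ler_norml => /andP[].
Qed.

Let hi (i : 'I_d) : 'rV[R]_d -> R := 'D_(delta_mx 0 i) h.
Let sq x : R := 1 + \sum_i hi i x ^+ 2.
Let lap x : R := \sum_i 'D_(delta_mx 0 i) (hi i) x.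

Let shi i : smooth (hi i) := smooth_derive _ sh.
Let csq : continuous sq.
Proof.
apply: continuous_add; first exact: continuous_cst.
by apply: continuous_sum => i; apply: continuous_mul; exact: smooth_continuous.
Qed.
Let clap : continuous lap.
Proof. by apply: continuous_sum => i; apply: smooth_continuous; exact: smooth_derive. Qed.

(** A layer average involving first derivatives of [phi] only, which the energy can bound. The
    weight is [1 + |grad h|^2] because integration by parts on a layer then turns the [z]-derivative
    into [reg_flux], up to a term of order zero in [u]. *)
Let N (z : R) := L (fun x => sq x * u (x, h x + z)).

Let dN (z : R) : is_derive z 1 N (reg_flux z - L (fun x => lap x * u (x, h x + z))).
Proof.
have cu : continuous (fun x => u (x, h x + z)).
  by apply: (continuous_layer sh); exact: smooth_continuous.
have cD v : continuous (fun x => 'D_v f (x, h x + z)).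
  by apply: (continuous_layer_derive sh); exact: smooth_reg_norm.
have cDu v : continuous (fun x => 'D_v u (x, h x + z)).
  exact: (continuous_layer_derive sh).
apply: (is_derive_eq (is_derive_layer (w := sq) B sh z csq (su 1%N))).
(* The horizontal divergence of [u grad h] along the layer integrates to zero; adding it to the flux
   density trades the tangential terms for [|grad h|^2 d_y f] and [lap * u]. *)
pose g i x := hi i x * u (x, h x + z).
have dgr x v := @derive_graph R d u h x v z (smooth_differentiable _ su)
  (smooth_differentiable _ sh).
have Dg i v x : 'D_v (g i) x = hi i x * ('D_(v, 0) u (x, h x + z) +
    'D_v h x * 'D_(ev None) u (x, h x + z)) + u (x, h x + z) * 'D_v (hi i) x.
  have [d1 E1] := dgr x v.
  apply: (etrans (derive_mul _ (smooth_differentiable x (shi i)) d1)).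
  exact: (congr1 (fun a => hi i x * a + _) E1).
have Cg i : Ck 1 (g i).
  split=> [x|v].
    by apply: differentiable_mul; [exact: smooth_differentiable|have [] := dgr x 0].
  have -> : 'D_v (g i) = fun x => hi i x * ('D_(v, 0) u (x, h x + z) +
      'D_v h x * 'D_(ev None) u (x, h x + z)) + u (x, h x + z) * 'D_v (hi i) x.
    by apply/funext => x; exact: Dg.
  have chi j : continuous (hi j) by exact: smooth_continuous.
  apply: continuous_add; apply: continuous_mul => //.
    apply: continuous_add; first exact: cDu.
    by apply: continuous_mul; [apply: smooth_continuous; exact: smooth_derive|exact: cDu].
  by apply: smooth_continuous; exact: smooth_derive.
have pg i : lattice_periodic B (g i).
  move=> k x; rewrite /g /u ph xperiodic_reg_norm /hi.
  by rewrite (lattice_periodic_derive _ ph).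
have I0 i : L ('D_(delta_mx 0 i) (g i)) = 0 by exact: torus_integral_derive.
have cDg i : continuous ('D_(delta_mx 0 i) (g i)) by have [_] := Cg i; exact.
have cF : continuous (fun x => \sum_j conormal h j x * 'D_(ev j) f (x, h x + z)).
  apply: continuous_sum => j; apply: continuous_mul; last exact: cD.
  by apply: continuous_conormal; exact: sh.
have cl : continuous (fun x => lap x * u (x, h x + z)) by exact: continuous_mul.
rewrite /reg_flux /flux -torus_integralB//.
have S0 : L (fun x => \sum_i 'D_(delta_mx 0 i) (g i) x) = 0.
  by rewrite torus_integral_sum// big1.
apply: (etrans _ (addr0 _)); rewrite -[X in _ + X]S0.
rewrite -torus_integralD; last 2 first.
- exact: continuous_sub.
- exact: continuous_sum.
congr (L _); apply/funext => x.
have E : \sum_i 'D_(delta_mx 0 i) (g i) x =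
    \sum_i hi i x * 'D_(delta_mx 0 i, 0) f (x, h x + z) +
    (\sum_i hi i x ^+ 2) * 'D_(ev None) f (x, h x + z) + lap x * u (x, h x + z).
  rewrite /lap mulr_suml [in X in _ + X]mulr_suml -!big_split/=; apply: eq_bigr => i _.
  rewrite Dg !Du -/(hi i x) mulrDr mulrA -expr2; congr (_ + _).
  by rewrite mulrC.
rewrite E Du sum_option /conormal mul1r /sq.
rewrite (_ : \sum_i - 'D_(delta_mx 0 i) h x * 'D_(ev (Some i)) f (x, h x + z) =
  - \sum_i hi i x * 'D_(delta_mx 0 i, 0) f (x, h x + z)); last first.
  by rewrite -sumrN; apply: eq_bigr => i _; rewrite mulNr.
move: ('D_(ev None) f (x, h x + z)) (\sum_i hi i x * _) (\sum_i _ ^+ 2) (lap x * _).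
by move=> a b c e; ring.
Qed.

Let final_arith1 (a J Ll W Vt t E K : R) : a < 0 -> J <= a -> `|Ll| <= W * (Vt + t * E) ->
  W * Vt <= - a / 2 -> K = W * t -> 0 <= K * E - (J - Ll) + a / 2.
Proof.
move=> a0 Ja; rewrite ler_norml => /andP[Ln Lp] WV ->.
by rewrite mulrDr in Lp Ln; lra.
Qed.

(** If the surface flux [a] were negative, monotonicity would keep the flux below [a] at every
    depth, so that [N] would grow at least like [a / 2 * z] downwards, up to a bounded error. At a
    deep layer of energy at most 1, however, [N] obeys a fixed bound. *)
Lemma reg_flux_ge0 : 0 <= reg_flux 0.
Proof.
rewrite leNgt; apply/negP => Jneg.
have [W1 W10 HW1] := torus_cell_bounded B clap.
have [W2 W20 HW2] := torus_cell_bounded B csq.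
have [b Hb] := flux_grad_bounded_below uB sh ph dphi.
have V0 : 0 < V by rewrite /V normr_gt0 -unitfE -unitmxE.
set a := reg_flux 0 in Jneg.
(* Chosen so that the [th] part of the error, [W1 * V * th], uses up exactly half of [- a]. *)
pose th := - a / 2 / (W1 * V).
have th0 : 0 < th by rewrite /th !divr_gt0 ?mulr_gt0 ?oppr_gt0.
pose K := W1 * (1 + th^-1).
have K0 : 0 < K by rewrite mulr_gt0// ltr_wpDr// invr_ge0 ltW.
(* The rest of the error is [K] times the layer energy, the derivative of [K * flux_grad]; hence [q]
   is nondecreasing. *)
pose q z := K * flux_grad B h phi phi z - N z + a / 2 * z.
have dq (z : R) : z <= 0 -> is_derive z 1 q (K * dirichlet B h phi z -
    (reg_flux z - L (fun x => lap x * u (x, h x + z))) + a / 2 * 1).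
  move=> z0.
  have d1 : is_derive z 1 (fun z : R => K * flux_grad B h phi phi z)
      (K * dirichlet B h phi z).
    by apply: is_deriveZ; exact: is_derive_flux_grad_self.
  have d3 : is_derive z 1 (fun z : R => a / 2 * z) (a / 2 * 1) by apply: is_deriveZ.
  exact: (is_deriveD (is_deriveB d1 (dN z)) d3).
have q_mono z : z <= 0 -> q z <= q 0.
  move=> z0; apply: (derive_ge0_le dq) => // r r0; rewrite mulr1.
  apply: (final_arith1 Jneg (J_mono r0 (lexx 0)) (layer_bound r clap W10 th0 HW1)) => //.
  by rewrite mulrA /th mulrC divfK ?lexx// mulf_neq0// gt_eqF.
(* [D] collects the bound on [N] at energy at most 1, the value [q 0] and the lower bound of the
   energy term. The depth [z0] satisfies [a / 2 * z0 = |D| - a / 2 > D], which would give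
   [q z > q 0]. *)
pose D := W2 * (V * 1 + (1 + 1^-1) * 1) + q 0 - K * b.
pose z0 := - (2 * `|D| / - a + 1).
have ma : 0 < - a by rewrite oppr_gt0.
have z00 : z0 <= 0 by rewrite oppr_le0 addr_ge0// divr_ge0 ?mulr_ge0// ltW.
have [z zz0 Ez] := derivative_small
  (fun z z0 => is_derive_flux_grad_self uB sh ph dphi z0) Hb ltr01 z00.
have z_le0 := le_trans zz0 z00.
have E0 := dirichlet_ge0 B sh z sphi.
have E1 : dirichlet B h phi z <= 1.
  by apply: le_trans (ltW Ez); rewrite ler_peMr// lerDl oppr_ge0.
have N1 : N z <= W2 * (V * 1 + (1 + 1^-1) * 1).
  apply: (le_trans (ler_norm _)); apply: (le_trans (layer_bound z csq W20 ltr01 HW2)).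
  by rewrite ler_pM2l// lerD2l ler_pM2l// invr1.
have := q_mono z z_le0; rewrite /q.
have KI : K * b <= K * flux_grad B h phi phi z by rewrite ler_pM2l// Hb.
have z1 : a / 2 * z0 <= a / 2 * z.
  by rewrite ler_nM2l// pmulr_llt0// invr_gt0.
have z2 : a / 2 * z0 = `|D| - a / 2.
  rewrite /z0; move: (`|D|) => n; field; rewrite lt_eqF//.
have Dn := ler_norm D.
rewrite -/(q 0); move: KI z1 z2 Dn N1; rewrite /D.
move: (q 0) (K * b) (K * flux_grad B h phi phi z) (a / 2 * z) (a / 2 * z0) (N z)
  (W2 * _) (`|_|) => ? ? ? ? ? ? ? ?; lra.
Qed.

End Subharmonic.

(** * Mean curvature of a graph *)

Section MeanCurvature.
Context {R : realType} {d : nat} (B : 'M[R]_d) (h : 'rV[R]_d -> R).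
Hypotheses (uB : B \in unitmx) (sh : smooth h) (ph : lattice_periodic B h).
Local Notation L := (torus_integral B).
Local Notation hi i := ('D_(delta_mx 0 i) h).

Definition slope_sq x : R := 1 + \sum_i (hi i x) ^+ 2.

Lemma slope_sq_gt0 x : 0 < slope_sq x.
Proof. by rewrite ltr_pwDl// sumr_ge0// => i _; rewrite sqr_ge0. Qed.

Lemma area_densityE x : area_density h x = Num.sqrt (slope_sq x).
Proof.
rewrite /area_density /dot /slope_sq; congr (Num.sqrt (_ + _)).
by apply: eq_bigr => i _; rewrite mxE.
Qed.

Lemma area_density_gt0 x : 0 < area_density h x.
Proof. by rewrite area_densityE sqrtr_gt0 slope_sq_gt0. Qed.

Lemma sqr_area_density x : area_density h x ^+ 2 = slope_sq x.
Proof. by rewrite area_densityE sqr_sqrtr// ltW// slope_sq_gt0. Qed.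

Let shi i : smooth (hi i) := smooth_derive _ sh.

Let sslope : smooth slope_sq.
Proof.
apply: smooth_add; first exact: smooth_cst.
by apply: smooth_sum => i; exact: smooth_mul.
Qed.

Let w x : R := (Num.sqrt (slope_sq x))^-1.

Let sw : smooth w.
Proof. by apply: smooth_invsqrt => // x; exact: slope_sq_gt0. Qed.

Lemma smooth_area_density : smooth (area_density h).
Proof.
rewrite (_ : area_density h = fun x => Num.sqrt (slope_sq x)).
  by apply: smooth_sqrt => // x; exact: slope_sq_gt0.
by apply/funext => x; exact: area_densityE.
Qed.

Definition unit_slope (i : 'I_d) x : R := (area_density h x)^-1 * hi i x.

Lemma smooth_unit_slope i : smooth (unit_slope i).
Proof.
rewrite (_ : unit_slope i = fun x => w x * hi i x); first exact: smooth_mul.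
by apply/funext => x; rewrite /unit_slope area_densityE.
Qed.

Lemma mean_curvature_div x :
  mean_curvature h x = - \sum_i 'D_(delta_mx 0 i) (unit_slope i) x.
Proof.
rewrite /mean_curvature /div; congr (- _); apply: eq_bigr => i _.
rewrite (_ : (fun z => _) = unit_slope i)//.
by apply/funext => z; rewrite !mxE.
Qed.

Lemma smooth_mean_curvature : smooth (mean_curvature h).
Proof.
rewrite (_ : mean_curvature h = fun x => - \sum_i 'D_(delta_mx 0 i) (unit_slope i) x).
  apply: smooth_opp; apply: smooth_sum => i; apply: smooth_derive.
  exact: smooth_unit_slope.
by apply/funext => x; exact: mean_curvature_div.
Qed.

Lemma lattice_periodic_area_density : lattice_periodic B (area_density h).
Proof.
move=> k x; rewrite !area_densityE /slope_sq; congr (Num.sqrt (_ + _)).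
by apply: eq_bigr => i _; rewrite (lattice_periodic_derive _ ph).
Qed.

Lemma lattice_periodic_unit_slope i : lattice_periodic B (unit_slope i).
Proof.
move=> k x; rewrite /unit_slope lattice_periodic_area_density.
by rewrite (lattice_periodic_derive _ ph).
Qed.

Lemma lattice_periodic_mean_curvature : lattice_periodic B (mean_curvature h).
Proof.
move=> k x; rewrite !mean_curvature_div; congr (- _); apply: eq_bigr => i _.
by rewrite (lattice_periodic_derive _ (@lattice_periodic_unit_slope i)).
Qed.

(** The right side is the first variation of area in the direction [v]. It is used with [v = 1],
    giving zero total curvature, and with [v] the time derivative of [h]. *)
Lemma mean_curvature_by_parts (v : 'rV[R]_d -> R) : smooth v -> lattice_periodic B v ->
  L (fun x => mean_curvature h x * v x) =
  L (fun x => \sum_i unit_slope i x * 'D_(delta_mx 0 i) v x).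
Proof.
move=> sv pv; have su i := @smooth_unit_slope i.
have cu i : continuous (unit_slope i) by exact: smooth_continuous.
have cDv i : continuous ('D_(delta_mx 0 i) v).
  by apply: smooth_continuous; exact: smooth_derive.
have c1 : continuous (fun x => \sum_i unit_slope i x * 'D_(delta_mx 0 i) v x).
  by apply: continuous_sum => i; exact: continuous_mul.
have c2 : continuous (fun x => mean_curvature h x * v x).
  by apply: continuous_mul; apply: smooth_continuous => //; exact: smooth_mean_curvature.
apply/eqP; rewrite eq_sym -subr_eq0 -torus_integralB//; apply/eqP.
rewrite (_ : (fun x => _) = fun x =>
    \sum_i 'D_(delta_mx 0 i) (fun x => unit_slope i x * v x) x); last first.
  apply/funext => x; rewrite mean_curvature_div mulNr opprK mulr_suml -big_split/=.
  apply: eq_bigr => i _; apply: esym.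
  apply: (etrans (derive_mul _ (smooth_differentiable x (su i)) (smooth_differentiable x sv))).
  by congr (_ + _); exact: mulrC.
have suv i : smooth (fun x => unit_slope i x * v x) by exact: smooth_mul.
rewrite torus_integral_sum; last first.
  by move=> i; apply: smooth_continuous; exact: smooth_derive.
rewrite big1// => i _; apply: torus_integral_derive => //; first exact: suv.
by move=> k x; rewrite lattice_periodic_unit_slope pv.
Qed.

Lemma mean_curvature_integral : L (mean_curvature h) = 0.
Proof.
have := mean_curvature_by_parts (smooth_cst 1) (fun _ _ => erefl).
under eq_fun do rewrite mulr1.
move=> ->; rewrite -[RHS](mulr0 `|\det B|) -torus_integral_cst; congr (L _).
by apply/funext => x; rewrite big1// => i _; rewrite derive_cst mulr0.
Qed.

Let mean_curvature_arith (a b s : R) (c e : 'I_d -> R) : s = a ^+ 2 -> a * b = 1 ->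
  - (\sum_i (b * c i - b ^+ 3 * e i)) * a ^+ 3 = - (s * \sum_i c i - \sum_i e i).
Proof.
move=> -> ab; rewrite sumrB -!mulr_sumr; move: (\sum_i c i) (\sum_i e i) => {}c {}e.
have b3 : b ^+ 3 * a ^+ 3 = 1 by rewrite -exprMn mulrC ab expr1n.
have b1 : b * a ^+ 3 = a ^+ 2 by rewrite exprS mulrA [b * a]mulrC ab mul1r.
have -> : - (b * c - b ^+ 3 * e) * a ^+ 3 = - (b * a ^+ 3 * c - b ^+ 3 * a ^+ 3 * e) by ring.
by rewrite b3 b1 mul1r.
Qed.

(** The non-divergence form of the curvature, cleared of denominators so that it can be compared
    with a polynomial expression in the derivatives of [P]. *)
Lemma mean_curvatureE x :
  mean_curvature h x * area_density h x ^+ 3 =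
  - (slope_sq x * \sum_i 'D_(delta_mx 0 i) (hi i) x -
     \sum_i \sum_k hi i x * hi k x * 'D_(delta_mx 0 i) (hi k) x).
Proof.
have dhi i y : differentiable (hi i) y by exact: smooth_differentiable.
have Ds v : 'D_v slope_sq x = 2 * \sum_k hi k x * 'D_v (hi k) x.
  have dsum : differentiable (fun x => \sum_i (hi i x) ^+ 2) x.
    by apply: differentiable_bigsum => i; exact: differentiable_mul.
  rewrite (derive_add v (differentiable_cst (1 : R) x) dsum).
  rewrite derive_cst add0r derive_bigsum; last by move=> i; exact: differentiable_mul.
  rewrite mulr_sumr; apply: eq_bigr => k _.
  apply: (etrans (derive_mul v (dhi k x) (dhi k x))).
  by rewrite -mulr2n mulr_natl.
have [dw Dw] : differentiable w x /\ forall v, 'D_v w x =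
    - (w x ^+ 3 * \sum_k hi k x * 'D_v (hi k) x).
  split=> [|v]; first exact: smooth_differentiable.
  have [_ ->] := derive_invsqrt v (slope_sq_gt0 x) (smooth_differentiable x sslope).
  rewrite Ds -/(w x); move: (w x) (\sum_k _) => a b.
  by field.
have sE : area_density h x * w x = 1.
  by rewrite area_densityE divff// gt_eqF// sqrtr_gt0 slope_sq_gt0.
have Du i : 'D_(delta_mx 0 i) (unit_slope i) x = w x * 'D_(delta_mx 0 i) (hi i) x -
    w x ^+ 3 * \sum_k hi i x * hi k x * 'D_(delta_mx 0 i) (hi k) x.
  have -> : unit_slope i = fun x => w x * hi i x.
    by apply/funext => y; rewrite /unit_slope area_densityE.
  apply: (etrans (derive_mul _ dw (dhi i x))); rewrite Dw.
  rewrite mulrN mulrCA [in X in _ - _ * X]mulr_sumr; congr (_ - _ * _).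
  by apply: eq_bigr => k _; rewrite mulrA.
apply: (etrans _ (mean_curvature_arith
  (fun i => 'D_(delta_mx 0 i) (hi i) x)
  (fun i => \sum_k hi i x * hi k x * 'D_(delta_mx 0 i) (hi k) x)
  (esym (sqr_area_density x)) sE)).
rewrite mean_curvature_div; congr (- _ * _); apply: eq_bigr => i _; exact: Du.
Qed.

End MeanCurvature.

(** * The curvature weighted by the flux of the harmonic extension *)

Section CurvatureFlux.
Context {R : realType} {d : nat} (B : 'M[R]_d) (h : 'rV[R]_d -> R).
Hypotheses (uB : B \in unitmx) (sh : smooth h) (ph : lattice_periodic B h).
Variable phi : 'rV[R]_d * R -> R.
Hypotheses (dphi : decaying_harmonic B h phi) (phi_h : forall x, phi (x, h x) = h x).
Local Notation L := (torus_integral B).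
Local Notation P := (pressure phi).
Local Notation hi i := ('D_(delta_mx 0 i) h).
Local Notation kappa := (mean_curvature h).
Local Notation sigma := (area_density h).

Let sP : smooth P := smooth_pressure dphi.

(** As [P] vanishes on the surface, its gradient there is [- beta] times the conormal, so
    [|grad P| = beta * sigma] once [beta >= 0]. The [+ 0] matches the layer [z = 0]. *)
Let beta x : R := - 'D_(ev None) P (x, h x + 0).

Let trace_derive (G : 'rV[R]_d * R -> R) x i : smooth G ->
  'D_(delta_mx 0 i) (fun x => G (x, h x + 0)) x =
  'D_(ev (Some i)) G (x, h x + 0) + hi i x * 'D_(ev None) G (x, h x + 0).
Proof.
move=> sG; have [_ ->//] := @derive_graph R d G h x (delta_mx 0 i) 0
  (smooth_differentiable _ sG) (smooth_differentiable _ sh).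
Qed.

Let beta_ge0 x : torus_cell B x -> 0 <= beta x.
Proof.
move=> cx; rewrite /beta oppr_ge0 addr0.
exact: (pressure_dy_le0 uB sh ph dphi phi_h cx).
Qed.

Let DP_Some x i : 'D_(ev (Some i)) P (x, h x + 0) = beta x * hi i x.
Proof.
have E : (fun x => P (x, h x + 0)) = fun=> 0.
  by apply/funext => y; rewrite addr0 (pressure_graph phi_h).
have := trace_derive x i sP.
move=> /(etrans (esym (congr1 (fun k => 'D_(delta_mx 0 i) k x) E))).
rewrite derive_cst => /esym/eqP; rewrite addr_eq0 => /eqP ->.
by rewrite /beta mulNr mulrC.
Qed.

Let DPE x j : 'D_(ev j) P (x, h x + 0) = - (beta x * conormal h j x).
Proof.
case: j => [i|]; first by rewrite DP_Some /= mulrN opprK.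
by rewrite /= mulr1 /beta opprK.
Qed.

Let cbeta : continuous beta.
Proof.
by apply: continuous_opp; exact: (continuous_layer_derive sh).
Qed.

Let conormal_sq x : \sum_j conormal h j x ^+ 2 = slope_sq h x.
Proof.
rewrite sum_option /= expr1n /slope_sq; congr (_ + _).
by apply: eq_bigr => i _; rewrite sqrrN.
Qed.

Lemma conormal_derivative x :
  \sum_j conormal h j x * 'D_(ev j) phi (x, h x + 0) = 1 - beta x * slope_sq h x.
Proof.
have E j : 'D_(ev j) phi (x, h x + 0) = (ev j).2 - beta x * conormal h j x.
  have := derive_pressure_at dphi (ev j) (x, h x + 0); rewrite DPE => /eqP.
  by rewrite eq_sym subr_eq => /eqP ->; rewrite addrC.
under eq_bigr do rewrite E mulrBr.
rewrite sumrB; congr (_ - _).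
  by rewrite sum_option /= mul1r big1 ?addr0// => i _; rewrite mulr0.
rewrite -conormal_sq mulr_sumr; apply: eq_bigr => j _.
by rewrite mulrCA expr2.
Qed.

Let grad_sq_trace x : grad_sq P (x, h x + 0) = beta x ^+ 2 * slope_sq h x.
Proof.
rewrite /grad_sq -conormal_sq mulr_sumr; apply: eq_bigr => j _.
by rewrite DPE sqrrN exprMn.
Qed.

Let hess_sum (I : finType) (nu : option I -> R) (D : option I -> option I -> R)
    (hh X : I -> R) :
  nu None = 1 -> (forall i, nu (Some i) = - hh i) ->
  (forall i, D None (Some i) = X i) -> (forall i, D (Some i) None = X i) ->
  \sum_j \sum_k nu j * nu k * D j k = D None None - 2 * (\sum_k hh k * X k) +
    \sum_i \sum_k hh i * hh k * D (Some i) (Some k).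
Proof.
move=> n0 n1 D1 D2; rewrite sum_option sum_option n0 !mul1r.
have e1 : \sum_i 1 * nu (Some i) * D None (Some i) = - \sum_k hh k * X k.
  by rewrite -sumrN; apply: eq_bigr => i _; rewrite n1 D1 mul1r mulNr.
have e2 : \sum_i \sum_k nu (Some i) * nu k * D (Some i) k = - (\sum_k hh k * X k) +
    \sum_i \sum_k hh i * hh k * D (Some i) (Some k).
  rewrite -sumrN -big_split/=; apply: eq_bigr => i _.
  rewrite sum_option n0 n1 D2 mulr1 mulNr; congr (_ + _).
  by apply: eq_bigr => k _; rewrite n1 mulrNN.
rewrite e1 e2; move: (\sum_k hh k * X k) (\sum_i \sum_k _) (D None None) => a b c; ring.
Qed.

(** The hypotheses are the tangential derivatives of [d_i P = beta * d_i h] and of [beta], and the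
    Laplace equation. Taking the trace of the first, and contracting it with [grad h] twice, gives
    two scalar identities from which the derivatives [bk] of [beta] are eliminated. *)
Let hess_arith (I : finType) (hh X bk : I -> R) (A H : I -> I -> R) (b Y : R) :
  (forall i k, A k i + hh k * X i = b * H k i + hh i * bk k) ->
  (forall k, bk k = - (X k + hh k * Y)) ->
  Y + \sum_i A i i = 0 ->
  Y - 2 * (\sum_k hh k * X k) + \sum_i \sum_k hh i * hh k * A i k =
  - b * ((1 + \sum_k hh k ^+ 2) * (\sum_i H i i) - \sum_i \sum_k hh i * hh k * H i k).
Proof.
move=> E1 E2 E3.
set X' := \sum_k hh k * X k; set n := \sum_k hh k ^+ 2.
set Z := \sum_i \sum_k hh i * hh k * A i k.
set Lp := \sum_i H i i; set Hh := \sum_i \sum_k hh i * hh k * H i k.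
pose b' := \sum_k hh k * bk k.
have F1 : \sum_i A i i + X' = b * Lp + b'.
  rewrite /X' /Lp /b' mulr_sumr -!big_split/=; apply: eq_bigr => i _; exact: E1.
have F2 : Z + n * X' = b * Hh + n * b'.
  have e1 : n * X' = \sum_i \sum_k hh i * hh k * (hh i * X k).
    rewrite /n /X' mulr_suml; apply: eq_bigr => i _; rewrite mulr_sumr.
    by apply: eq_bigr => k _; ring.
  have e2 : n * b' = \sum_i \sum_k hh i * hh k * (hh k * bk i).
    rewrite mulrC /n /b' mulr_suml; apply: eq_bigr => i _; rewrite mulr_sumr.
    by apply: eq_bigr => k _; ring.
  rewrite e1 e2 /Z /Hh mulr_sumr -!big_split/=; apply: eq_bigr => i _.
  rewrite mulr_sumr -!big_split/=; apply: eq_bigr => k _.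
  by rewrite -mulrDr E1 mulrDr mulrCA.
have F3 : b' = - (X' + n * Y).
  rewrite /b' /X' /n mulr_suml -big_split/= -sumrN; apply: eq_bigr => k _.
  by rewrite E2; ring.
move: F1 F2 F3 E3.
move: (\sum_i A i i) X' n Z Lp Hh b' => S X' n Z Lp Hh b' F1 F2 F3 E3.
have hY : Y = - S by apply/eqP; rewrite -addr_eq0 E3.
have hZ : Z = b * Hh + n * b' - n * X' by rewrite -F2 addrK.
have hS : S = b * Lp + b' - X' by rewrite -F1 addrK.
have hb : b' + X' + n * Y = 0 by rewrite F3; ring.
have -> : Y - 2 * X' + Z = - b * ((1 + n) * Lp - Hh) + (b' + X' + n * Y) * -1
    + (1 + n) * (b * Lp + b' - X' + Y).
  by rewrite hZ; ring.
by rewrite hb -hS hY addrC subrr; ring.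
Qed.

(** The conormal is [sigma] times the unit normal, so the left side is [sigma^2] times the second
    normal derivative of [P]. The identity expresses that [P] is harmonic and zero on the surface:
    the boundary condition is differentiated twice tangentially. *)
Lemma second_fundamental_form x :
  \sum_j \sum_k conormal h j x * conormal h k x * 'D_(ev j) ('D_(ev k) P) (x, h x + 0)
  = beta x * (kappa x * sigma x ^+ 3).
Proof.
have sDP k : smooth ('D_(ev k) P) by exact: smooth_derive.
have Dbeta k : 'D_(delta_mx 0 k) beta x =
    - ('D_(ev (Some k)) ('D_(ev None) P) (x, h x + 0) +
       hi k x * 'D_(ev None) ('D_(ev None) P) (x, h x + 0)).
  have [dt Et] := @derive_graph R d ('D_(ev None) P) h x (delta_mx 0 k) 0
    (smooth_differentiable _ (sDP None)) (smooth_differentiable _ sh).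
  exact: (etrans (derive_opp _ dt) (congr1 -%R Et)).
have dbeta : differentiable beta x.
  have [dt _] := @derive_graph R d ('D_(ev None) P) h x 0 0
    (smooth_differentiable _ (sDP None)) (smooth_differentiable _ sh).
  exact: differentiable_opp.
have E1 i k : 'D_(ev (Some k)) ('D_(ev (Some i)) P) (x, h x + 0) +
    hi k x * 'D_(ev (Some i)) ('D_(ev None) P) (x, h x + 0) =
    beta x * 'D_(delta_mx 0 k) (hi i) x + hi i x * 'D_(delta_mx 0 k) beta x.
  have F : (fun x => 'D_(ev (Some i)) P (x, h x + 0)) = fun x => beta x * hi i x.
    by apply/funext => y; exact: DP_Some.
  have T := trace_derive x k (sDP (Some i)).
  have sy : 'D_(ev None) ('D_(ev (Some i)) P) (x, h x + 0) =
     'D_(ev (Some i)) ('D_(ev None) P) (x, h x + 0).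
    by apply: derive_comm; exact: sP.
  rewrite sy in T; rewrite -T.
  apply: (etrans (congr1 (fun g => 'D_(delta_mx 0 k) g x) F)).
  exact: (derive_mul _ dbeta (smooth_differentiable x (smooth_derive _ sh))).
have E3 : 'D_(ev None) ('D_(ev None) P) (x, h x + 0) +
    \sum_i 'D_(ev (Some i)) ('D_(ev (Some i)) P) (x, h x + 0) = 0.
  have [_ _ _ H] := dphi; have := H x 0 (lexx 0); rewrite sum_option => E0.
  have D2 j : 'D_(ev j) ('D_(ev j) P) (x, h x + 0) = 'D_(ev j) ('D_(ev j) phi) (x, h x + 0).
    exact: (derive2_pressure dphi).
  exact: (etrans (congr2 +%R (D2 None) (eq_bigr _ (fun i _ => D2 (Some i)))) E0).
have := hess_arith E1 Dbeta E3.
rewrite -/(slope_sq h x) => E.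
transitivity (- beta x * (slope_sq h x * \sum_i 'D_(delta_mx 0 i) (hi i) x -
     \sum_i \sum_k hi i x * hi k x * 'D_(delta_mx 0 i) (hi k) x)); last first.
  by rewrite (mean_curvatureE sh x) mulrN mulNr.
apply: (etrans _ E).
have sy i : 'D_(ev None) ('D_(ev (Some i)) P) (x, h x + 0) =
    'D_(ev (Some i)) ('D_(ev None) P) (x, h x + 0).
  by apply: derive_comm; exact: sP.
exact: (@hess_sum _ (fun j => conormal h j x)
  (fun j k => 'D_(ev j) ('D_(ev k) P) (x, h x + 0))
  (fun i => hi i x) (fun i => 'D_(ev (Some i)) ('D_(ev None) P) (x, h x + 0))
  erefl (fun=> erefl) sy (fun=> erefl)).
Qed.

(** With [p = b * s], the value of [|grad P|], the two sides differ through [p * (f - p) / f], which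
    lies between [0] and [f - p <= e]. This is the cost of regularizing [|grad P|]. *)
Let reg_arith (k b s e f : R) : 0 <= b -> 0 < s -> 0 < e -> 0 < f ->
  f ^+ 2 = e ^+ 2 + b ^+ 2 * s ^+ 2 ->
  - (b * f^-1) * (b * (k * s ^+ 3)) <= - (k * (b * s ^+ 2)) + e * (`|k| * s).
Proof.
move=> b0 s0 e0 f0 fE; pose p := b * s.
have p0 : 0 <= p by rewrite mulr_ge0// ltW.
have fE' : f ^+ 2 = e ^+ 2 + p ^+ 2 by rewrite fE exprMn.
have pf : p <= f by rewrite -ler_sqr ?nnegrE ?(ltW f0)// fE' lerDr sqr_ge0.
have fpe : f <= p + e.
  rewrite -ler_sqr ?nnegrE ?(ltW f0)// ?addr_ge0 ?(ltW e0)//.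
  rewrite fE' -subr_ge0 (_ : _ - _ = 2 * (p * e)); last by ring.
  by rewrite !mulr_ge0// ltW.
have fp0 : 0 <= f - p by rewrite subr_ge0.
have D0 : 0 <= p * (f - p) / f := divr_ge0 (mulr_ge0 p0 fp0) (ltW f0).
have De : p * (f - p) / f <= e.
  apply: (@le_trans _ _ (f - p)); last by rewrite lerBlDl.
  by rewrite ler_pdivrMr// mulrC ler_wpM2l.
have -> : - (b * f^-1) * (b * (k * s ^+ 3)) =
    - (k * (b * s ^+ 2)) + p * (f - p) / f * (k * s).
  by rewrite /p; field; rewrite gt_eqF.
rewrite lerD2l; apply: (@le_trans _ _ (p * (f - p) / f * (`|k| * s))).
  by rewrite ler_wpM2l// ler_pM2r// ler_norm.
by rewrite ler_wpM2r// mulr_ge0// ltW.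
Qed.

Lemma flux_curvature_ge0 :
  0 <= L (fun x => kappa x * \sum_j conormal h j x * 'D_(ev j) phi (x, h x + 0)).
Proof.
have ck : continuous kappa by apply: smooth_continuous; exact: smooth_mean_curvature.
have cs : continuous sigma by apply: smooth_continuous; exact: smooth_area_density.
have cb : continuous (fun x => kappa x * (beta x * sigma x ^+ 2)).
  by apply: continuous_mul => //; apply: continuous_mul => //; exact: continuous_mul.
have cn : continuous (fun x => `|kappa x| * sigma x).
  by apply: continuous_mul => //; exact: continuous_norm.
(* Here the total curvature splits off and integrates to zero; what remains is the unregularized
   flux of [grad |grad P|]. *)
rewrite (_ : (fun x => _) = fun x => kappa x - kappa x * (beta x * sigma x ^+ 2)); last first.
  by apply/funext => x; rewrite conormal_derivative sqr_area_density mulrBr mulr1.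
rewrite torus_integralB// (mean_curvature_integral uB sh ph) sub0r -torus_integralN//.
pose C := L (fun x => `|kappa x| * sigma x).
have C0 : 0 <= C.
  apply: torus_integral_ge0 => // x _; rewrite mulr_ge0//.
  by apply: ltW; exact: area_density_gt0.
have key e : 0 < e -> 0 <= L (fun x => - (kappa x * (beta x * sigma x ^+ 2))) + e * C.
  move=> e0; apply: (le_trans (reg_flux_ge0 uB sh ph dphi e0)).
  have cne : continuous (fun x => e * (`|kappa x| * sigma x)).
    by apply: continuous_mul => //; exact: continuous_cst.
  have cbN : continuous (fun x => - (kappa x * (beta x * sigma x ^+ 2))).
    exact: continuous_opp.
  rewrite /C -torus_integralZ// -torus_integralD//.
  apply: le_torus_integral.
  - apply: continuous_sum => j; apply: continuous_mul.
      by apply: continuous_conormal; exact: sh.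
    apply: (continuous_layer_derive sh); exact: (smooth_reg_norm dphi).
  - exact: continuous_add.
  move=> x cx.
  have f0 := reg_norm_gt0 phi e0 (x, h x + 0).
  have -> : \sum_j conormal h j x * 'D_(ev j) (reg_norm phi e) (x, h x + 0) =
      - (beta x * (reg_norm phi e (x, h x + 0))^-1) * (beta x * (kappa x * sigma x ^+ 3)).
    rewrite -second_fundamental_form mulr_sumr; apply: eq_bigr => j _.
    rewrite (derive_reg_norm dphi e0) mulrCA !mulr_sumr; apply: eq_bigr => k _.
    rewrite DPE; move: ('D_(ev j) _ _) (_^-1) (conormal h j x) (conormal h k x) (beta x).
    by move=> a1 a2 a3 a4 a5; ring.
  apply: reg_arith => //.
  - exact: beta_ge0.
  - exact: area_density_gt0.
  - by rewrite (sqr_reg_norm phi e0) /reg_sq grad_sq_trace sqr_area_density.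
apply/ler_addgt0Pr => e e0.
(* Dividing by [C + 1] rather than [C] allows zero curvature. *)
have C10 : 0 < C + 1 by rewrite ltr_wpDl.
apply: (le_trans (key (e / (C + 1)) (divr_gt0 e0 C10))); rewrite lerD2l.
by rewrite mulrAC ler_pdivrMr// ler_pM2l// lerDl.
Qed.

End CurvatureFlux.

(** * Time derivatives *)

Section TimeSlices.
Context {R : realType} {d : nat}.
Implicit Types H : R * 'rV[R]_d -> R.

Lemma derive_slice H (t : R) v x :
  'D_v (fun x => H (t, x)) x = 'D_(0, v) H (t, x).
Proof.
have E : (fun r : R => r^-1 *: (((fun x => H (t, x)) \o shift x) (r *: v) - H (t, x))) =
    (fun r : R => r^-1 *: ((H \o shift (t, x)) (r *: (0 : R, v)) - H (t, x))).
  apply/funext => r /=; congr (_ *: (H _ - _)).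
  by rewrite -[RHS]/(r * 0 + t, r *: v + x) mulr0 add0r.
by rewrite /derive E.
Qed.

Lemma smooth_slice H (t : R) : smooth H -> smooth (fun x => H (t, x)).
Proof.
move=> + k; elim: k H => [|k IH] H sH.
  apply: (continuous_of_comp _ (smooth_continuous sH) (f := fun x : 'rV[R]_d => (t, x))).
  by apply: continuous_pairing; [exact: continuous_cst|exact: continuous_idfun].
split=> [x|v].
  have dp : differentiable (fun x : 'rV[R]_d => (t, x)) x.
    by apply: differentiable_pair => //; exact: differentiable_cst.
  exact: (differentiable_comp dp (smooth_differentiable (t, x) sH)).
rewrite (_ : 'D_v _ = fun x => 'D_(0, v) H (t, x)).
  exact: (IH ('D_(0, v) H) (smooth_derive _ sH)).
by apply/funext => x; exact: derive_slice.
Qed.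

Lemma is_derive_time H x (s : R) : smooth H ->
  is_derive s 1 (fun s => H (s, x)) ('D_(1, 0) H (s, x)).
Proof.
move=> sH.
have E (r : R) : (r, x) = (0, x) + r *: (1 : R, 0 : 'rV[R]_d).
  by rewrite -[RHS]/(0 + r * 1, x + r *: 0) mulr1 add0r scaler0 addr0.
rewrite E; under eq_fun do rewrite E.
by apply: differentiable_line; exact: smooth_differentiable.
Qed.

Lemma lattice_periodic_time_derive (B : 'M[R]_d) H t :
  (forall t, lattice_periodic B (fun x => H (t, x))) ->
  lattice_periodic B (fun x => 'D_(1, 0) H (t, x)).
Proof.
move=> pH i x.
have E : (fun r : R => r^-1 *: ((H \o shift (t, x + row i B)) (r *: (1 : R, 0 : 'rV[R]_d))
      - H (t, x + row i B))) =
    (fun r : R => r^-1 *: ((H \o shift (t, x)) (r *: (1 : R, 0 : 'rV[R]_d)) - H (t, x))).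
  apply/funext => r /=; rewrite pH; congr (_ *: (_ - _)).
  rewrite -[in LHS]/(H (r * 1 + t, r *: 0 + (x + row i B))) addrA.
  exact: pH.
by rewrite /derive E.
Qed.

Lemma continuous_slices (f : R * 'rV[R]_d -> R) : continuous f ->
  continuous (fun p : R * 'rV[R]_d => f (p.1, p.2)).
Proof.
move=> cf; rewrite (_ : (fun p => _) = f)//.
by apply/funext => -[].
Qed.

End TimeSlices.

(** * The Dirichlet-to-Neumann operator as a flux density *)

Section DirichletNeumann.
Context {R : realType} {d : nat} (B : 'M[R]_d) (h : 'rV[R]_d -> R).
Hypotheses (sh : smooth h).
Local Notation L := (torus_integral B).

Lemma dirichlet_neumannE (phi : 'rV[R]_d * R -> R) x :
  dy phi (x, h x) - dot (grad h x) (\row_i dx i phi (x, h x)) =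
  \sum_j conormal h j x * 'D_(ev j) phi (x, h x + 0).
Proof.
rewrite addr0 sum_option /= mul1r -sumrN; congr (_ + _).
by rewrite /dot; apply: eq_bigr => i _; rewrite !mxE mulNr.
Qed.

Lemma flux_gradE (psi : 'rV[R]_d -> R) (phi1 phi2 : 'rV[R]_d * R -> R) :
  (forall x, phi1 (x, h x) = psi x) ->
  flux_grad B h phi1 phi2 0 =
  L (fun x => psi x * \sum_j conormal h j x * 'D_(ev j) phi2 (x, h x + 0)).
Proof.
move=> tr; congr (L _); apply/funext => x; rewrite mulr_sumr; apply: eq_bigr => j _.
by rewrite mulrCA addr0 tr.
Qed.

Lemma continuous_dirichlet_neumann (phi : 'rV[R]_d * R -> R) : smooth phi ->
  continuous (fun x => \sum_j conormal h j x * 'D_(ev j) phi (x, h x + 0)).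
Proof.
move=> sphi; apply: continuous_sum => j; apply: continuous_mul.
  by apply: continuous_conormal; exact: sh.
exact: (continuous_layer_derive sh).
Qed.

End DirichletNeumann.

Theorem theorem2p1 (R : realType) (d : nat) (d_ge1 : (1 <= d)%N)
    (B : 'M[R]_d) (B_unit : B \in unitmx)
    (g mu T : R) (g_ge0 : 0 <= g) (mu_ge0 : 0 <= mu) (T_gt0 : 0 < T)
    (h : R * 'rV[R]_d -> R)
    (h_smooth : smooth h)
    (h_periodic : forall t, lattice_periodic B (fun x => h (t, x)))
    (G : ('rV[R]_d -> R) -> ('rV[R]_d -> R) -> 'rV[R]_d -> R)
    (G_DN : forall t, 0 <= t <= T ->
       is_dirichlet_to_neumann B (fun x => h (t, x)) (G (fun x => h (t, x))))
    (h_eqn : forall t x, 0 <= t <= T ->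
       'D_(1 : R, 0 : 'rV[R]_d) h (t, x)
       + G (fun z => h (t, z))
           (fun z => g * h (t, z) + mu * mean_curvature (fun w => h (t, w)) z) x
       = 0) :
  forall t, 0 <= t <= T ->
    (derivable (fun s => torus_integral B (fun x => h (s, x) ^+ 2)) t 1
     /\ derive1 (fun s => torus_integral B (fun x => h (s, x) ^+ 2)) t <= 0)
    /\
    (derivable
       (fun s => torus_integral B (area_density (fun x => h (s, x)))) t 1
     /\ derive1
          (fun s => torus_integral B (area_density (fun x => h (s, x)))) t <= 0).
Proof.
move=> t t0T; set ht := fun x => h (t, x).
have sh : smooth ht by exact: smooth_slice.
have pht : lattice_periodic B ht := h_periodic t.
pose kappa := mean_curvature ht.
have sk : smooth kappa := smooth_mean_curvature sh.
have pk : lattice_periodic B kappa := lattice_periodic_mean_curvature pht.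
pose psi x := g * ht x + mu * kappa x.
have spsi : smooth psi.
  by apply: smooth_add; apply: smooth_mul => //; exact: smooth_cst.
have ppsi : lattice_periodic B psi by move=> i x; rewrite /psi pht pk.
have DN := G_DN t t0T; rewrite -/ht in DN.
(* Harmonic extensions of all three functions are needed, since symmetry pairs that of [psi] with
   those of [h] and [kappa]. *)
have [phih exh _] := DN ht sh pht.
have [phik exk _] := DN kappa sk pk.
have [phip exp Gp] := DN psi spsi ppsi.
have dh := harmonic_extension_decaying sh exh.
have dk := harmonic_extension_decaying sh exk.
have dp := harmonic_extension_decaying sh exp.
have [_ _ _ trh] := exh; have [_ _ _ trk] := exk; have [_ _ _ trp] := exp.
have [[sphih _] _ _ _] := exh; have [[sphik _] _ _ _] := exk.
have [[sphip _] _ _ _] := exp.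
pose N (phi : 'rV[R]_d * R -> R) x : R :=
  \sum_j conormal ht j x * 'D_(ev j) phi (x, ht x + 0).
have cN phi : smooth phi -> continuous (N phi) by exact: continuous_dirichlet_neumann.
have cht : continuous ht := smooth_continuous sh.
have ckap : continuous kappa := smooth_continuous sk.
pose L := torus_integral B.
have FE ps phi1 phi2 : (forall x, phi1 (x, ht x) = ps x) ->
    flux_grad B ht phi1 phi2 0 = L (fun x => ps x * N phi2 x) by exact: flux_gradE.
have hNh : 0 <= L (fun x => ht x * N phih x).
  by rewrite -(FE _ _ phih trh); exact: (flux_grad_self_ge0 B_unit sh pht dh).
have kNk : 0 <= L (fun x => kappa x * N phik x).
  by rewrite -(FE _ _ phik trk); exact: (flux_grad_self_ge0 B_unit sh pht dk).
have kNh : 0 <= L (fun x => kappa x * N phih x).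
  exact: (flux_curvature_ge0 B_unit sh pht dh trh).
have psiN phi : smooth phi -> L (fun x => psi x * N phi x) =
    g * L (fun x => ht x * N phi x) + mu * L (fun x => kappa x * N phi x).
  move=> sphi; have cNp := cN phi sphi.
  have c1 : continuous (fun x => ht x * N phi x) by exact: continuous_mul.
  have c2 : continuous (fun x => kappa x * N phi x) by exact: continuous_mul.
  rewrite /L -!torus_integralZ// -torus_integralD; last 2 first.
  - by apply: continuous_mul => //; exact: continuous_cst.
  - by apply: continuous_mul => //; exact: continuous_cst.
  by congr (torus_integral B _); apply/funext => x; rewrite /psi mulrDl !mulrA.
have hNk : L (fun x => ht x * N phik x) = L (fun x => kappa x * N phih x).
  rewrite -(FE _ _ phik trh) -(FE _ _ phih trk).
  exact: (flux_grad_sym B_unit sh pht dh dk).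
have hNp : 0 <= L (fun x => ht x * N phip x).
  (* Symmetry moves the operator onto [h]: [int h G(psi) = g int h G(h) + mu int kappa G(h)],
     writing [G] for the operator at time [t]. *)
  rewrite -(FE _ _ phip trh) (flux_grad_sym B_unit sh pht dh dp).
  by rewrite (FE _ _ phih trp) psiN// addr_ge0// mulr_ge0.
have kNp : 0 <= L (fun x => kappa x * N phip x).
  (* Likewise [int kappa G(psi) = g int h G(kappa) + mu int kappa G(kappa)], and [hNk] turns the
     first integral into [int kappa G(h)]. *)
  rewrite -(FE _ _ phip trk) (flux_grad_sym B_unit sh pht dk dp).
  by rewrite (FE _ _ phik trp) psiN// hNk addr_ge0// mulr_ge0.
pose v x := 'D_(1 : R, 0 : 'rV[R]_d) h (t, x).
have vE : v = fun x => - N phip x.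
  apply/funext => x; have := h_eqn t x t0T; rewrite -/(v x) Gp.
  by rewrite dirichlet_neumannE => /eqP; rewrite addr_eq0 => /eqP.
(* As a slice of a derivative of [h], the velocity is an admissible direction in the first variation
   of area. *)
have sv : smooth v := smooth_slice t (smooth_derive _ h_smooth).
have pv : lattice_periodic B v by exact: lattice_periodic_time_derive.
have c_slice (H : R * 'rV[R]_d -> R) s : smooth H -> continuous (fun x : 'rV[R]_d => H (s, x)).
  by move=> sH; exact: smooth_continuous (smooth_slice s sH).
have D1 : is_derive t 1 (fun s => torus_integral B (fun x => h (s, x) ^+ 2))
    (- (2 * L (fun x => ht x * N phip x))).
  have sq : smooth (fun p => h p ^+ 2) by exact: smooth_mul.
  apply: (is_derive_eq (@is_derive_torus_integral R d B (fun s x => h (s, x) ^+ 2)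
    (fun s x => 'D_(1, 0) (fun p => h p ^+ 2) (s, x)) t _ _ _)).
  - by move=> s; exact: (c_slice (fun p => h p ^+ 2)).
  - by move=> x s; exact: (@is_derive_time R d (fun p => h p ^+ 2)).
  - exact: (continuous_slices (smooth_continuous (smooth_derive (1 : R, 0 : 'rV[R]_d) sq))).
  have cp : continuous (fun x => ht x * N phip x).
    by apply: continuous_mul => //; exact: cN.
  rewrite -mulNr /L -torus_integralZ//; congr (torus_integral B _).
  apply/funext => x; have dhx := smooth_differentiable (t, x) h_smooth.
  apply: (etrans (derive_mul _ dhx dhx)); rewrite -/(v x) vE /=.
  by rewrite -/(ht x); move: (ht x) (N phip x) => a b; ring.
(* The slopes are taken on space-time, so that the area density is jointly smooth in time and
   position and can be differentiated under the integral. *)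
pose hj i := 'D_(0 : R, delta_mx 0 i : 'rV[R]_d) h.
pose S p := 1 + \sum_i (hj i p) ^+ 2.
have S0 p : 0 < S p by rewrite ltr_pwDl// sumr_ge0// => i _; rewrite sqr_ge0.
have shj i : smooth (hj i) by exact: smooth_derive.
have sS : smooth S.
  apply: smooth_add; first exact: smooth_cst.
  by apply: smooth_sum => i; exact: smooth_mul.
have sA : smooth (fun p => Num.sqrt (S p)) by exact: smooth_sqrt.
have areaE s x : area_density (fun x => h (s, x)) x = Num.sqrt (S (s, x)).
  rewrite area_densityE /slope_sq /S; congr (Num.sqrt (_ + _)).
  by apply: eq_bigr => i _; rewrite derive_slice.
have D2 : is_derive t 1 (fun s => torus_integral B (area_density (fun x => h (s, x))))
    (- L (fun x => kappa x * N phip x)).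
  rewrite (_ : (fun s => torus_integral B _) =
      fun s => torus_integral B (fun x => Num.sqrt (S (s, x)))); last first.
    by apply/funext => s; congr (torus_integral B _); apply/funext => x; exact: areaE.
  apply: (is_derive_eq (@is_derive_torus_integral R d B (fun s x => Num.sqrt (S (s, x)))
    (fun s x => 'D_(1, 0) (fun p => Num.sqrt (S p)) (s, x)) t _ _ _)).
  - by move=> s; exact: (c_slice (fun p => Num.sqrt (S p))).
  - by move=> x s; exact: (@is_derive_time R d (fun p => Num.sqrt (S p))).
  - exact: (continuous_slices (smooth_continuous (smooth_derive (1 : R, 0 : 'rV[R]_d) sA))).
  have cp : continuous (fun x => kappa x * N phip x).
    by apply: continuous_mul => //; exact: cN.
  (* The derivative of the area density is the scalar product of [unit_slope] and [grad v];
     integrating by parts gives [kappa * v], and the equation gives [v = - G(psi)]. *)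
  transitivity (L (fun x => kappa x * v x)); last first.
    rewrite /L -torus_integralN//; congr (torus_integral B _); apply/funext => x.
    by rewrite vE mulrN.
  rewrite /L /kappa (mean_curvature_by_parts B_unit sh pht sv pv).
  congr (torus_integral B _); apply/funext => x.
  rewrite derive_sqrt//; last exact: smooth_differentiable.
  have dhj i p : differentiable (hj i) p by exact: smooth_differentiable.
  have dsum : differentiable (fun p => \sum_i (hj i p) ^+ 2) (t, x).
    by apply: differentiable_bigsum => i; exact: differentiable_mul.
  rewrite (derive_add _ (differentiable_cst (1 : R) (t, x)) dsum) derive_cst add0r.
  rewrite derive_bigsum; last by move=> i; exact: differentiable_mul.
  rewrite -areaE mulr_sumr; apply: eq_bigr => i _.
  have E1 : hj i (t, x) = 'D_(delta_mx 0 i) ht x by rewrite derive_slice.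
  have E2 : 'D_(1, 0) (hj i) (t, x) = 'D_(delta_mx 0 i) v x.
    (* Time and space derivatives of [h] are exchanged to expose the spatial gradient of the
       velocity. *)
    apply: (etrans (derive_comm (t, x) _ _ (h_smooth 2%N))).
    exact: esym (derive_slice ('D_(1, 0) h) t _ x).
  rewrite (derive_mul _ (dhj i (t, x)) (dhj i (t, x))) E1 E2 /unit_slope -/ht.
  move: ('D_(delta_mx 0 i) ht x) ('D_(delta_mx 0 i) v x) ((area_density ht x)^-1) => a b c.
  by field.
split; split.
- by have [] := D1.
- rewrite derive1E; have [_ ->] := D1.
  by rewrite oppr_le0 mulr_ge0.
- by have [] := D2.
- by rewrite derive1E; have [_ ->] := D2; rewrite oppr_le0.
Qed.
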